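(* Let $\mu>0$ and let $f:\mathbb R\to\mathbb R$ be continuous with $f(u)\ge0$ for $u\ge0$ and $f(u)=0$ for $u\le0$, such that there is $q\in(2,6)$ with $\lim_{u\to\infty}f(u)/u^{q-1}=0$, and $\lim_{u\to0}f(u)/u=0$. Then any minimising sequence for $E_\mu$ on $\mathcal M_{\mathrm{rad},\mu}$ is convergent. So $\mathfrak m_{\mathrm{rad},\mu}:=\inf_{\mathcal M_{\mathrm{rad},\mu}}E_\mu$ is achieved on a radial function $\mathfrak u$, and moreover $$\mathfrak m_{\mathrm{rad},\mu}=\mathfrak m_\mu=\min_{u\in\mathcal M_\mu}E_\mu(u)=E_\mu(\mathfrak u)>0,$$ where $\mathfrak m_\mu:=\inf_{\mathcal M_\mu}E_\mu$. Finally $\mathfrak u$ is negative (i.e. $\mathfrak u\le0$) and hence $E_\mu(\mathfrak u)=\frac12\|\mathfrak u\|_\mu^2$.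
   Context: $F(t)=\int_0^tf(s)\,ds$. $H^1_\mu(\mathbb R^3)$ is $H^1(\mathbb R^3)$ with norm $\|u\|_\mu^2=\int|\nabla u|^2+\mu\int u^2$; $H^1_{\mathrm{rad},\mu}(\mathbb R^3)$ is its subspace of radial functions. For $u\in H^1(\mathbb R^3)$, $\phi_u(x)=\int_{\mathbb R^3}\frac{1-e^{-|x-y|}}{|x-y|}u^2(y)\,dy$. $E_\mu(u)=\frac12\|u\|_\mu^2+\int F(u)$, $\mathcal M_\mu=\{u\in H^1_\mu(\mathbb R^3):\int\phi_uu^2=1\}$, $\mathcal M_{\mathrm{rad},\mu}=\mathcal M_\mu\cap H^1_{\mathrm{rad},\mu}(\mathbb R^3)$.
   Formalization: ''Any minimising sequence is convergent'' is stated as: every minimising sequence has a subsequence converging in H^1_mu; the literal claim fails for f=0, where alternating a minimiser u with -u gives a non-convergent minimising sequence. *)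

(* Defs.v *)
From HB Require Import structures.
From mathcomp Require Import all_boot all_order all_algebra.
From mathcomp Require Import all_classical all_reals all_analysis.
Set Implicit Arguments. Unset Strict Implicit. Unset Printing Implicit Defensive.
Import Order.TTheory GRing.Theory Num.Theory.
Import numFieldNormedType.Exports.
Local Open Scope classical_set_scope.
Local Open Scope ring_scope.

Section Defs.
Variable R : realType.

Definition R3 := ((R * R) * R)%type.

Definition leb3 := ((@lebesgue_measure R \x @lebesgue_measure R) \x @lebesgue_measure R)%E.

Definition enorm3 (x : R3) : R := Num.sqrt (x.1.1 ^+ 2 + x.1.2 ^+ 2 + x.2 ^+ 2).
Definition sub3 (x y : R3) : R3 := ((x.1.1 - y.1.1, x.1.2 - y.1.2), x.2 - y.2).

Definition coord_line (i : 'I_3) (x : R3) (t : R) : R3 :=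
  if val i == 0%N then ((t, x.1.2), x.2)
  else if val i == 1%N then ((x.1.1, t), x.2)
  else ((x.1.1, x.1.2), t).
Definition coord (i : 'I_3) (x : R3) : R :=
  if val i == 0%N then x.1.1 else if val i == 1%N then x.1.2 else x.2.

Definition pderiv (i : 'I_3) (f : R3 -> R) : R3 -> R :=
  fun x => derive1 (fun t => f (coord_line i x t)) (coord i x).
Definition pderivable (i : 'I_3) (f : R3 -> R) (x : R3) : Prop :=
  derivable (fun t => f (coord_line i x t)) (coord i x) 1.

Definition iter_pderiv (l : seq 'I_3) (f : R3 -> R) : R3 -> R :=
  foldr pderiv f l.

Definition test_fun (phi : R3 -> R) : Prop :=
  (forall l : seq 'I_3, continuous (iter_pderiv l phi) /\
     forall i x, pderivable i (iter_pderiv l phi) x) /\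
  compact (closure [set x | phi x != 0]).

Definition L2 (u : R3 -> R) : Prop :=
  measurable_fun setT u /\ (\int[leb3]_x ((u x) ^+ 2)%:E < +oo)%E.

Definition weak_pderiv (i : 'I_3) (u g : R3 -> R) : Prop :=
  forall phi, test_fun phi ->
    (\int[leb3]_x (u x * pderiv i phi x)%:E = - \int[leb3]_x (g x * phi x)%:E)%E.

Definition is_weak_grad (u : R3 -> R) (g : 'I_3 -> R3 -> R) : Prop :=
  forall i, L2 (g i) /\ weak_pderiv i u (g i).

Definition H1 (u : R3 -> R) : Prop := L2 u /\ exists g, is_weak_grad u g.

(* the (a.e. unique) weak gradient *)
Definition wgrad (u : R3 -> R) : 'I_3 -> R3 -> R :=
  xget (fun _ _ => 0) (is_weak_grad u).

Definition hnorm2 (mu : R) (u : R3 -> R) : R :=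
  Rintegral leb3 setT (fun x => \sum_(i < 3) (wgrad u i x) ^+ 2)
  + mu * Rintegral leb3 setT (fun x => (u x) ^+ 2).
Definition hnorm (mu : R) (u : R3 -> R) : R := Num.sqrt (hnorm2 mu u).

Definition radial (u : R3 -> R) : Prop :=
  forall x y, enorm3 x = enorm3 y -> u x = u y.

Definition primF (f : R -> R) (t : R) : R :=
  if 0 <= t then Rintegral (@lebesgue_measure R) `[0, t] f
  else - Rintegral (@lebesgue_measure R) `[t, 0] f.

(* kernel (1 - e^{-r})/r, extended by its limit 1 at r = 0 *)
Definition kern (r : R) : R := if r == 0 then 1 else (1 - expR (- r)) / r.

Definition phiu (u : R3 -> R) (x : R3) : \bar R :=
  (\int[leb3]_y (kern (enorm3 (sub3 x y)) * (u y) ^+ 2)%:E)%E.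

Definition phi_energy (u : R3 -> R) : \bar R :=
  (\int[leb3]_x (phiu u x * ((u x) ^+ 2)%:E))%E.

Definition Emu (mu : R) (f : R -> R) (u : R3 -> R) : R :=
  hnorm2 mu u / 2 + Rintegral leb3 setT (fun x => primF f (u x)).

Definition Mmu (u : R3 -> R) : Prop := H1 u /\ phi_energy u = 1%E.
Definition Mrad (u : R3 -> R) : Prop := Mmu u /\ radial u.

End Defs.

(* Main.v *)
(** As [f] is nonnegative and vanishes on the negative half-line, [Emu] is at least half the
    squared norm, with equality at nonpositive functions; since [u |-> - |u|] preserves the
    constraint and does not increase the norm, everything reduces to minimising the norm.

    Write [DD u] for the double integral of [K (|x - y|) u(x)^2 u(y)^2]. The kernel [K] is
    decreasing with values in ]0, 1], so that [DD] is continuous on L^2 and bounded by the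
    fourth power of the L^2 norm.

    Compactness: for a radial [u] the potential is radial, and averaging the kernel over many
    points of a sphere shows that the potential is small far away, uniformly on bounded sets.
    Together with Rellich's theorem on balls, this shows that the midpoint of two late terms of
    a minimising sequence almost satisfies the constraint, and the parallelogram identity makes
    a subsequence Cauchy in H^1.

    Equality of the two infima: the Dirichlet integral is the limit, up to normalisation, of
    the energies [Enr t u], the integrals of [(u(x) - u(y))^2] over [|x - y| <= t].
    Polarisation across a plane that does not contain 0 keeps the L^2 norm, decreases all
    [Enr t] and increases [DD] and the mass near the origin. A function that maximises a
    strictly decreasing radial weight in the class described by these inequalities equals its
    polarisations; letting the planes tend to 0, it is invariant under the linear reflections,
    hence radial. *)
Require Import Defs.
From HB Require Import structures.
From mathcomp Require Import all_boot all_order all_algebra.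
From mathcomp Require Import all_classical all_reals all_analysis.
From mathcomp Require Import measurable_realfun ring lra.
Set Implicit Arguments. Unset Strict Implicit. Unset Printing Implicit Defensive.
Import Order.TTheory GRing.Theory Num.Theory.
Import numFieldNormedType.Exports.
Local Open Scope classical_set_scope.
Local Open Scope ring_scope.

(** Bounded sets of radial functions of [H1] are not relatively compact in L2, and no decay of the
    functions themselves is proved: only the potential becomes small far away, so only the
    constraint behaves well under local convergence. Strong convergence comes from homogeneity: [DD]
    has degree 4 and the squared norm degree 2, so a function with [DD] close to 1 cannot have a
    norm much below the infimum. Gradients never enter the rearrangement directly. Weak derivatives
    are read off L2 norms of translation differences: a bound of [Enr t w] by a multiple of [t ^+ 5]
    yields a weak gradient by duality. Comparing all [Enr t] therefore gives both the existence of a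
    gradient and the inequality of the Dirichlet integrals, for absolute values as for limits of
    rearrangements. Mirrors have normals [(a, b, 1)]: such a reflection is a product of shears,
    which preserve the measure by Tonelli, and those through 0 carry every point to the third axis.
    Finally [radial] is a condition on all values, whereas reflections give equalities almost
    everywhere; averages over balls bridge this gap. *)

Section L2theory.
Context d (T : measurableType d) (R : realType) (m : {measure set T -> \bar R}).
Implicit Types u v w : T -> R.

(** * Square integrable functions: scalar product, norm, Cauchy-Schwarz *)

Definition intble (u : T -> R) := m.-integrable setT (EFin \o u).
Definition rint (u : T -> R) : R := Rintegral m setT u.

(** Functions rather than classes modulo null sets, because [radial] and the sign of the minimiser
    concern values at every point; equality almost everywhere is brought in only where it is needed.
    For [leb R] this is [L2]. *)
Definition l2 u := measurable_fun setT u /\ (\int[m]_x ((u x) ^+ 2)%:E < +oo)%E.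
Definition ip u v : R := rint (fun x => u x * v x).
Definition n2 u : R := rint (fun x => (u x) ^+ 2).
Definition nrm u : R := Num.sqrt (n2 u).

Lemma intble_ge0 u : measurable_fun setT u -> (forall x, 0 <= u x) ->
  (\int[m]_x (u x)%:E < +oo)%E -> intble u.
Proof.
move=> mu u0 fu; apply/integrableP; split; first exact/measurable_EFinP.
apply: le_lt_trans fu; rewrite le_eqVlt; apply/orP; left; apply/eqP.
by apply: eq_integral => x _ /=; rewrite ger0_norm.
Qed.

Lemma intble_meas u : intble u -> measurable_fun setT u.
Proof. by move=> /integrableP[/measurable_EFinP]. Qed.

Lemma rintE u : intble u -> (rint u)%:E = (\int[m]_x (u x)%:E)%E.
Proof. by move=> iu; rewrite /rint /Rintegral fineK//; exact: integrable_fin_num. Qed.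

Lemma intble_lty u : intble u -> (\int[m]_x (u x)%:E < +oo)%E.
Proof. by move=> /rintE <-; rewrite ltry. Qed.

Lemma intble_le u v : measurable_fun setT u -> (forall x, `|u x| <= v x) ->
  intble v -> intble u.
Proof.
move=> mu uv; apply: le_integrable => //; first exact/measurable_EFinP.
by move=> x _ /=; rewrite lee_fin (le_trans (uv x))// ler_norm.
Qed.

Lemma intbleD u v : intble u -> intble v -> intble (fun x => u x + v x).
Proof. by move=> iu iv; have := integrableD measurableT iu iv. Qed.

Lemma intbleB u v : intble u -> intble v -> intble (fun x => u x - v x).
Proof. by move=> iu iv; have := integrableB measurableT iu iv. Qed.

Lemma intbleZ a u : intble u -> intble (fun x => a * u x).
Proof. by move=> iu; have := integrableZl measurableT a iu. Qed.

Lemma intble_norm u : intble u -> intble (fun x => `|u x|).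
Proof. by move=> iu; have := integrable_norm iu. Qed.

Lemma rintD u v : intble u -> intble v -> rint (fun x => u x + v x) = rint u + rint v.
Proof. by move=> iu iv; rewrite /rint RintegralD. Qed.

Lemma rintB u v : intble u -> intble v -> rint (fun x => u x - v x) = rint u - rint v.
Proof. by move=> iu iv; rewrite /rint RintegralB. Qed.

Lemma rintZ a u : intble u -> rint (fun x => a * u x) = a * rint u.
Proof. by move=> iu; rewrite /rint RintegralZl. Qed.

Lemma rint_ge0 u : (forall x, 0 <= u x) -> 0 <= rint u.
Proof. by move=> u0; apply: Rintegral_ge0. Qed.

Lemma rint_le u v : intble u -> intble v -> (forall x, u x <= v x) -> rint u <= rint v.
Proof. by move=> iu iv uv; apply: le_Rintegral. Qed.

Lemma rint_norm u : intble u -> `|rint u| <= rint (fun x => `|u x|).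
Proof. by move=> iu; apply: le_normr_Rintegral. Qed.

Lemma l2_sq u : l2 u -> intble (fun x => (u x) ^+ 2).
Proof.
move=> [mu fu]; apply: intble_ge0 => //; first exact: measurable_funX.
by move=> x; exact: sqr_ge0.
Qed.

Lemma l2P u : measurable_fun setT u -> intble (fun x => (u x) ^+ 2) -> l2 u.
Proof. by move=> mu iu; split=> //; exact: intble_lty iu. Qed.

Lemma l2_dom u v : measurable_fun setT u -> (forall x, `|u x| <= `|v x|) -> l2 v -> l2 u.
Proof.
move=> mu uv lv; apply: l2P => //; apply: intble_le (l2_sq lv).
  exact: measurable_funX.
by move=> x; rewrite ger0_norm ?sqr_ge0// -[u x ^+ 2]real_normK ?num_real// -[v x ^+ 2]real_normK ?num_real// lerXn2r ?nnegrE.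
Qed.

Lemma l2_mul u v : l2 u -> l2 v -> intble (fun x => u x * v x).
Proof.
move=> lu lv; have := intbleD (l2_sq lu) (l2_sq lv); apply: intble_le.
  by apply: measurable_funM; [case: lu|case: lv].
move=> x; rewrite ler_norml; apply/andP; split; first by
  have := sqr_ge0 (u x + v x); have := sqr_ge0 (u x); have := sqr_ge0 (v x); nra.
by have := sqr_ge0 (u x - v x); have := sqr_ge0 (u x); have := sqr_ge0 (v x); nra.
Qed.

Lemma l2D u v : l2 u -> l2 v -> l2 (fun x => u x + v x).
Proof.
move=> lu lv; have mw : measurable_fun setT (fun x => u x + v x).
  by apply: measurable_funD; [case: lu|case: lv].
apply: l2P => //.
have := intbleD (intbleZ 2 (l2_sq lu)) (intbleZ 2 (l2_sq lv)); apply: intble_le.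
  exact: measurable_funX.
by move=> x; rewrite ger0_norm ?sqr_ge0//; have := sqr_ge0 (u x - v x); nra.
Qed.

Lemma l2Z a u : l2 u -> l2 (fun x => a * u x).
Proof.
move=> lu; apply: l2P; first by apply: measurable_funM => //; case: lu.
have := intbleZ (a ^+ 2) (l2_sq lu).
by rewrite (_ : (fun _ => _) = (fun x => (a * u x) ^+ 2))//; apply/funext => x; rewrite exprMn.
Qed.

Lemma l2B u v : l2 u -> l2 v -> l2 (fun x => u x - v x).
Proof.
move=> lu lv; have := l2D lu (l2Z (-1) lv).
by rewrite (_ : (fun _ => _) = (fun x => u x - v x))//; apply/funext => x; rewrite mulN1r.
Qed.

Lemma l2N u : l2 u -> l2 (fun x => - u x).
Proof.
by move=> lu; apply: l2_dom (lu); [apply: measurable_funN; case: lu|move=> x; rewrite normrN].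
Qed.

Lemma l2_abs u : l2 u -> l2 (fun x => `|u x|).
Proof.
by move=> lu; apply: l2_dom (lu); [apply: measurableT_comp => //; case: lu|move=> x; rewrite normr_id].
Qed.

Lemma l20 : l2 (fun=> 0).
Proof.
apply: l2P => //; rewrite /intble (_ : _ \o _ = cst 0%E); first exact: integrable0.
by apply/funext => x /=; rewrite expr0n.
Qed.

Lemma n2_ge0 u : 0 <= n2 u.
Proof. by apply: rint_ge0 => x; exact: sqr_ge0. Qed.

Lemma n2E u : l2 u -> (n2 u)%:E = (\int[m]_x ((u x) ^+ 2)%:E)%E.
Proof. by move=> /l2_sq /rintE. Qed.

Lemma n2_ip u : n2 u = ip u u.
Proof. by []. Qed.

Lemma ipC u v : ip u v = ip v u.
Proof. by congr rint; apply/funext => x; rewrite mulrC. Qed.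

Lemma ipDl u v w : l2 u -> l2 v -> l2 w -> ip (fun x => u x + v x) w = ip u w + ip v w.
Proof.
move=> lu lv lw; rewrite /ip -rintD; [|exact: l2_mul|exact: l2_mul].
by congr rint; apply/funext => x; rewrite mulrDl.
Qed.

Lemma ipBl u v w : l2 u -> l2 v -> l2 w -> ip (fun x => u x - v x) w = ip u w - ip v w.
Proof.
move=> lu lv lw; rewrite /ip -rintB; [|exact: l2_mul|exact: l2_mul].
by congr rint; apply/funext => x; rewrite mulrBl.
Qed.

Lemma ipZl a u v : l2 u -> l2 v -> ip (fun x => a * u x) v = a * ip u v.
Proof.
move=> lu lv; rewrite /ip -rintZ; last exact: l2_mul.
by congr rint; apply/funext => x; rewrite mulrA.
Qed.

Lemma ipDr u v w : l2 u -> l2 v -> l2 w -> ip w (fun x => u x + v x) = ip w u + ip w v.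
Proof. by move=> *; rewrite ipC ipDl// ![ip w _]ipC. Qed.

Lemma ipBr u v w : l2 u -> l2 v -> l2 w -> ip w (fun x => u x - v x) = ip w u - ip w v.
Proof. by move=> *; rewrite ipC ipBl// ![ip w _]ipC. Qed.

Lemma ipZr a u v : l2 u -> l2 v -> ip v (fun x => a * u x) = a * ip v u.
Proof. by move=> *; rewrite ipC ipZl// ![ip v _]ipC. Qed.

Lemma n2D u v : l2 u -> l2 v -> n2 (fun x => u x + v x) = n2 u + 2 * ip u v + n2 v.
Proof.
move=> lu lv; rewrite !n2_ip ipDl// ?ipDr//; last exact: l2D.
by rewrite [ip v u]ipC; ring.
Qed.

Lemma n2B u v : l2 u -> l2 v -> n2 (fun x => u x - v x) = n2 u - 2 * ip u v + n2 v.
Proof.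
move=> lu lv; rewrite !n2_ip ipBl// ?ipBr//; last exact: l2B.
by rewrite [ip v u]ipC; ring.
Qed.

Lemma n2Z a u : l2 u -> n2 (fun x => a * u x) = a ^+ 2 * n2 u.
Proof. by move=> lu; rewrite !n2_ip ipZl// ?ipZr//; [ring|exact: l2Z]. Qed.

Lemma n2N u : n2 (fun x => - u x) = n2 u.
Proof. by congr rint; apply/funext => x; rewrite sqrrN. Qed.

Lemma n2_le u v : l2 u -> l2 v -> (forall x, `|u x| <= `|v x|) -> n2 u <= n2 v.
Proof.
move=> lu lv uv; apply: rint_le; [exact: l2_sq|exact: l2_sq|move=> x].
by rewrite -[u x ^+ 2]real_normK ?num_real// -[v x ^+ 2]real_normK ?num_real// lerXn2r ?nnegrE.
Qed.

Lemma ip_sqr_le u v : l2 u -> l2 v -> (ip u v) ^+ 2 <= n2 u * n2 v.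
Proof.
move=> lu lv.
have Q t : 0 <= n2 u + 2 * t * ip u v + t ^+ 2 * n2 v.
  have := n2_ge0 (fun x => u x + t * v x).
  rewrite (@n2D u (fun x => t * v x))//; last exact: l2Z.
  by rewrite n2Z// ipZr// mulrA.
have [v0|v0] := eqVneq (n2 v) 0.
  rewrite v0 mulr0; have [->|i0] := eqVneq (ip u v) 0; first by rewrite expr0n.
  (* The quadratic in [t] is affine here, and this [t] would give it the value [-1]. *)
  have := Q (- (n2 u + 1) / (2 * ip u v)); rewrite v0 mulr0 addr0.
  have -> : n2 u + 2 * (- (n2 u + 1) / (2 * ip u v)) * ip u v = -1 by field.
  by rewrite oppr_ge0 ler10.
have vp : 0 < n2 v by rewrite lt_neqAle eq_sym v0 n2_ge0.
have := Q (- ip u v / n2 v).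
have -> : n2 u + 2 * (- ip u v / n2 v) * ip u v + (- ip u v / n2 v) ^+ 2 * n2 v
  = (n2 u * n2 v - ip u v ^+ 2) / n2 v by field.
by rewrite pmulr_lge0 ?invr_gt0// subr_ge0.
Qed.

Lemma nrm_ge0 u : 0 <= nrm u.
Proof. exact: sqrtr_ge0. Qed.

Lemma nrm_sqr u : nrm u ^+ 2 = n2 u.
Proof. by rewrite sqr_sqrtr// n2_ge0. Qed.

Lemma ip_le u v : l2 u -> l2 v -> `|ip u v| <= nrm u * nrm v.
Proof.
move=> lu lv; rewrite -(@ler_pXn2r _ 2)// ?nnegrE ?mulr_ge0 ?nrm_ge0//.
by rewrite exprMn !nrm_sqr real_normK ?num_real// ip_sqr_le.
Qed.

Lemma nrmD u v : l2 u -> l2 v -> nrm (fun x => u x + v x) <= nrm u + nrm v.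
Proof.
move=> lu lv; rewrite -(@ler_pXn2r _ 2)// ?nnegrE ?addr_ge0 ?nrm_ge0//.
rewrite sqrrD !nrm_sqr n2D//.
by have := le_trans (ler_norm _) (ip_le lu lv); lra.
Qed.

Lemma nrmN u : nrm (fun x => - u x) = nrm u.
Proof. by rewrite /nrm n2N. Qed.

Lemma nrmB u v : l2 u -> l2 v -> nrm (fun x => u x - v x) <= nrm u + nrm v.
Proof. by move=> lu lv; rewrite -[nrm v]nrmN; apply: nrmD => //; exact: l2N. Qed.

Lemma nrmBC u v : nrm (fun x => u x - v x) = nrm (fun x => v x - u x).
Proof. by rewrite -nrmN; congr nrm; apply/funext => x; rewrite opprB. Qed.

Lemma nrmZ a u : l2 u -> nrm (fun x => a * u x) = `|a| * nrm u.
Proof. by move=> lu; rewrite /nrm n2Z// sqrtrM ?sqr_ge0// sqrtr_sqr. Qed.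

Lemma nrm_tri u v w : l2 u -> l2 v -> l2 w ->
  nrm (fun x => u x - w x) <= nrm (fun x => u x - v x) + nrm (fun x => v x - w x).
Proof.
move=> lu lv lw; rewrite (_ : (fun x => u x - w x) = (fun x => (u x - v x) + (v x - w x))).
  by apply: nrmD; apply: l2B.
by apply/funext => x; ring.
Qed.

Lemma nrm_le_n2 u e : 0 <= e -> nrm u <= e <-> n2 u <= e ^+ 2.
Proof.
by move=> e0; rewrite -nrm_sqr ler_pXn2r ?nnegrE ?nrm_ge0.
Qed.

Lemma nrm_dist u v : l2 u -> l2 v -> `|nrm u - nrm v| <= nrm (fun x => u x - v x).
Proof.
move=> lu lv.
have A (f g : T -> R) : l2 f -> l2 g -> nrm f <= nrm g + nrm (fun x => f x - g x).
  move=> lf lg; rewrite addrC; have := nrmD (l2B lf lg) lg.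
  by rewrite (_ : (fun x => f x - g x + g x) = f)//; apply/funext => x; rewrite subrK.
rewrite ler_norml; apply/andP; split; first by have := A _ _ lv lu; rewrite nrmBC; lra.
by have := A _ _ lu lv; lra.
Qed.

Lemma ae_n2 u v : l2 u -> l2 v -> {ae m, forall x, u x = v x} -> n2 u = n2 v.
Proof.
move=> lu lv uv; rewrite /n2 /rint /Rintegral; congr fine.
apply: ae_eq_integral => //; [| |].
- by apply/measurable_EFinP/measurable_funX; case: lu.
- by apply/measurable_EFinP/measurable_funX; case: lv.
- by apply: filterS uv => x /= ->.
Qed.

Lemma ae_rint u v : measurable_fun setT u -> measurable_fun setT v ->
  {ae m, forall x, u x = v x} -> rint u = rint v.
Proof.
move=> mu mv uv; rewrite /rint /Rintegral; congr fine.
apply: ae_eq_integral => //; [exact/measurable_EFinP|exact/measurable_EFinP|].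
by apply: filterS uv => x /= ->.
Qed.

Lemma ae_ip u v w : l2 u -> l2 v -> l2 w -> {ae m, forall x, u x = v x} -> ip u w = ip v w.
Proof.
move=> [mu _] [mv _] [mw _] uv; apply: ae_rint; [exact: measurable_funM..|].
by apply: filterS uv => x /= ->.
Qed.

Lemma rint_eq0 u : intble u -> (forall x, 0 <= u x) -> rint u = 0 ->
  {ae m, forall x, u x = 0}.
Proof.
move=> iu u0 r0.
have mu : measurable_fun setT (EFin \o u) by case/integrableP : iu.
have [+ _] := ae_eq_integral_abs m measurableT mu.
have -> : (\int[m]_(x in setT) `|(EFin \o u) x| = 0)%E.
  have -> : (0 = (rint u)%:E)%E by rewrite r0.
  by rewrite rintE//; apply: eq_integral => x _ /=; rewrite ger0_norm.
by move=> /(_ erefl); apply: filterS => x /(_ I) /= [].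
Qed.

Lemma n2_eq0 u : l2 u -> n2 u = 0 -> {ae m, forall x, u x = 0}.
Proof.
move=> lu n0; have := @rint_eq0 (fun x => u x ^+ 2) (l2_sq lu).
move=> /(_ (fun x => sqr_ge0 _) n0); apply: filterS => x /eqP.
by rewrite expf_eq0 /= => /eqP.
Qed.

Lemma l2_indic (A : set T) : measurable A -> (m A < +oo)%E -> l2 (\1_A).
Proof.
move=> mA fA; split; first exact: measurable_indic.
under eq_integral do rewrite indicE expr2 -natrM mulnb andbb -indicE.
by rewrite integral_indic// setIT.
Qed.

End L2theory.

Lemma seq0P (R : realType) (a : nat -> R) : (forall n, 0 <= a n) ->
  a @ \oo --> (0 : R) <-> (forall e, 0 < e -> exists N, forall n, (N <= n)%N -> a n <= e).
Proof.
move=> a0; rewrite cvgr0Pnorm_le; split=> H e e0.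
  by have [N _ HN] := H _ e0; exists N => n Nn; have := HN n Nn; rewrite /= ger0_norm.
by have [N HN] := H _ e0; exists N => // n /= Nn; rewrite ger0_norm// HN.
Qed.

Lemma increasing_seq_ge (s : nat -> nat) : (forall n, (s n < s n.+1)%N) -> forall n, (n <= s n)%N.
Proof. by move=> si; elim=> // n IH; exact: leq_ltn_trans IH (si n). Qed.

Lemma extract_subseq (P : nat -> nat -> Prop) :
  (forall k, exists N, forall n, (N <= n)%N -> P k n) ->
  exists s : nat -> nat, (forall n, (s n < s n.+1)%N) /\ forall k, P k (s k).
Proof.
move=> /choice[N HN]; pose s := fix s n := if n is k.+1 then maxn (N n) (s k).+1 else N 0%N.
exists s; split=> [n|k]; first by rewrite /= leq_maxr.
by apply: HN; case: k => [|k] //=; rewrite leq_maxl.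
Qed.

(** * Completeness of L2 and Riesz representation on a subspace *)

Section L2complete.
Context d (T : measurableType d) (R : realType) (m : {measure set T -> \bar R}).
Implicit Types u v w : T -> R.

(* Defined at every point from the values at that point only, so that limits of radial
   functions are exactly (not just almost everywhere) radial. *)
Definition plim (us : nat -> T -> R) (x : T) : R := fine (limn_esup (fun n => (us n x)%:E)).

Lemma plim_cvg us x l : us ^~ x @ \oo --> l -> plim us x = l.
Proof.
move=> H; have /cvg_limn_einf_sup[_ E] : (fun n => (us n x)%:E) @ \oo --> l%:E.
  by apply: cvg_EFin => //; exact: nearW.
by rewrite /plim E.
Qed.

Lemma measurable_plim us : (forall n, measurable_fun setT (us n)) -> measurable_fun setT (plim us).
Proof.
move=> mus; apply: (@measurableT_comp _ _ _ _ _ _ (@fine R)); first exact: fine_measurable.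
by apply: measurable_fun_limn_esup => n; exact/measurable_EFinP.
Qed.

Lemma limn_einf_le (a : nat -> \bar R) C : (forall n, (a n <= C)%E) -> (limn_einf a <= C)%E.
Proof.
move=> aC; rewrite limn_einf_lim; apply: lime_le; first exact: is_cvg_einfs.
apply: nearW => n; apply: le_trans (aC n); apply: ereal_inf_lbound.
by exists n => //=.
Qed.

(** The limit is known only almost everywhere, so the integral of [f] is first exchanged for that of
    the lower limit, to which Fatou's lemma applies. *)
Lemma fatou_le (fs : nat -> T -> R) (f : T -> R) (C : \bar R) :
  (forall n, measurable_fun setT (fs n)) -> measurable_fun setT f ->
  (forall n x, 0 <= fs n x) -> (forall x, 0 <= f x) ->
  {ae m, forall x, fs ^~ x @ \oo --> f x} ->
  (forall n, (\int[m]_x (fs n x)%:E <= C)%E) -> (\int[m]_x (f x)%:E <= C)%E.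
Proof.
move=> mfs mf fs0 f0 ff fC.
have -> : (\int[m]_x (f x)%:E = \int[m]_x limn_einf (fun n => (fs n x)%:E))%E.
  apply: ge0_ae_eq_integral => //.
  - exact/measurable_EFinP.
  - rewrite (_ : (fun x => _) = (fun x => (- limn_esup (fun n => - (fs n x)%:E))%E)).
      apply: measurableT_comp => //; apply: measurable_fun_limn_esup => n.
      by apply: measurableT_comp => //; exact/measurable_EFinP.
    apply/funext => x; rewrite -limn_einfN; congr limn_einf; apply/funext => n /=.
    by rewrite opprK.
  - by move=> x _; rewrite lee_fin.
  - move=> x _; rewrite limn_einf_lim; apply: lime_ge; first exact: is_cvg_einfs.
    by apply: nearW => n; apply: le_ereal_inf_tmp => _ [k _ <-]; rewrite lee_fin.
  - apply: filterS ff => x H _.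
    have /cvg_limn_einf_sup[-> //] : (fun n => (fs n x)%:E) @ \oo --> (f x)%:E.
    by apply: cvg_EFin => //; exact: nearW.
apply: le_trans; last exact: (limn_einf_le fC).
apply: fatou => //; first by move=> n; exact/measurable_EFinP.
by move=> n x _; rewrite lee_fin.
Qed.

Lemma l2_fatou us u C : (forall n, l2 m (us n)) -> measurable_fun setT u ->
  {ae m, forall x, us ^~ x @ \oo --> u x} -> (forall n, n2 m (us n) <= C) ->
  l2 m u /\ n2 m u <= C.
Proof.
move=> lus mu uu nC.
have H : (\int[m]_x ((u x) ^+ 2)%:E <= C%:E)%E.
  apply: (@fatou_le (fun n x => us n x ^+ 2)) => //.
  - by move=> n; apply: measurable_funX; case: (lus n).
  - exact: measurable_funX.
  - by move=> n x; exact: sqr_ge0.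
  - by move=> x; exact: sqr_ge0.
  - by apply: filterS uu => x H; rewrite expr2; under eq_fun do rewrite expr2; apply: cvgM.
  - by move=> n; rewrite -n2E// lee_fin.
have lu : l2 m u by split=> //; apply: le_lt_trans H (ltry _).
by split=> //; rewrite -lee_fin n2E.
Qed.

(** The squared increments, weighted by [4 ^+ k], have integrals at most [2^-1 ^+ k], so their sum
    is finite almost everywhere. Where it equals [M], each increment is at most
    [Num.sqrt M * 2^-1 ^+ k], and the series of increments converges geometrically. *)
Lemma fast_cauchy us : (forall n, l2 m (us n)) ->
  (forall k, n2 m (fun x => us k.+1 x - us k x) <= 8^-1 ^+ k) ->
  {ae m, forall x, cvgn (us ^~ x)}.
Proof.
move=> lus fast.
pose f k x := 4 ^+ k * (us k.+1 x - us k x) ^+ 2.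
have f0 k x : 0 <= f k x by rewrite mulr_ge0 ?sqr_ge0 ?exprn_ge0.
have mus k : measurable_fun setT (us k) by case: (lus k).
have mf k : measurable_fun setT (f k).
  by apply: measurable_funM => //; apply: measurable_funX; exact: measurable_funB.
have If : (\int[m]_x (\sum_(0 <= k <oo) (f k x)%:E) < +oo)%E.
  rewrite integral_nneseries//; last 2 first.
  - by move=> k; exact/measurable_EFinP.
  - by move=> k x _; rewrite lee_fin.
  apply: (@le_lt_trans _ _ (2%:E)); last by rewrite ltry.
  have := cvg_lim (@ereal_hausdorff _) (@cvg_geometric_eseries_half R 2 0).
  rewrite expr0 divr1 => <-; apply: lee_nneseries.
    by move=> k _ _; apply: integral_ge0 => x _; rewrite lee_fin.
  move=> k _; rewrite -[X in (X <= _)%E]rintE.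
    rewrite /f rintZ; last by apply: l2_sq; exact: l2B.
    rewrite lee_fin; apply: (@le_trans _ _ (4 ^+ k * 8^-1 ^+ k)).
      by rewrite ler_pM2l ?exprn_gt0//; exact: fast.
    rewrite -exprMn addn1 natrX exprS invfM mulrA divff// mul1r -exprVn.
    by rewrite (_ : 4 / 8 = 2^-1 :> R)//; field.
  by apply: intbleZ; apply: l2_sq; exact: l2B.
have msum : measurable_fun setT (fun x => \sum_(0 <= k <oo) (f k x)%:E)%E.
  by apply: ge0_emeasurable_sum => [k x _ _|k _]; [rewrite lee_fin|exact/measurable_EFinP].
have isum : m.-integrable setT (fun x => \sum_(0 <= k <oo) (f k x)%:E)%E.
  apply/integrableP; split=> //; apply: le_lt_trans If.
  rewrite le_eqVlt; apply/orP; left; apply/eqP; apply: eq_integral => x _.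
  by rewrite gee0_abs//; apply: nneseries_ge0 => k _ _; rewrite lee_fin.
have := integrable_ae measurableT isum; apply: filterS => x /(_ I) fin.
set M := fine (\sum_(0 <= k <oo) (f k x)%:E)%E.
have fM k : f k x <= M.
  rewrite -lee_fin /M fineK//.
  apply: le_trans (@nneseries_lim_ge R (fun k => (f k x)%:E) xpredT 0 k.+1 _); last first.
    by move=> i _ _; rewrite lee_fin.
  rewrite big_nat_recr//= leeDr// sume_ge0// => i _.
  by rewrite lee_fin.
have M0 : 0 <= M by exact: le_trans (f0 0%N x) (fM 0%N).
have dM k : `|us k.+1 x - us k x| <= Num.sqrt M * (2^-1) ^+ k.
  rewrite -(@ler_pXn2r _ 2)// ?nnegrE ?mulr_ge0 ?sqrtr_ge0 ?exprn_ge0//.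
  rewrite exprMn sqr_sqrtr// real_normK ?num_real//.
  rewrite exprAC (_ : 2^-1 ^+ 2 = 4^-1 :> R); last by field.
  by rewrite exprVn ler_pdivlMr ?exprn_gt0// mulrC; exact: fM.
have S : cvgn (series (telescope (us ^~ x))).
  apply: normed_cvg; apply: (@series_le_cvg _ _ (geometric (Num.sqrt M) 2^-1)) => //.
  - by move=> n; exact: normr_ge0.
  - by move=> n; rewrite /= mulr_ge0 ?sqrtr_ge0 ?exprn_ge0.
  - apply: is_cvg_geometric_series; rewrite ger0_norm// invf_lt1//.
    by rewrite ltr1n.
move: S; rewrite telescopeK => S.
rewrite (_ : us ^~ x = (fun n => (us n x - us 0%N x) + us 0%N x)); last first.
  by apply/funext => n; rewrite subrK.
by apply: is_cvgD => //; exact: is_cvg_cst.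
Qed.

Lemma cvg_n2_le us u v : (forall n, l2 m (us n)) -> l2 m u -> l2 m v ->
  (fun n => n2 m (fun x => us n x - u x)) @ \oo --> (0 : R) ->
  (fun n => ip m (us n) v) @ \oo --> ip m u v.
Proof.
move=> lus lu lv /seq0P H; apply/cvgrPdist_le => e e0.
have e1 : 0 < (e / (1 + nrm m v)) ^+ 2.
  by rewrite exprn_gt0// divr_gt0// ltr_wpDr// nrm_ge0.
have [|N HN] := H _ _ e1; first by move=> n; exact: n2_ge0.
exists N => // n /= Nn; have := HN n Nn.
have d0 : 0 <= e / (1 + nrm m v) by rewrite divr_ge0 ?addr_ge0 ?nrm_ge0// ltW.
rewrite -nrm_le_n2// distrC -ipBl// => A.
apply: le_trans (ip_le _ lv) _; first exact: l2B.
apply: (@le_trans _ _ (e / (1 + nrm m v) * nrm m v)).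
  by rewrite ler_wpM2r ?nrm_ge0.
have p0 : 0 < 1 + nrm m v by rewrite ltr_wpDr ?nrm_ge0.
by rewrite mulrAC ler_pdivrMr//; have := nrm_ge0 m v; nra.
Qed.

Lemma cvg_nrm us u : (forall n, l2 m (us n)) -> l2 m u ->
  (fun n => n2 m (fun x => us n x - u x)) @ \oo --> (0 : R) ->
  (fun n => nrm m (us n)) @ \oo --> nrm m u.
Proof.
move=> lus lu /seq0P H; apply/cvgrPdist_le => e e0.
have [|N HN] := H (fun n => n2_ge0 m _) (e ^+ 2); first by rewrite exprn_gt0.
exists N => // n /= Nn; have := HN n Nn; rewrite -nrm_le_n2; last exact: ltW.
by rewrite distrC; apply: le_trans; exact: nrm_dist.
Qed.

Lemma cvg_n2 us u : (forall n, l2 m (us n)) -> l2 m u ->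
  (fun n => n2 m (fun x => us n x - u x)) @ \oo --> (0 : R) ->
  (fun n => n2 m (us n)) @ \oo --> n2 m u.
Proof.
move=> lus lu H; rewrite -nrm_sqr; under eq_fun do rewrite -nrm_sqr.
by rewrite expr2; under eq_fun do rewrite expr2; apply: cvgM; exact: cvg_nrm.
Qed.

Definition l2cauchy us := forall e, 0 < e ->
  exists N, forall n k, (N <= n)%N -> (N <= k)%N -> n2 m (fun x => us n x - us k x) <= e.

(** Riesz-Fischer: a subsequence satisfying [fast_cauchy] converges almost everywhere, and Fatou's
    lemma bounds the distance of every [us n] to the limit. The limit is given explicitly as a
    [plim], so that symmetries shared by the values of all terms pass to it. *)
Lemma l2_complete us : (forall n, l2 m (us n)) -> l2cauchy us ->
  exists s : nat -> nat, (forall n, (s n < s n.+1)%N) /\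
   let u := plim (fun n => us (s n)) in
   [/\ l2 m u, (fun n => n2 m (fun x => us n x - u x)) @ \oo --> (0 : R) &
     {ae m, forall x, (fun n => us (s n) x) @ \oo --> u x}].
Proof.
move=> lus Hc.
have [s [si sP]] : exists s : nat -> nat, (forall n, (s n < s n.+1)%N) /\
    forall k, forall n, (s k <= n)%N -> n2 m (fun x => us n x - us (s k) x) <= 8^-1 ^+ k.
  apply: (extract_subseq (P := fun k j => forall n, (j <= n)%N ->
      n2 m (fun x => us n x - us j x) <= 8^-1 ^+ k)) => k.
  have [|N HN] := Hc (8^-1 ^+ k); first by rewrite exprn_gt0.
  by exists N => j Nj n jn; apply: HN => //; exact: leq_trans Nj jn.
exists s; split=> //; set u := plim _.
have mu : measurable_fun setT u by apply: measurable_plim => n; case: (lus (s n)).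
have ae1 : {ae m, forall x, (fun n => us (s n) x) @ \oo --> u x}.
  have : {ae m, forall x, cvgn (fun n => us (s n) x)}.
    apply: (fast_cauchy (us := fun n => us (s n))) => [//|k].
    by apply: sP; exact/ltnW/si.
  by apply: filterS => x cx; rewrite /u (plim_cvg cx).
have key e : 0 < e -> exists N, forall n, (N <= n)%N ->
    l2 m (fun x => us n x - u x) /\ n2 m (fun x => us n x - u x) <= e.
  move=> e0; have [N HN] := Hc _ e0; exists N => n Nn.
  (* The shift by [N] keeps the second index beyond [N]. In this way [us n - u] is shown to be
     square integrable before [u] is. *)
  apply: (@l2_fatou (fun k x => us n x - us (s (k + N)%N) x)).
  - by move=> k; exact: l2B.
  - by apply: measurable_funB => //; case: (lus n).
  - apply: filterS ae1 => x H; apply: cvgB; first exact: cvg_cst.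
    by move: H; rewrite -(cvg_shiftn N).
  - move=> k; apply: HN => //.
    by apply: leq_trans (increasing_seq_ge si _); rewrite leq_addl.
have lu : l2 m u.
  have [N /(_ N (leqnn N))[lN _]] := key 1 ltr01.
  have := l2B (lus N) lN.
  by rewrite (_ : (fun x => us N x - (us N x - u x)) = u)//; apply/funext => x; ring.
split=> //; apply/seq0P => [n|e e0]; first exact: n2_ge0.
by have [N HN] := key _ e0; exists N => n /HN[].
Qed.

Lemma l2_cvg_cauchy us u : (forall n, l2 m (us n)) -> l2 m u ->
  (fun n => n2 m (fun x => us n x - u x)) @ \oo --> (0 : R) -> l2cauchy us.
Proof.
move=> lus lu /seq0P H e e0.
have [|N HN] := H (fun n => n2_ge0 m _) (e / 4); first by rewrite divr_gt0.
exists N => n k Nn Nk; have An := HN n Nn; have Ak := HN k Nk.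
rewrite (_ : (fun x => us n x - us k x) = (fun x => (us n x - u x) - (us k x - u x))); last first.
  by apply/funext => x; ring.
have ln := l2B (lus n) lu; have lk := l2B (lus k) lu.
have := n2_ge0 m (fun x => (us n x - u x) + (us k x - u x)).
by rewrite n2B// n2D//; lra.
Qed.

Lemma n2_lim_unique us u v : (forall n, l2 m (us n)) -> l2 m u -> l2 m v ->
  (fun n => n2 m (fun x => us n x - u x)) @ \oo --> (0 : R) ->
  (fun n => n2 m (fun x => us n x - v x)) @ \oo --> (0 : R) -> {ae m, forall x, u x = v x}.
Proof.
move=> lus lu lv cu cv.
have : n2 m (fun x => u x - v x) = 0.
  apply/eqP; rewrite eq_le n2_ge0 andbT; apply/ler_addgt0Pl => e e0; rewrite addr0.
  have e4 : 0 < e / 4 by rewrite divr_gt0.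
  have /seq0P/(_ _ e4)[|N HN] := cu; first by move=> n; exact: n2_ge0.
  have /seq0P/(_ _ e4)[|K HK] := cv; first by move=> n; exact: n2_ge0.
  have := HN _ (leq_maxl N K); have := HK _ (leq_maxr N K); set n := maxn N K => A B.
  rewrite (_ : (fun x => u x - v x) = (fun x => (us n x - v x) - (us n x - u x))); last first.
    by apply/funext => x; ring.
  have ln := l2B (lus n) lu; have lk := l2B (lus n) lv.
  have := n2_ge0 m (fun x => (us n x - v x) + (us n x - u x)).
  by rewrite n2B// n2D//; lra.
move=> /n2_eq0 => /(_ (l2B lu lv)); apply: filterS => x /eqP.
by rewrite subr_eq0 => /eqP.
Qed.

Lemma l2_cvg_ae us u : (forall n, l2 m (us n)) -> l2 m u ->
  (fun n => n2 m (fun x => us n x - u x)) @ \oo --> (0 : R) ->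
  exists s : nat -> nat, (forall n, (s n < s n.+1)%N) /\
   {ae m, forall x, (fun n => us (s n) x) @ \oo --> u x}.
Proof.
move=> lus lu cu; have [s [si [lp cp aep]]] := l2_complete lus (l2_cvg_cauchy lus lu cu).
exists s; split=> //; have := n2_lim_unique lus lu lp cu cp.
by apply: filterS2 aep => x A ->.
Qed.

(** The subspace [V] is not assumed closed, so the representer is the L2 limit of a minimising
    sequence of [n2 f - 2 * l f] on [V], which is Cauchy by the parallelogram identity. The
    approximating sequence is part of the conclusion because with [l] a scalar product it yields
    density; with [l] a derivative moved onto the test function, the representer is a weak
    derivative. *)
Lemma riesz_subspace (V : set (T -> R)) (l : (T -> R) -> R) (C : R) :
  V (fun=> 0) -> (forall a f g, V f -> V g -> V (fun x => a * f x + g x)) ->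
  (forall f, V f -> l2 m f) ->
  (forall a f g, V f -> V g -> l (fun x => a * f x + g x) = a * l f + l g) ->
  (forall f, V f -> `|l f| <= C * nrm m f) ->
  exists G, [/\ l2 m G, forall f, V f -> ip m G f = l f &
    exists fs : nat -> T -> R, (forall n, V (fs n)) /\
      (fun n => n2 m (fun x => fs n x - G x)) @ \oo --> (0 : R)].
Proof.
move=> V0 VD VL lD lC.
pose J f := n2 m f - 2 * l f.
have Jlb f : V f -> - C ^+ 2 <= J f.
  move=> Vf; have := lC f Vf; rewrite /J -nrm_sqr => A.
  have := ler_norm (l f); have := sqr_ge0 (nrm m f - C); nra.
pose S := [set J f | f in V].
have hS : has_inf S.
  split; first by exists (J (fun=> 0)), (fun=> 0).
  by exists (- C ^+ 2) => _ [f Vf <-]; exact: Jlb.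
have Jinf f : V f -> inf S <= J f by move=> Vf; apply: ge_inf; [case: hS|exists f].
have /choice[fs Hfs] n : exists f, V f /\ J f <= inf S + n.+1%:R^-1.
  have [_ [f Vf <-] /ltW] := @inf_adherent _ S (n.+1%:R^-1) ltac:(by rewrite invr_gt0) hS.
  by exists f.
have Vfs n : V (fs n) by case: (Hfs n).
have lfs n : l2 m (fs n) by exact: VL.
have Jexp f g a : V f -> V g -> J (fun x => a * f x + g x) =
    a ^+ 2 * n2 m f + 2 * a * ip m f g + n2 m g - 2 * (a * l f + l g).
  move=> Vf Vg; rewrite /J n2D//; [|exact/l2Z/VL|exact: VL].
  by rewrite n2Z ?ipZl ?lD//; [ring|exact: VL..].
have hc : l2cauchy fs.
  move=> e e0.
  have e4 : 0 < e / 4 by rewrite divr_gt0.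
  have [N _ HN] := near_infty_natSinv_lt (PosNum e4).
  exists N => n k Nn Nk.
  have := HN n Nn; have := HN k Nk => /= ik iN.
  have [_ Jn] := Hfs n; have [_ Jk] := Hfs k.
  have Vz : V (fun x => 2^-1 * fs k x + 0) by exact: VD.
  have Vh : V (fun x => 2^-1 * fs n x + (2^-1 * fs k x + 0)) by exact: VD.
  have := Jinf _ Vh; rewrite Jexp//.
  have -> : (fun x => 2^-1 * fs k x + 0) = (fun x => 2^-1 * fs k x).
    by apply/funext => x; rewrite addr0.
  have lz : l (fun x => 2^-1 * fs k x) = 2^-1 * l (fs k).
    have := lD 2^-1 _ _ (Vfs k) V0.
    have -> : (fun x => 2^-1 * fs k x + 0) = (fun x => 2^-1 * fs k x).
      by apply/funext => x; rewrite addr0.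
    move=> ->; have := lD 1 _ _ V0 V0.
    have -> : (fun x : T => 1 * 0 + 0) = (fun=> 0 : R) by apply/funext => x; ring.
    move=> /eqP; rewrite mul1r -subr_eq0 opprD addrA subrr sub0r oppr_eq0 => /eqP ->.
    by rewrite addr0.
  rewrite ipZr// n2Z// lz n2B// => A.
  move: Jn Jk A; rewrite /J.
  move: (ip m (fs n) (fs k)) (n2 m (fs n)) (n2 m (fs k)) (l (fs n)) (l (fs k)) iN ik.
  move: (n.+1%:R^-1) (k.+1%:R^-1) (inf S) => x y I p a b la lb h1 h2 h3 h4 h5.
  have E : 4 * (2^-1 ^+ 2 * a + 2 * 2^-1 * (2^-1 * p) + 2^-1 ^+ 2 * b -
    2 * (2^-1 * la + 2^-1 * lb)) = a + 2 * p + b - 4 * la - 4 * lb by field.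
  lra.
have [s [_]] := l2_complete lfs hc; set G := plim _ => -[lG cG _].
exists G; split=> //; last by exists fs.
move=> g Vg; apply/eqP; rewrite -subr_eq0; set D := ip m G g - l g.
have lg := VL _ Vg.
(* First variation at [G]. As [G] need not lie in [V], the inequality is read at the competitors
   [t * g + fs n], with an error [1 / (n + 1)], and then passed to the limit. *)
have Q t : 0 <= 2 * t * D + t ^+ 2 * n2 m g.
  have B n : - n.+1%:R^-1 <= 2 * t * (ip m (fs n) g - l g) + t ^+ 2 * n2 m g.
    have [_ Jn] := Hfs n.
    have := Jinf _ (VD t _ _ Vg (Vfs n)); rewrite Jexp// [ip m g _]ipC.
    by move: Jn; rewrite /J; move: (n.+1%:R^-1) => y; lra.
  have c1 : (fun n => 2 * t * (ip m (fs n) g - l g) + t ^+ 2 * n2 m g) @ \oo -->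
     (2 * t * D + t ^+ 2 * n2 m g).
    apply: cvgD; last exact: cvg_cst.
    apply: cvgM; first exact: cvg_cst.
    apply: cvgB; last exact: cvg_cst.
    exact: cvg_n2_le.
  have c2 : (fun n => - n.+1%:R^-1 : R) @ \oo --> (0 : R).
    by rewrite -oppr0; apply: cvgN; exact: cvg_harmonic.
  by apply: ler_cvg_to c2 c1 _; exact: nearW.
have [g0|g0] := eqVneq (n2 m g) 0.
  by have := Q (- D); rewrite g0; have := sqr_ge0 D; nra.
have gp : 0 < n2 m g by rewrite lt_neqAle eq_sym g0 n2_ge0.
have := Q (- D / n2 m g).
have -> : 2 * (- D / n2 m g) * D + (- D / n2 m g) ^+ 2 * n2 m g = - D ^+ 2 / n2 m g by field.
rewrite pmulr_lge0 ?invr_gt0// oppr_ge0 => D2.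
by have := conj D2 (sqr_ge0 D) => /andP; rewrite -eq_le sqrf_eq0.
Qed.

End L2complete.

(** * Measure-preserving maps and Lebesgue measure on the line *)

Section mpres.
Context d (T : measurableType d) (R : realType) (m : {measure set T -> \bar R}).

(** Stated for integrals of nonnegative functions instead of measures of preimages: in this form it
    follows from Tonelli's theorem for shears and composes at once. *)
Definition mpres (t : T -> T) := measurable_fun setT t /\
  forall f : T -> \bar R, measurable_fun setT f -> (forall x, 0 <= f x)%E ->
    (\int[m]_x f (t x) = \int[m]_x f x)%E.

Lemma mpres_comp s t : mpres s -> mpres t -> mpres (s \o t).
Proof.
move=> [ms Hs] [mt Ht]; split; first exact: measurableT_comp.
move=> f mf f0; rewrite -(Hs f mf f0) -(Ht (f \o s))//.
  exact: measurableT_comp.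
by move=> x /=; exact: f0.
Qed.

Variable t : T -> T.
Hypothesis ht : mpres t.

Lemma mpres_meas (f : T -> R) : measurable_fun setT f -> measurable_fun setT (fun x => f (t x)).
Proof. by move=> mf; case: ht => mt _; exact: measurableT_comp. Qed.

Lemma mpres_int (f : T -> \bar R) : measurable_fun setT f ->
  (\int[m]_x f (t x) = \int[m]_x f x)%E.
Proof.
case: ht => mt H mf; rewrite integralE [RHS]integralE.
have mp := measurable_funepos mf; have mn := measurable_funeneg mf.
rewrite -(H _ mp (fun x => funepos_ge0 f x)) -(H _ mn (fun x => funeneg_ge0 f x)).
by congr (_ - _)%E; apply: eq_integral => x _; rewrite ?funeposE ?funenegE.
Qed.

Lemma mpres_rint (f : T -> R) : measurable_fun setT f -> rint m (fun x => f (t x)) = rint m f.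
Proof.
move=> mf; rewrite /rint /Rintegral; congr fine.
by rewrite (mpres_int (f := fun x => (f x)%:E))//; exact/measurable_EFinP.
Qed.

Lemma mpres_l2 u : l2 m u -> l2 m (fun x => u (t x)).
Proof.
move=> [mu fu]; split; first exact: mpres_meas.
rewrite (mpres_int (f := fun x => (u x ^+ 2)%:E))//.
by apply/measurable_EFinP/measurable_funX.
Qed.

Lemma mpres_n2 u : measurable_fun setT u -> n2 m (fun x => u (t x)) = n2 m u.
Proof. by move=> mu; apply: (mpres_rint (f := fun x => u x ^+ 2)); exact: measurable_funX. Qed.

Lemma mpres_nrm u : measurable_fun setT u -> nrm m (fun x => u (t x)) = nrm m u.
Proof. by move=> mu; rewrite /nrm mpres_n2. Qed.

Lemma mpres_ip u v : measurable_fun setT u -> measurable_fun setT v ->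
  ip m (fun x => u (t x)) (fun x => v (t x)) = ip m u v.
Proof.
by move=> mu mv; apply: (mpres_rint (f := fun x => u x * v x)); exact: measurable_funM.
Qed.

Lemma mpres_ae (P : T -> Prop) : {ae m, forall x, P x} -> {ae m, forall x, P (t x)}.
Proof.
case: ht => mt H [N [mN N0 sN]]; exists (t @^-1` N); split.
- by rewrite -[X in measurable X]setTI; exact: mt.
- have mN' : measurable (t @^-1` N) by rewrite -[X in measurable X]setTI; exact: mt.
  rewrite -N0 -[in RHS](setIT N) -(setIT (t @^-1` N)) -!integral_indic//.
  rewrite -(H (fun x => (\1_N x)%:E))//.
  by apply/measurable_EFinP; exact: measurable_indic.
- by move=> x /= Px; apply: sN.
Qed.

End mpres.

Section lebesgue1.
Context {R : realType}.
Local Notation mu := (@lebesgue_measure R).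

(** Half-open intervals determine Lebesgue measure, so it is enough to compare the pushforward with
    it on them. *)
Lemma lebesgue_pushforward_itv (phi : measurableTypeR R -> measurableTypeR R) :
  measurable_fun setT phi ->
  (forall a b, mu (phi @^-1` `]a, b]) = mu `]a, b]) ->
  mpres mu phi.
Proof.
move=> mphi H; split=> // f mf f0.
transitivity (\int[pushforward mu phi]_x f x)%E.
  by rewrite ge0_integral_pushforward.
apply: eq_measure_integral => A mA _; apply/esym.
apply: (@lebesgue_measure_unique R (pushforward mu phi)) => //.
by move=> _ [[a b]] _ <-; rewrite -H.
Qed.

Lemma lebesgue_shift a : mpres mu (fun x => x + a).
Proof.
apply: lebesgue_pushforward_itv => [|b c]; first exact: measurable_funD.
rewrite (_ : _ @^-1` _ = `]b - a, c - a]%classic); last first.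
  by apply/seteqP; split=> x; rewrite /= !in_itv/= ltrBlDr lerBrDr.
rewrite !lebesgue_measure_itv/= !lte_fin ltrD2r.
by case: ifP => // _; rewrite -!EFinB; congr EFin; ring.
Qed.

Lemma lebesgue_flip : mpres mu (fun x => - x).
Proof.
apply: lebesgue_pushforward_itv => [|b c]; first exact: measurable_funN.
rewrite (_ : _ @^-1` _ = `[- c, - b[%classic); last first.
  by apply/seteqP; split=> x; rewrite /= !in_itv/= lerNl ltrNr andbC.
rewrite !lebesgue_measure_itv/= !lte_fin ltrN2.
by case: ifP => // _; rewrite -!EFinB; congr EFin; ring.
Qed.

End lebesgue1.

(** * Tonelli on iterated products; shears and reflections of R^3 *)

Section sf_prod.
Context d1 d2 (T1 : measurableType d1) (T2 : measurableType d2) (R : realType).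
Variables (m1 : {sigma_finite_measure set T1 -> \bar R}) (m2 : {sigma_finite_measure set T2 -> \bar R}).

Lemma sigma_finite_product : sigma_finite setT (m1 \x m2)%E.
Proof.
have [F FT Ff] := sigma_finiteT m1; have [G GT Gf] := sigma_finiteT m2.
pose c n := odflt (0, 0)%N (unpickle n : option (nat * nat)).
exists (fun n => F (c n).1 `*` G (c n).2).
  apply/esym/seteqP; split=> // -[x y] _.
  have [i _ Fx] : (\bigcup_i F i) x by rewrite -FT.
  have [j _ Gy] : (\bigcup_j G j) y by rewrite -GT.
  by exists (pickle (i, j)) => //; rewrite /c pickleK.
move=> n; have [mF fF] := Ff (c n).1; have [mG fG] := Gf (c n).2.
by split; [exact: measurableX|rewrite product_measure1E// lte_mul_pinfty// ge0_fin_numE].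
Qed.

(** Sigma-finiteness is attached to the product so that it can be a factor of a further product: R^3
    is built from three lines, and the double integrals below live on R^3 x R^3. *)
Definition sf_prod := HB.pack_for {sigma_finite_measure set (T1 * T2)%type -> \bar R}
  (m1 \x m2)%E (Measure_isSigmaFinite.Build _ _ _ (m1 \x m2)%E sigma_finite_product).

Variable f : T1 * T2 -> \bar R.
Hypotheses (mf : measurable_fun setT f) (f0 : forall x, (0 <= f x)%E).

Lemma tonelli1 : (\int[sf_prod]_z f z = \int[m1]_x \int[m2]_y f (x, y))%E.
Proof. exact: fubini_tonelli1. Qed.

Lemma tonelli2 : (\int[sf_prod]_z f z = \int[m2]_y \int[m1]_x f (x, y))%E.
Proof. exact: fubini_tonelli2. Qed.

Lemma tonelli_meas1 : measurable_fun setT (fun x => \int[m2]_y f (x, y))%E.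
Proof. exact: measurable_fun_fubini_tonelli_F. Qed.

Lemma tonelli_meas2 : measurable_fun setT (fun y => \int[m1]_x f (x, y))%E.
Proof. exact: measurable_fun_fubini_tonelli_G. Qed.

End sf_prod.

(** Convertible with [leb3], but carrying the sigma-finite structure. *)
Definition leb (R : realType) :=
  sf_prod (sf_prod (@lebesgue_measure R) (@lebesgue_measure R)) (@lebesgue_measure R).

Section leb3.
Context {R : realType}.
Local Notation R3 := (R3 R).
Local Notation mu := (@lebesgue_measure R).

Local Notation leb := (@leb R).

Lemma mpair d (T : measurableType d) (f g h : T -> R) :
  measurable_fun setT f -> measurable_fun setT g -> measurable_fun setT h ->
  measurable_fun setT (fun x => ((f x, g x), h x) : R3).
Proof. by move=> mf mg mh; do 2 apply: measurable_fun_pair => //. Qed.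

Lemma m11 : measurable_fun setT (fun x : R3 => x.1.1).
Proof. by apply: measurableT_comp => //; exact: measurable_fst. Qed.
Lemma m12 : measurable_fun setT (fun x : R3 => x.1.2).
Proof. by apply: measurableT_comp => //; exact: measurable_fst. Qed.
Lemma m2 : measurable_fun setT (fun x : R3 => x.2).
Proof. exact: measurable_snd. Qed.

(** For fixed [x.1] this is a translation of the line, preceded by a flip when [b] holds, so the
    inner integral in Tonelli's theorem does not change. *)
Lemma mpres_shear3 (g : R * R -> R) (b : bool) : measurable_fun setT g ->
  mpres leb (fun x => (x.1, (if b then - x.2 else x.2) + g x.1)).
Proof.
move=> mg; have mt : measurable_fun setT
    (fun x : R3 => (x.1, (if b then - x.2 else x.2) + g x.1)).
  apply: measurable_fun_pair => //=; apply: measurable_funD; last first.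
    exact: (measurableT_comp mg measurable_fst).
  by case: b; [apply: measurable_funN|]; exact: measurable_snd.
split=> // f mf f0.
rewrite /leb [LHS]tonelli1//; last exact: measurableT_comp.
rewrite [RHS](tonelli1 (sf_prod mu mu) mu mf f0); apply: eq_integral => p _ /=.
have mfp : measurable_fun setT (fun z => f (p, z)) by exact: measurableT_comp.
have [_ /(_ (fun z => f (p, z)) mfp (fun z => f0 _)) <-] := lebesgue_shift (g p).
case: b {mt} => //.
have [_ H] := @lebesgue_flip R; rewrite -(H (fun z => f (p, z + g p)))//.
have ms : measurable_fun setT (fun z : R => z + g p) by exact: measurable_funD.
exact: (measurableT_comp mfp ms).
Qed.

Lemma shift2 (v : R * R) (f : R * R -> \bar R) :
  measurable_fun setT f -> (forall x, 0 <= f x)%E ->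
  (\int[sf_prod mu mu]_p f (p.1 + v.1, p.2 + v.2)%R = \int[sf_prod mu mu]_p f p)%E.
Proof.
move=> mf f0; have ms : measurable_fun setT (fun p : R * R => (p.1 + v.1, p.2 + v.2)).
  by apply: measurable_fun_pair; apply: measurable_funD.
rewrite [LHS]tonelli1//; last exact: measurableT_comp.
rewrite [RHS](tonelli1 mu mu mf f0) /=.
have [_ H1] := lebesgue_shift v.1; have [_ H2] := lebesgue_shift v.2.
rewrite -(H1 (fun x => \int[mu]_y f (x, y)))%E; last 2 first.
- exact: tonelli_meas1.
- by move=> x; exact: integral_ge0.
apply: eq_integral => x _.
by rewrite (H2 (fun y => f (x + v.1, y)))//; exact: measurableT_comp.
Qed.

Lemma mpres_shear12 (g h : R -> R) : measurable_fun setT g -> measurable_fun setT h ->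
  mpres leb (fun x => ((x.1.1 + g x.2, x.1.2 + h x.2), x.2)).
Proof.
move=> mg mh; have mt : measurable_fun setT
    (fun x : R3 => ((x.1.1 + g x.2, x.1.2 + h x.2), x.2)).
  apply: mpair; last exact: m2.
    by apply: measurable_funD; [exact: m11|exact: (measurableT_comp mg m2)].
  by apply: measurable_funD; [exact: m12|exact: (measurableT_comp mh m2)].
split=> // f mf f0.
rewrite /leb [LHS]tonelli2//; last exact: measurableT_comp.
rewrite [RHS](tonelli2 (sf_prod mu mu) mu mf f0); apply: eq_integral => z _ /=.
by rewrite (shift2 (g z, h z) (f := fun p => f (p, z)))//; exact: measurableT_comp.
Qed.

Definition add3 (x y : R3) : R3 := ((x.1.1 + y.1.1, x.1.2 + y.1.2), x.2 + y.2).
Definition opp3 (x : R3) : R3 := ((- x.1.1, - x.1.2), - x.2).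

Lemma mpres_shift (h : R3) : mpres leb (fun x => add3 x h).
Proof.
have := mpres_comp (mpres_shear12 (g := cst h.1.1) (h := cst h.1.2) _ _)
  (mpres_shear3 (g := cst h.2) false _).
by apply; exact: measurable_cst.
Qed.

Section reflection.
Variables a b s : R.

(** Reflection in the plane [a x1 + b x2 + x3 = s]: [refl_l] is the affine form vanishing on it and
    [refl_k] is 2 over the squared length of the normal [(a, b, 1)]. The coefficient 1 allows the
    factorisation into shears in [mpres_refl], and such normals are enough for [refl_pole]. *)
Definition refl_k := 2 / (a ^+ 2 + b ^+ 2 + 1).
Definition refl_l (x : R3) := a * x.1.1 + b * x.1.2 + x.2 - s.
Definition refl (x : R3) : R3 :=
  ((x.1.1 - refl_k * refl_l x * a, x.1.2 - refl_k * refl_l x * b), x.2 - refl_k * refl_l x).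

Lemma refl_n0 : a ^+ 2 + b ^+ 2 + 1 != 0.
Proof. by apply: lt0r_neq0; have := sqr_ge0 a; have := sqr_ge0 b; lra. Qed.

Lemma refl_lK x : refl_l (refl x) = - refl_l x.
Proof. by rewrite /refl /refl_l /refl_k/=; field; exact: refl_n0. Qed.

Lemma reflK : involutive refl.
Proof.
move=> x; rewrite {1}/refl refl_lK; case: x => [[x y] z]; rewrite /refl/=.
by congr ((_, _), _); ring.
Qed.

(** In the coordinate [w = a x1 + b x2 + x3], introduced by a shear, the reflection sends [w] to
    [2 s - w] and translates [x1] and [x2] by amounts that depend on [w] alone; a last shear
    restores [x3]. *)
Lemma mpres_refl : mpres leb refl.
Proof.
have H1 := mpres_shear3 (g := fun p : R * R => a * p.1 + b * p.2) false.
have H2 := mpres_shear12 (g := fun w => - (refl_k * a * (w - s))) (h := fun w => - (refl_k * b * (w - s))).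
have H3 := mpres_shear3 (g := cst (2 * s)) true.
have H4 := mpres_shear3 (g := fun p : R * R => - (a * p.1 + b * p.2)) false.
have m1 : measurable_fun setT (fun p : R * R => a * p.1 + b * p.2).
  by apply: measurable_funD; apply: measurable_funM.
have ml c : measurable_fun setT (fun w : R => - (refl_k * c * (w - s))).
  by apply: measurable_funN; apply: measurable_funM => //; exact: measurable_funB.
have := mpres_comp (H4 (measurable_funN m1)) (mpres_comp (H3 (measurable_cst _)) (mpres_comp (H2 (ml _) (ml _)) (H1 m1))).
rewrite (_ : _ \o _ = refl)//; apply/funext => -[[x y] z]; rewrite /refl /refl_l/=.
congr ((_, _), _); [ring|ring|].
by rewrite /refl_k; field; exact: refl_n0.
Qed.

End reflection.
End leb3.

(** * Smooth bump functions on the line *)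

Section smooth.
Context {R : realType}.
Implicit Types f g : R -> R.

Fixpoint CN n f := if n is n'.+1 then (forall x, derivable f x 1) /\ CN n' (derive1 f) else True.
Definition smooth f := forall n, CN n f.

Lemma CNW n f : CN n.+1 f -> CN n f.
Proof. by elim: n f => // n IH f [df cf]; split=> //; apply: IH. Qed.

Lemma is_derive_derive1 f (x : R) : derivable f x 1 -> is_derive x 1 f (derive1 f x).
Proof. by move=> df; rewrite derive1E; exact: derivableP. Qed.

Lemma derive1_of f f' : (forall x : R, is_derive x 1 f (f' x)) -> (derive1 f) = f'.
Proof. by move=> H; apply/funext => x; rewrite derive1E; apply: derive_val. Qed.

Lemma CN_of n f f' : (forall x : R, is_derive x 1 f (f' x)) -> CN n f' -> CN n.+1 f.
Proof.
move=> H cf; split; last by rewrite (derive1_of H).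
by move=> x; apply: ex_derive.
Qed.

Lemma CN_cst n c : CN n (fun=> c).
Proof. by elim: n c => // n IH c; apply: (CN_of (f' := fun=> 0)) => // x; exact: is_derive_cst. Qed.

Lemma CN_D n f g : CN n f -> CN n g -> CN n (fun x => f x + g x).
Proof.
elim: n f g => // n IH f g [df cf] [dg cg].
apply: (CN_of (f' := fun x => derive1 f x + derive1 g x)); last exact: IH.
by move=> x; apply: is_deriveD; exact: is_derive_derive1.
Qed.

Lemma CN_M n f g : CN n f -> CN n g -> CN n (fun x => f x * g x).
Proof.
elim: n f g => // n IH f g cf cg.
have [df cf'] := cf; have [dg cg'] := cg.
apply: (CN_of (f' := fun x => f x * derive1 g x + g x * derive1 f x)).
  by move=> x; apply: is_deriveM; exact: is_derive_derive1.
by apply: CN_D; apply: IH => //; exact: CNW.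
Qed.

Lemma CN_affine n f c d : CN n f -> CN n (fun x => f (c * x + d)).
Proof.
elim: n f => // n IH f [df cf].
apply: (CN_of (f' := fun x => derive1 f (c * x + d) * c)); last first.
  by apply: CN_M; [exact: IH|exact: CN_cst].
move=> x; apply: (is_derive1_comp (f := f) (g := fun x => c * x + d)).
  exact: is_derive_derive1.
have -> : c = c *: (1 : R) + 0 by rewrite addr0 scaler1.
apply: is_deriveD; rewrite ?addr0 ?scaler1.
have := is_deriveZ (f := (id : R -> R)) c (is_derive_id x (1:R)).
by rewrite scaler1; apply.
Qed.

(** The functions [x^(-k) exp(-1/x)], extended by 0, form a family whose derivatives are linear
    combinations of its members ([is_derive_flat]); smoothness follows by induction on the order,
    for all [k] together. *)
Definition flat k (x : R) : R := if 0 < x then x^-1 ^+ k * expR (- x^-1) else 0.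

(** With [y = 1/x] this is the bound [y^(k+1) <= (k+1)! exp y]. Since [flat k h / h = flat k.+1 h],
    it shows that the derivative at 0 vanishes. *)
Lemma flat_bound k x : `|flat k x| <= k.+1`!%:R * `|x|.
Proof.
rewrite /flat; case: ifP => x0; last by rewrite normr0 mulr_ge0.
have y0 : 0 < x^-1 by rewrite invr_gt0.
rewrite (gtr0_norm x0) ger0_norm ?mulr_ge0 ?expR_ge0 ?exprn_ge0 ?(ltW y0)//.
have ex : x = x^-1^-1 by rewrite invrK.
rewrite {3}ex; move: y0; move: x^-1 => y y0.
rewrite ler_pdivlMr// mulrAC -exprSr expRN.
rewrite ler_pdivrMr ?expR_gt0// mulrC -ler_pdivrMr ?ltr0n ?fact_gt0//.
by apply: le_trans (expR_ge1Dxn k (ltW y0)); rewrite lerDr.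
Qed.

Lemma is_derive_near f g (x : R) df : {near x, g =1 f} -> is_derive x 1 g df -> is_derive x 1 f df.
Proof.
move=> gf dg; apply: DeriveDef; first by apply: near_eq_derivable gf _; apply: ex_derive.
by rewrite -(near_eq_derive (1:R) gf); apply: derive_val.
Qed.

Lemma is_derive_flat k (x : R) : is_derive x 1 (flat k) (flat k.+2 x - k%:R * flat k.+1 x).
Proof.
have [x0|x0|<-] := ltgtP 0 x.
- apply: (is_derive_near (g := fun x => x^-1 ^+ k * expR (- x^-1))).
    near=> y; rewrite /flat ifT//; near: y; exact: lt_nbhsr.
  have dV : is_derive x 1 (fun y : R => y^-1) (- x ^- 2).
    have := @is_deriveV R id x (1:R) (1:R) (lt0r_neq0 x0) (is_derive_id x (1:R)).
    by rewrite scaler1.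
  have d1 : is_derive x 1 (fun y : R => y^-1 ^+ k) (k%:R * x^-1 ^+ k.-1 * (- x ^- 2)).
    have := @is_deriveX R R (fun y => y^-1) k x 1 _ dV.
    by rewrite exprfctE => /is_derive_eq; apply.
  have d2 : is_derive x 1 (fun y : R => expR (- y^-1)) (expR (- x^-1) * x ^- 2).
    have dN : is_derive x 1 (fun y : R => - y^-1) (x ^- 2) by have := is_deriveN dV; rewrite opprK.
    exact: (@is_derive1_comp R expR (fun y => - y^-1) x _ _ (is_derive_expR _) dN).
  have := is_deriveM d1 d2; rewrite /flat x0 => /is_derive_eq; apply.
  rewrite /GRing.scale/= -exprVn.
  case: k d1 => [|k] d1 /=; first by rewrite !expr0; ring.
  by rewrite !exprS; ring.
- rewrite /flat ifF; last by apply/negbTE; rewrite -leNgt ltW.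
  rewrite ifF; last by apply/negbTE; rewrite -leNgt ltW.
  rewrite mulr0 subr0; apply: (is_derive_near (g := fun=> 0)).
  near=> y; rewrite ifF//; apply/negbTE; rewrite -leNgt ltW//; near: y; exact: lt_nbhsl.
- have E j : flat j 0 = 0 by rewrite /flat ltxx.
  have H : h^-1 *: ((flat k \o shift 0) (h *: 1) - flat k 0) @[h --> (0:R)^'] --> (0 : R).
    apply/cvgrPdist_le => e e0; near=> h.
    rewrite sub0r normrN E subr0 /= addr0 [h *: 1]mulr1.
    have h0 : h != 0 by near: h; exact: nbhs_dnbhs_neq.
    have -> : h^-1 *: flat k h = flat k.+1 h.
      rewrite /flat; case: ifP => _; last by rewrite scaler0.
      by rewrite exprS /GRing.scale/=; ring.
    apply: le_trans (flat_bound _ _) _.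
    have c0 : 0 < k.+2`!%:R :> R by rewrite ltr0n fact_gt0.
    rewrite mulrC -ler_pdivlMr//.
    near: h; apply: dnbhs0_le; exact: divr_gt0.
  rewrite !E mulr0 subr0.
  by apply: DeriveDef; [apply/cvg_ex; exists 0|exact: cvg_lim H].
Unshelve. all: by end_near. Qed.

Lemma smooth_flat k : smooth (flat k).
Proof.
move=> n; elim: n k => // n IH k; apply: (CN_of (is_derive_flat k)).
have -> : (fun x => flat k.+2 x - k%:R * flat k.+1 x) = (fun x => flat k.+2 x + (- k%:R) * flat k.+1 x).
  by apply/funext => x; rewrite mulNr.
by apply: CN_D => //; apply: CN_M => //; exact: CN_cst.
Qed.

Lemma smooth_derivable f : smooth f -> forall x, derivable f x 1.
Proof. by move=> /(_ 1%N)[]. Qed.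

Lemma smooth_derive1 f : smooth f -> smooth (derive1 f).
Proof. by move=> sf n; have [] := sf n.+1. Qed.

Lemma smooth_cont f : smooth f -> continuous f.
Proof.
by move=> sf x; apply: differentiable_continuous; apply/derivable1_diffP; exact: smooth_derivable.
Qed.

(* Tends to the indicator of ]a, b[ as c tends to infinity. *)
Definition bump (a b c x : R) : R := flat 0 (c * (x - a)) * flat 0 (c * (b - x)).

Lemma smooth_bump a b c : smooth (bump a b c).
Proof.
move=> n; rewrite /bump; apply: CN_M.
- by have := CN_affine c (- (c * a)) (smooth_flat 0 n); under eq_fun do rewrite -mulrBr.
- have := CN_affine (- c) (c * b) (smooth_flat 0 n).
  by under eq_fun do rewrite mulNr addrC -mulrBr.
Qed.

Lemma flat0_01 x : 0 <= flat 0 x <= 1.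
Proof.
rewrite /flat; case: ifP => x0; last by rewrite lexx ler01.
by rewrite expr0 mul1r expR_ge0 -expR0 ler_expR oppr_le0 invr_ge0 ltW.
Qed.

Lemma bump_01 a b c x : 0 <= bump a b c x <= 1.
Proof.
have /andP[h1 h2] := flat0_01 (c * (x - a)); have /andP[h3 h4] := flat0_01 (c * (b - x)).
by rewrite mulr_ge0//= mulr_ile1.
Qed.

Lemma bump_out a b c x : 0 < c -> x \notin `]a, b[ -> bump a b c x = 0.
Proof.
move=> c0; rewrite in_itv/= negb_and -!leNgt /bump /flat !pmulr_rgt0// !subr_gt0.
by case/orP => h; rewrite (leNgt _ _) in h *; rewrite ltNge; rewrite -ltNge ?(negbTE h) ?mul0r ?mulr0.
Qed.

Lemma cvg_flat0 x : 0 < x -> (fun n => flat 0 (n.+1%:R * x)) @ \oo --> (1 : R).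
Proof.
move=> x0; have -> : (fun n => flat 0 (n.+1%:R * x)) = (fun n => expR (- (n.+1%:R^-1 * x^-1))).
  apply/funext => n; rewrite /flat pmulr_rgt0 ?ltr0n// x0 expr0 mul1r.
  by rewrite invfM.
rewrite -[X in _ --> X]expR0; apply: continuous_cvg; first exact: continuous_expR.
have H : (fun n => n.+1%:R^-1 * x^-1) @ \oo --> (0 * x^-1 : R).
  by apply: cvgM; [exact: cvg_harmonic|exact: cvg_cst].
by rewrite mul0r in H; rewrite -oppr0; apply: cvgN.
Qed.

Lemma cvg_bump a b x : (fun n => bump a b n.+1%:R x) @ \oo --> (\1_(`]a, b[%classic) x : R).
Proof.
rewrite indicE; have [xab|xab] := boolP (x \in `]a, b[).
  rewrite mem_set//; move: xab; rewrite in_itv/= => /andP[ax xb].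
  rewrite -[X in _ --> X](mulr1 1); apply: cvgM; apply: cvg_flat0; by rewrite subr_gt0.
rewrite memNset; last by move=> /= H; rewrite H in xab.
apply: cvg_near_cst; apply: nearW => n; rewrite bump_out//.
Qed.

End smooth.

(** * Test functions on R^3 *)

Section tests.
Context {R : realType}.
Local Notation R3 := (R3 R).
Implicit Types (f g phi psi : R3 -> R) (x y h : R3).

Lemma cvg_R3 (T : Type) (F : set_system T) (FF : Filter F) (f g h : T -> R) (a b c : R) :
  f @ F --> a -> g @ F --> b -> h @ F --> c ->
  (fun t => ((f t, g t), h t)) @ F --> (((a, b), c) : R3).
Proof.
move=> fa gb hc.
have fg : (fun t => (f t, g t)) @ F --> ((a, b) : R * R).
  exact: (@cvg_pair _ _ _ F (nbhs a) (nbhs b) _ _ _ f g fa gb).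
exact: (@cvg_pair _ _ _ F (nbhs ((a, b) : R * R)) (nbhs c) _ _ _ (fun t => (f t, g t)) h fg hc).
Qed.

Definition box_le (L : R) x := [/\ `|x.1.1| <= L, `|x.1.2| <= L & `|x.2| <= L].
Definition bsupp f (L : R) := forall x, f x != 0 -> box_le L x.
(** [test_fun] with the compact support replaced by a bounding box ([test_funP]), a quantitative
    form that passes easily to sums and shifts and bounds L2 norms. *)
Definition tst phi :=
  (forall l, continuous (iter_pderiv l phi) /\ forall i x, pderivable i (iter_pderiv l phi) x) /\
  exists L, bsupp phi L.

Lemma cont11 : continuous (fun x : R3 => x.1.1).
Proof. by move=> x; apply: continuous_comp; [exact: cvg_fst|exact: cvg_fst]. Qed.
Lemma cont12 : continuous (fun x : R3 => x.1.2).
Proof. by move=> x; apply: continuous_comp; [exact: cvg_fst|exact: cvg_snd]. Qed.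
Lemma cont2 : continuous (fun x : R3 => x.2).
Proof. by move=> x; exact: cvg_snd. Qed.

Definition cbox (L : R) : set R3 := (`[- L, L] `*` `[- L, L]) `*` `[- L, L].

Lemma cboxP L x : cbox L x <-> box_le L x.
Proof.
rewrite /cbox /=; rewrite !in_itv/= -!ler_norml; split; first by move=> [[]].
by move=> [].
Qed.

Lemma compact_cbox L : compact (cbox L).
Proof. by apply: compact_setX; [apply: compact_setX|]; exact: segment_compact. Qed.

Lemma closed_cbox L : closed (cbox L).
Proof.
have -> : cbox L = ((fun x : R3 => x.1.1) @^-1` `[- L, L]) `&` ((fun x : R3 => x.1.2) @^-1` `[- L, L])
    `&` ((fun x : R3 => x.2) @^-1` `[- L, L]).
  by apply/seteqP; split=> x [[? ?] ?].
by apply: closedI; [apply: closedI|]; apply: closed_comp;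
  do ?[exact: itv_closed|move=> x _; exact: cont11|move=> x _; exact: cont12|move=> x _; exact: cont2].
Qed.

Lemma compact_range_bound (A : set R3) (p : R3 -> R) : compact A -> continuous p ->
  exists M, forall x, A x -> `|p x| <= M.
Proof.
move=> cA cp; have /compact_bounded : compact (p @` A).
  by apply: continuous_compact => //; exact: continuous_subspaceT.
move=> [M [_ HM]]; exists (M + 1) => x Ax.
by apply: (HM (M + 1)); [rewrite ltrDl|exists x].
Qed.

Lemma test_funP phi : test_fun phi <-> tst phi.
Proof.
split=> -[sm]; last first.
  move=> [L bL]; split=> //.
  apply: subclosed_compact (@compact_cbox L) _; first exact: closed_closure.
  move=> x cx; apply: closed_cbox; apply: closure_subset cx.
  by move=> y /= /bL ?; apply/cboxP.
move=> cc; split=> //.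
have [M1 H1] := compact_range_bound cc cont11.
have [M2 H2] := compact_range_bound cc cont12.
have [M3 H3] := compact_range_bound cc cont2.
exists (Num.max M1 (Num.max M2 M3)) => x fx.
have cx : closure [set x | phi x != 0] x by exact: subset_closure.
by split; rewrite !le_max ?H1 ?H2 ?H3 ?orbT.
Qed.

Lemma tst_cont phi : tst phi -> continuous phi.
Proof. by move=> [/(_ [::])[]]. Qed.

Lemma tst_bound phi : tst phi -> exists2 M, 0 <= M & forall x, `|phi x| <= M.
Proof.
move=> tp; have [_ [L bL]] := tp.
have [M HM] := compact_range_bound (@compact_cbox L) (tst_cont tp).
exists (Num.max 0 M) => [|x]; first by rewrite le_max lexx.
have [->|fx] := eqVneq (phi x) 0; first by rewrite normr0 le_max lexx.
by rewrite le_max HM ?orbT//; apply/cboxP; exact: bL.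
Qed.

Section measurable_continuous.

Lemma floor_grid_cvg (a : R) : (fun n => (Num.floor (a * n.+1%:R))%:~R / n.+1%:R : R) @ \oo --> a.
Proof.
apply/cvgrPdist_le => e e0; have [N _ HN] := near_infty_natSinv_lt (PosNum e0).
exists N => // n Nn; have /= := HN n Nn => ne.
have n0 : 0 < n.+1%:R :> R by rewrite ltr0n.
have /andP[h1 h2] := floor_itv (a * n.+1%:R).
rewrite intrD mulr1z in h2; apply: le_trans (ltW ne).
rewrite -[X in `|X - _|](mulfK (lt0r_neq0 n0)) -mulrBl normrM [X in _ * X]gtr0_norm ?invr_gt0//.
apply: ler_piMl; first by rewrite invr_ge0 ltW.
move: (a * _) (_%:~R) h1 h2 => u v h1 h2.
by rewrite ler_norml; apply/andP; split; lra.
Qed.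

Lemma measurable_floor_fiber (c : R) (i : int) : 0 < c ->
  measurable [set a : R | Num.floor (a * c) = i].
Proof.
move=> c0; rewrite (_ : [set a | _] = `[i%:~R / c, (i + 1)%:~R / c[%classic) //.
apply/seteqP; split=> a /=; rewrite in_itv/= ler_pdivrMr// ltr_pdivlMr//.
  by move=> <-; exact: floor_itv.
by move=> H; apply: floor_def.
Qed.

(** Measurability refers to the product sigma-algebra. The function is the pointwise limit of its
    values at points rounded to the grid of mesh [1 / (n + 1)], and each of these approximations is
    constant on countably many measurable cubes. *)
Lemma measurable_continuous3 f : continuous f -> measurable_fun setT f.
Proof.
move=> cf.
pose q n x : R3 := (((Num.floor (x.1.1 * n.+1%:R))%:~R / n.+1%:R, (Num.floor (x.1.2 * n.+1%:R))%:~R / n.+1%:R),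
   (Num.floor (x.2 * n.+1%:R))%:~R / n.+1%:R).
apply: (@measurable_fun_cvg _ _ _ _ (fun n x => f (q n x))); last first.
  move=> x _; apply: (@cvg_comp _ _ _ (q^~ x) f _ (nbhs x)); last exact: cf.
  by case: x => [[a b] c]; apply: cvg_R3; exact: floor_grid_cvg.
move=> n _ Y mY; rewrite setTI.
pose F (i : int * int * int) : set R3 := [set x | f (((i.1.1%:~R / n.+1%:R), i.1.2%:~R / n.+1%:R), i.2%:~R / n.+1%:R) \in Y] `&`
   (([set a : R | Num.floor (a * n.+1%:R) = i.1.1] `*` [set a : R | Num.floor (a * n.+1%:R) = i.1.2])
     `*` [set a : R | Num.floor (a * n.+1%:R) = i.2]).
rewrite (_ : _ @^-1` Y = \bigcup_i F i).
  apply: countable_bigcupT_measurable; first exact: countableP.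
  move=> i; apply: measurableI.
    by case: (_ \in Y); [rewrite set_true|rewrite set_false]; [exact: measurableT|exact: measurable0].
  by apply: measurableX; [apply: measurableX|]; apply: measurable_floor_fiber; rewrite ltr0n.
apply/seteqP; split=> x /=.
  move=> H; exists ((Num.floor (x.1.1 * n.+1%:R), Num.floor (x.1.2 * n.+1%:R)), Num.floor (x.2 * n.+1%:R)) => //.
  by split=> //=; rewrite inE.
by move=> [i _ [/= Yi [[h1 h2] h3]]]; rewrite /q h1 h2 h3; exact: set_mem.
Qed.
End measurable_continuous.

Lemma tst_meas phi : tst phi -> measurable_fun setT phi.
Proof. by move/tst_cont/measurable_continuous3. Qed.

Lemma measurable_cbox L : measurable (cbox L).
Proof. by apply: measurableX; [apply: measurableX|]; exact: measurable_itv. Qed.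

Lemma leb_prod (A B C : set R) : measurable A -> measurable B -> measurable C ->
  leb R ((A `*` B) `*` C) = (lebesgue_measure A * lebesgue_measure B * lebesgue_measure C)%E.
Proof.
move=> mA mB mC.
have := @product_measure1E _ _ _ _ R (sf_prod (@lebesgue_measure R) (@lebesgue_measure R))
  (@lebesgue_measure R) (A `*` B) C (measurableX mA mB) mC.
move=> H; transitivity (sf_prod (@lebesgue_measure R) (@lebesgue_measure R) (A `*` B) * lebesgue_measure C)%E => //.
by congr (_ * _)%E; exact: (@product_measure1E _ _ _ _ R (@lebesgue_measure R) (@lebesgue_measure R)).
Qed.

Lemma leb_cbox_lty L : (leb R (cbox L) < +oo)%E.
Proof.
rewrite leb_prod//; try exact: measurable_itv.
by rewrite !lebesgue_measure_itv/=; case: ifP => _; rewrite ?mule0// -EFinB -!EFinM ltry.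
Qed.

Lemma bounded_bsupp_l2 f M L : measurable_fun setT f -> (forall x, `|f x| <= M) -> bsupp f L -> l2 (leb R) f.
Proof.
move=> mf fM bf. refine (@l2_dom _ _ R (leb R) f (fun x => M * \1_(cbox L) x) mf _ _).
  move=> x; rewrite indicE; have [->|fx] := eqVneq (f x) 0; first by rewrite normr0.
  by rewrite mem_set ?mulr1; [apply: le_trans (fM x) (ler_norm _)|apply/cboxP; exact: bf].
by apply: l2Z; apply: l2_indic; [exact: measurable_cbox|exact: leb_cbox_lty].
Qed.

Lemma tst_l2 phi : tst phi -> l2 (leb R) phi.
Proof.
move=> tp; have [M _ HM] := tst_bound tp; have [_ [L bL]] := tp.
exact: bounded_bsupp_l2 (tst_meas tp) HM bL.
Qed.

Definition e3 (i : 'I_3) (t : R) : R3 := coord_line i ((0, 0), 0) t.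

Lemma add3_coord i x t : add3 x (e3 i t) = coord_line i x (Defs.coord i x + t).
Proof.
by case: x => [[a b] c]; rewrite /e3 /add3 /coord_line /Defs.coord; case: (val i == 0%N) => /=; case: (val i == 1%N) => /=; rewrite ?addr0.
Qed.

Lemma coord_line2 i x s t : coord_line i (coord_line i x s) t = coord_line i x t.
Proof. by rewrite /coord_line; case: (val i == 0%N) => /=; case: (val i == 1%N) => /=. Qed.

Lemma coord_lineK i x s : Defs.coord i (coord_line i x s) = s.
Proof. by rewrite /coord_line /Defs.coord; case: (val i == 0%N) => /=; case: (val i == 1%N) => /=. Qed.

Lemma coord_line_id i x : coord_line i x (Defs.coord i x) = x.
Proof. by case: x => [[a b] c]; rewrite /coord_line /Defs.coord; case: (val i == 0%N) => /=; case: (val i == 1%N) => /=. Qed.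

Lemma pderivable_line i f x (s : R) : pderivable i f (coord_line i x s) ->
  is_derive s (1 : R) (fun t => f (coord_line i x t)) (pderiv i f (coord_line i x s)).
Proof.
have E : (fun t => f (coord_line i (coord_line i x s) t)) = (fun t => f (coord_line i x t)).
  by apply/funext => t; rewrite coord_line2.
by rewrite /pderivable /pderiv coord_lineK E => H; exact: is_derive_derive1.
Qed.

Lemma pderivE i f x d : is_derive (Defs.coord i x) (1 : R) (fun t => f (coord_line i x t)) d ->
  pderiv i f x = d /\ pderivable i f x.
Proof.
move=> H; split; last by rewrite /pderivable; apply: ex_derive.
by rewrite /pderiv derive1E; apply: derive_val.
Qed.

Lemma tst_shift_derive i phi x t : tst phi ->
  is_derive t (1 : R) (fun s => phi (add3 x (e3 i s))) (pderiv i phi (add3 x (e3 i t))).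
Proof.
move=> [/(_ [::])[_ H] _]; under eq_fun do rewrite add3_coord; rewrite add3_coord.
have D := pderivable_line (H i (coord_line i x (Defs.coord i x + t))).
have S : is_derive t (1 : R) (fun s => Defs.coord i x + s) (1 : R).
  by have := is_deriveD (is_derive_cst (Defs.coord i x) t (1:R)) (is_derive_id t (1 : R)); rewrite add0r.
by have := is_derive1_comp D S; rewrite mulr1.
Qed.

(** The complement of the box is open, so [phi] vanishes along the line near a point outside. *)
Lemma bsupp_pderiv i phi L : bsupp phi L -> bsupp (pderiv i phi) L.
Proof.
move=> bL x; apply: contra_neqP => nb.
have oC := closed_openC (@closed_cbox L).
have xC : (~` cbox L) x by move/cboxP.
have Z y : (~` cbox L) y -> phi y = 0.
  by move=> yC; apply: contra_notP yC => /eqP /bL /cboxP.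
suff /pderivE[] : is_derive (Defs.coord i x) (1 : R) (fun t => phi (coord_line i x t)) 0 by [].
apply: (is_derive_near (g := fun=> 0)).
have cl : {for Defs.coord i x, continuous (coord_line i x)}.
  rewrite /coord_line; case: (val i == 0%N); [|case: (val i == 1%N)].
  - by apply: cvg_R3; [exact: cvg_id|exact: cvg_cst|exact: cvg_cst].
  - by apply: cvg_R3; [exact: cvg_cst|exact: cvg_id|exact: cvg_cst].
  - by apply: cvg_R3; [exact: cvg_cst|exact: cvg_cst|exact: cvg_id].
have N : nbhs (coord_line i x (Defs.coord i x)) (~` cbox L) by rewrite coord_line_id; exact: open_nbhs_nbhs.
have : \forall s \near Defs.coord i x, (~` cbox L) (coord_line i x s) by exact: cl _ N.
by apply: filterS => s /= /Z ->.
Qed.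

Lemma tst_pderiv i phi : tst phi -> tst (pderiv i phi).
Proof.
move=> [sm [L bL]]; split; last by exists L; exact: bsupp_pderiv.
by move=> l; have := sm (rcons l i); rewrite /iter_pderiv foldr_rcons.
Qed.

Lemma tst0 : tst (fun=> 0).
Proof.
have E l : iter_pderiv l (fun=> 0 : R) = (fun=> 0) :> (R3 -> R).
  elim: l => //= i l ->; apply/funext => x.
  by have [] := @pderivE i (fun=> 0) x 0 (is_derive_cst _ _ _).
split; last by exists 0 => x; rewrite eqxx.
move=> l; rewrite E; split; first by move=> x; exact: cvg_cst.
by move=> i x; have [] := @pderivE i (fun=> 0) x 0 (is_derive_cst _ _ _).
Qed.

Lemma tst_lin a phi psi : tst phi -> tst psi -> tst (fun x => a * phi x + psi x).
Proof.
move=> [sp [L bL]] [sq [K bK]].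
have D i f g x : pderivable i f x -> pderivable i g x ->
    is_derive (Defs.coord i x) (1 : R) (fun t => a * f (coord_line i x t) + g (coord_line i x t))
      (a * pderiv i f x + pderiv i g x).
  rewrite -{1 2}(coord_line_id i x) => /pderivable_line Df /pderivable_line Dg.
  have := is_deriveD (is_deriveZ a Df) Dg.
  by rewrite !coord_line_id.
have E l : iter_pderiv l (fun x => a * phi x + psi x) =
    (fun x => a * iter_pderiv l phi x + iter_pderiv l psi x).
  elim: l => //= i l ->; apply/funext => x.
  by have [] := @pderivE i (fun x => a * iter_pderiv l phi x + iter_pderiv l psi x) x _ (D i _ _ x ((sp l).2 i x) ((sq l).2 i x)).
split.
  move=> l; rewrite E; split.
    move=> x; apply: cvgD; last exact: (sq l).1.
    by apply: cvgM; [exact: cvg_cst|exact: (sp l).1].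
  by move=> i x; have [] := @pderivE i (fun x => a * iter_pderiv l phi x + iter_pderiv l psi x) x _ (D i _ _ x ((sp l).2 i x) ((sq l).2 i x)).
exists (Num.max L K) => x; have [->|/bL[h1 h2 h3] _] := eqVneq (phi x) 0.
  by rewrite mulr0 add0r => /bK[h1 h2 h3]; split; rewrite le_max ?h1 ?h2 ?h3 orbT.
by split; rewrite le_max ?h1 ?h2 ?h3.
Qed.

Lemma tst_shift h phi : tst phi -> tst (fun x => phi (add3 x h)).
Proof.
move=> [sp [L bL]].
have C i f x t : f (add3 (coord_line i x t) h) = f (coord_line i (add3 x h) (t + Defs.coord i h)).
  by congr f; rewrite /coord_line /Defs.coord /add3; case: (val i == 0%N) => /=; case: (val i == 1%N) => /=.
have D i f x : pderivable i f (add3 x h) ->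
    is_derive (Defs.coord i x) (1 : R) (fun t => f (add3 (coord_line i x t) h)) (pderiv i f (add3 x h)).
  under eq_fun do rewrite C.
  have e : coord_line i (add3 x h) (Defs.coord i x + Defs.coord i h) = add3 x h.
    rewrite -[RHS](coord_line_id i); congr coord_line.
    by rewrite /Defs.coord /add3; case: (val i == 0%N) => /=; case: (val i == 1%N) => /=.
  move=> pd; have Df := @pderivable_line i f (add3 x h) (Defs.coord i x + Defs.coord i h).
  rewrite e in Df; have {}Df := Df pd.
  have S : is_derive (Defs.coord i x) (1 : R) (fun s => s + Defs.coord i h) (1 : R).
    by have := is_deriveD (is_derive_id (Defs.coord i x) (1 : R)) (is_derive_cst (Defs.coord i h) (Defs.coord i x) (1:R)); rewrite addr0.
  have := @is_derive1_comp R (fun t => f (coord_line i (add3 x h) t)) (fun s => s + Defs.coord i h)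
    (Defs.coord i x) _ _ Df S.
  by rewrite mulr1.
have E l : iter_pderiv l (fun x => phi (add3 x h)) = (fun x => iter_pderiv l phi (add3 x h)).
  elim: l => //= i l ->; apply/funext => x.
  by have [] := @pderivE i (fun x => iter_pderiv l phi (add3 x h)) x _ (D i _ x ((sp l).2 i _)).
split.
  move=> l; rewrite E; split; last first.
    by move=> i x; have [] := @pderivE i (fun x => iter_pderiv l phi (add3 x h)) x _ (D i _ x ((sp l).2 i _)).
  move=> x; apply: (@continuous_comp _ _ _ (fun x => add3 x h)); last exact: (sp l).1.
  by apply: cvg_R3; apply: cvgD;
    do ?[exact: cvg_cst|exact: cont11|exact: cont12|exact: cont2].
exists (L + `|h.1.1| + `|h.1.2| + `|h.2|) => x /bL[/= h1 h2 h3].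
have T (u v : R) : `|u + v| <= L -> `|u| <= L + `|v|.
  by move=> H; have := ler_normD (u + v) (- v); rewrite addrK normrN; lra.
have := normr_ge0 h.1.1; have := normr_ge0 h.1.2; have := normr_ge0 h.2.
by have := T _ _ h1; have := T _ _ h2; have := T _ _ h3; split; lra.
Qed.

Lemma tst_mvt i phi x t : tst phi ->
  exists2 s, `|s| <= `|t| & phi (add3 x (e3 i t)) - phi x = t * pderiv i phi (add3 x (e3 i s)).
Proof.
move=> tp.
have x0 : add3 x (e3 i 0) = x by rewrite add3_coord addr0 coord_line_id.
pose F s := phi (add3 x (e3 i s)).
have dF s : is_derive s (1 : R) F (pderiv i phi (add3 x (e3 i s))) by exact: tst_shift_derive.
have cF a b : {within `[a, b], continuous F}.
  by apply: derivable_within_continuous => s _; apply: ex_derive.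
have [t0|t0|<-] := ltgtP 0 t.
- have [s + E] := MVT t0 (fun s _ => dF s) (cF 0 t).
  rewrite in_itv/= => /andP[s0 st]; exists s; first by rewrite !gtr0_norm ?ltW.
  by move: E; rewrite /F x0 subr0 mulrC.
- have [s + E] := MVT t0 (fun s _ => dF s) (cF t 0).
  rewrite in_itv/= => /andP[s0 st]; exists s; first by rewrite !ltr0_norm ?lerN2 ?ltW.
  by move: E; rewrite /F x0 sub0r => E; rewrite -opprB E; ring.
- by exists 0; rewrite // x0 subrr mul0r.
Qed.

End tests.

(** * Fundamental lemma of the calculus of variations; density of test functions *)

Lemma cvg_EFin_seq (R : realType) (f : nat -> R) (l : R) :
  f @ \oo --> l -> (fun n => (f n)%:E) @ \oo --> l%:E.
Proof. by move=> H; apply: cvg_EFin => //; exact: nearW. Qed.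

Section ae.
Context d (T : measurableType d) (R : realType) (m : {measure set T -> \bar R}).

Lemma ae_imp (P Q : T -> Prop) : (forall x, P x -> Q x) ->
  {ae m, forall x, P x} -> {ae m, forall x, Q x}.
Proof. by move=> PQ; apply: filterS. Qed.

Lemma ae_imp2 (P Q S : T -> Prop) : (forall x, P x -> Q x -> S x) ->
  {ae m, forall x, P x} -> {ae m, forall x, Q x} -> {ae m, forall x, S x}.
Proof. by move=> PQ; apply: filterS2. Qed.

End ae.

Section dct.
Context d (T : measurableType d) (R : realType) (m : {measure set T -> \bar R}).

Lemma rint_dct (fs : nat -> T -> R) (f G : T -> R) :
  (forall n, measurable_fun setT (fs n)) -> measurable_fun setT f ->
  (forall x, fs ^~ x @ \oo --> f x) -> (forall n x, `|fs n x| <= G x) -> intble m G ->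
  intble m f /\ (fun n => rint m (fs n)) @ \oo --> rint m f.
Proof.
move=> mfs mf ff fG iG.
have h1 n : measurable_fun setT (fun x => (fs n x)%:E) by exact/measurable_EFinP.
have h2 : measurable_fun setT (EFin \o f) by exact/measurable_EFinP.
have h3 : {ae m, forall x, setT x -> (fun n => (fs n x)%:E) @ \oo --> (EFin \o f) x}.
  by apply: aeW => x _; exact: cvg_EFin_seq.
have h4 : {ae m, forall x n, setT x -> (`|(fs n x)%:E| <= (EFin \o G) x)%E}.
  by apply: aeW => x n _; rewrite lee_fin.
have [i1 _ H] := dominated_convergence measurableT h1 h2 h3 iG h4.
split=> //; apply: fine_cvg; rewrite rintE//.
Qed.

End dct.

Section pi_zero.
Context d d' (T : measurableType d) (T' : measurableType d') (R : realType)
  (m : {measure set T -> \bar R}).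

(** Dynkin's theorem for a signed set function. With [p] a projection, [B] carries the constraints
    on the other coordinates, so that the class of admissible product sets is enlarged one factor at
    a time. *)
Lemma integral_pi_system0 (p : T -> T') (B : set T) (h : T -> R) (G : set (set T')) :
  measurable_fun setT p -> measurable B -> intble m h ->
  @measurable _ T' = <<s G>> -> setI_closed G ->
  (\int[m]_(x in B) (h x)%:E = 0)%E ->
  (forall A, G A -> \int[m]_(x in B `&` p @^-1` A) (h x)%:E = 0)%E ->
  forall A, measurable A -> (\int[m]_(x in B `&` p @^-1` A) (h x)%:E = 0)%E.
Proof.
move=> mp mB ih GE GI h0 hG A; rewrite GE.
have mpre E : measurable E -> measurable (B `&` p @^-1` E).
  by move=> mE; apply: measurableI => //; rewrite -[X in measurable X]setTI; exact: mp.
have mh : measurable_fun setT (EFin \o h) by case/integrableP : ih.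
apply: (@dynkin_induction _ T' G (fun A => \int[m]_(x in B `&` p @^-1` A) (h x)%:E = 0)%E) => //.
- by rewrite preimage_setT setIT.
- move=> S mS S0.
  have E : B = (B `&` p @^-1` S) `|` (B `&` p @^-1` (~` S)).
    by rewrite preimage_setC -setIUr setUv setIT.
  have D : [disjoint B `&` p @^-1` S & B `&` p @^-1` (~` S)].
    by apply/disj_setPLR => x [_ Sx] [_ /= /(_ Sx)].
  have := h0; rewrite {1}E integral_setU//.
  + by rewrite S0 add0e.
  + exact: mpre.
  + exact/mpre/measurableC.
  + exact: measurable_funTS.
- move=> F mF tF F0.
  rewrite preimage_bigcup setI_bigcupr integral_bigcup//.
  + by apply: eseries0 => i _ _; exact: F0.
  + apply/trivIsetP => i j _ _ ij; rewrite setIACA setIid -preimage_setI.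
    by move/trivIsetP : tF => /(_ i j I I ij) ->; rewrite preimage_set0 setI0.
  + by move=> k; exact: mpre.
  + apply: integrableS ih => //; apply: bigcup_measurable => k _; exact: mpre.
Qed.

End pi_zero.

Section fundamental.
Context {R : realType}.
Local Notation R3 := (R3 R).
Local Notation leb := (leb R).
Implicit Types (u v : R3 -> R) (x y : R3).

Definition tens (f g h : R -> R) : R3 -> R := fun x => f x.1.1 * g x.1.2 * h x.2.

Lemma pderiv_tens i (f g h : R -> R) : smooth f -> smooth g -> smooth h ->
  (forall x, pderivable i (tens f g h) x) /\
  exists (f' g' h' : R -> R), [/\ smooth f', smooth g', smooth h' & pderiv i (tens f g h) = tens f' g' h'].
Proof.
move=> sf sg sh.
have D (c : R -> R) (F : R -> R) (a z : R) : smooth c ->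
    (forall t, F t = a * c t) -> is_derive z (1 : R) F (a * derive1 c z).
  by move=> sc /funext ->; have := is_deriveZ a (is_derive_derive1 (@smooth_derivable R c sc z)).
have K F : (forall x, is_derive (Defs.coord i x) (1 : R)
    (fun t => tens f g h (coord_line i x t)) (F x)) ->
    (forall x, pderivable i (tens f g h) x) /\ pderiv i (tens f g h) = F.
  by move=> H; split=> [x|]; [|apply/funext => x]; have [] := pderivE (H x).
have [i0|i0] := boolP (val i == 0%N).
  have [|H E] := K (tens (derive1 f) g h) => [x|].
    rewrite /coord_line /Defs.coord i0 (_ : tens _ _ _ _ = (g x.1.2 * h x.2) * derive1 f x.1.1); last first.
      by rewrite /tens; ring.
    by apply: D => // t; rewrite /tens/=; ring.
  by split=> //; exists (derive1 f), g, h; split=> //; exact: smooth_derive1.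
have [i1|i1] := boolP (val i == 1%N).
  have [|H E] := K (tens f (derive1 g) h) => [x|].
    rewrite /coord_line /Defs.coord (negbTE i0) i1 (_ : tens _ _ _ _ = (f x.1.1 * h x.2) * derive1 g x.1.2); last first.
      by rewrite /tens; ring.
    by apply: D => // t; rewrite /tens/=; ring.
  by split=> //; exists f, (derive1 g), h; split=> //; exact: smooth_derive1.
have [|H E] := K (tens f g (derive1 h)) => [x|].
  rewrite /coord_line /Defs.coord (negbTE i0) (negbTE i1) (_ : tens _ _ _ _ = (f x.1.1 * g x.1.2) * derive1 h x.2); last first.
    by rewrite /tens; ring.
  by apply: D => // t; rewrite /tens/=; ring.
by split=> //; exists f, g, (derive1 h); split=> //; exact: smooth_derive1.
Qed.

Lemma tst_tens (f g h : R -> R) L : smooth f -> smooth g -> smooth h ->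
  bsupp (tens f g h) L -> tst (tens f g h).
Proof.
move=> sf sg sh bs; split; last by exists L.
move=> l; have [f' [g' [h' [sf' sg' sh' ->]]]] : exists (f' g' h' : R -> R),
   [/\ smooth f', smooth g', smooth h' & iter_pderiv l (tens f g h) = tens f' g' h'].
  elim: l => [|i l [f' [g' [h' [sf' sg' sh' E]]]]]; first by exists f, g, h.
  by rewrite /= E; exact: (pderiv_tens i sf' sg' sh').2.
split; last by move=> i; exact: (pderiv_tens i sf' sg' sh').1.
move=> x; rewrite /tens; apply: cvgM; [apply: cvgM|].
- by apply: continuous_comp; [exact: cont11|exact: smooth_cont].
- by apply: continuous_comp; [exact: cont12|exact: smooth_cont].
- by apply: continuous_comp; [exact: cont2|exact: smooth_cont].
Qed.

Definition obox (a1 b1 a2 b2 a3 b3 : R) : set R3 := (`]a1, b1[ `*` `]a2, b2[) `*` `]a3, b3[.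

Definition bump3 a1 b1 a2 b2 a3 b3 c := tens (bump a1 b1 c) (bump a2 b2 c) (bump a3 b3 c).

Lemma bump3_out a1 b1 a2 b2 a3 b3 c x : 0 < c -> ~ obox a1 b1 a2 b2 a3 b3 x ->
  bump3 a1 b1 a2 b2 a3 b3 c x = 0.
Proof.
move=> c0 nx; rewrite /bump3 /tens.
have [h1|h1] := boolP (x.1.1 \in `]a1, b1[); last by rewrite (bump_out c0 h1) !mul0r.
have [h2|h2] := boolP (x.1.2 \in `]a2, b2[); last by rewrite (bump_out c0 h2) mulr0 mul0r.
have [h3|h3] := boolP (x.2 \in `]a3, b3[); last by rewrite (bump_out c0 h3) mulr0.
by exfalso; apply: nx.
Qed.

Lemma bump3_01 a1 b1 a2 b2 a3 b3 c x : 0 <= bump3 a1 b1 a2 b2 a3 b3 c x <= 1.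
Proof.
have /andP[p1 q1] := bump_01 a1 b1 c x.1.1; have /andP[p2 q2] := bump_01 a2 b2 c x.1.2.
have /andP[p3 q3] := bump_01 a3 b3 c x.2.
rewrite /bump3 /tens; apply/andP; split; first exact: (mulr_ge0 (mulr_ge0 p1 p2) p3).
exact: (mulr_ile1 (mulr_ge0 p1 p2) p3 (mulr_ile1 p1 p2 q1 q2) q3).
Qed.

Lemma tst_bump3 a1 b1 a2 b2 a3 b3 c : 0 < c -> tst (bump3 a1 b1 a2 b2 a3 b3 c).
Proof.
move=> c0; apply: (@tst_tens _ _ _ (`|a1| + `|b1| + `|a2| + `|b2| + `|a3| + `|b3|)).
- exact: smooth_bump.
- exact: smooth_bump.
- exact: smooth_bump.
have B (a b s : R) : a < s < b -> `|s| <= `|a| + `|b|.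
  move=> /andP[h1 h2]; have := ler_norm b; have := ler_norm (- a); rewrite normrN => A C.
  by rewrite ler_norml; apply/andP; split; have := normr_ge0 a; have := normr_ge0 b; lra.
move=> x; apply: contraPP => nb; apply/negP; rewrite negbK; apply/eqP; apply: bump3_out => //; apply: contra_not nb => -[[/= ]].
rewrite !in_itv/= => /B h1 /B h2 /B h3.
have := normr_ge0 a1; have := normr_ge0 b1; have := normr_ge0 a2; have := normr_ge0 b2.
have := normr_ge0 a3; have := normr_ge0 b3; split; lra.
Qed.

Lemma measurable_obox a1 b1 a2 b2 a3 b3 : measurable (obox a1 b1 a2 b2 a3 b3).
Proof. by apply: measurableX; [apply: measurableX|]; exact: measurable_itv. Qed.

Lemma leb_obox_lty a1 b1 a2 b2 a3 b3 : (leb (obox a1 b1 a2 b2 a3 b3) < +oo)%E.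
Proof.
rewrite leb_prod//; try exact: measurable_itv.
rewrite !lebesgue_measure_itv/=; case: ifP => _; rewrite ?mul0e//.
case: ifP => _; rewrite ?mule0 ?mul0e//; case: ifP => _; rewrite ?mule0//.
by rewrite -!EFinB -!EFinM ltry.
Qed.

(** Dominated convergence along the bumps, which tend to the indicator of the open box. *)
Lemma orth_obox u a1 b1 a2 b2 a3 b3 : l2 leb u -> (forall phi, tst phi -> ip leb u phi = 0) ->
  rint leb (fun x => u x * \1_(obox a1 b1 a2 b2 a3 b3) x) = 0.
Proof.
move=> lu ort; set B := obox _ _ _ _ _ _.
have lB : l2 leb (\1_B) by apply: l2_indic; [exact: measurable_obox|exact: leb_obox_lty].
have mu : measurable_fun setT u by case: lu.
have tb n : tst (bump3 a1 b1 a2 b2 a3 b3 n.+1%:R) by apply: tst_bump3; rewrite ltr0n.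
have [||||| _ H] := @rint_dct _ _ R leb (fun n x => u x * bump3 a1 b1 a2 b2 a3 b3 n.+1%:R x)
    (fun x => u x * \1_B x) (fun x => `|u x| * \1_B x).
  - by move=> n; apply: measurable_funM => //; exact: tst_meas.
  - by apply: measurable_funM => //; case: lB.
  - move=> x; apply: cvgM; first exact: cvg_cst.
    have -> : \1_B x = \1_(`]a1, b1[%classic) x.1.1 * \1_(`]a2, b2[%classic) x.1.2 * \1_(`]a3, b3[%classic) x.2 :> R.
      by rewrite !indicE -!natrM !mulnb /B /obox !in_setX.
    by apply: cvgM; [apply: cvgM|]; exact: cvg_bump.
  - move=> n x; rewrite normrM ler_wpM2l//.
    have [Bx|nBx] := pselect (B x); last by rewrite bump3_out// normr0 indicE.
    have /andP[h1 h2] := bump3_01 a1 b1 a2 b2 a3 b3 n.+1%:R x.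
    by rewrite indicE mem_set// ger0_norm.
  - by apply: l2_mul => //; exact: l2_abs.
have E : (fun n => rint leb (fun x => u x * bump3 a1 b1 a2 b2 a3 b3 n.+1%:R x)) = (fun=> 0).
  by apply/funext => n; exact: ort _ (tb n).
by rewrite E in H; rewrite -(cvg_lim _ H)// lim_cst.
Qed.

Lemma setI_closed_itv : setI_closed (RGenOpens.G (R := R)).
Proof.
move=> _ _ [a [b ->]] [c [e ->]]; exists (Num.max a c), (Num.min b e).
apply/seteqP; split=> t /=; rewrite !in_itv/= gt_max lt_min.
  by move=> [/andP[-> ->] /andP[-> ->]].
by move=> /andP[/andP[-> ->] /andP[-> ->]].
Qed.

Lemma setI_closed_rect d1 d2 (T1 : measurableType d1) (T2 : measurableType d2) :
  setI_closed [set A `*` B | A in @measurable _ T1 & B in @measurable _ T2].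
Proof.
move=> _ _ [A mA [B mB <-]] [A' mA' [B' mB' <-]].
exists (A `&` A'); first exact: measurableI.
by exists (B `&` B'); [exact: measurableI|rewrite setXI].
Qed.

Theorem fundamental_lemma u : l2 leb u -> (forall phi, tst phi -> ip leb u phi = 0) ->
  {ae leb, forall x, u x = 0}.
Proof.
move=> lu ort.
(* A square integrable [u] need not be integrable, so the argument runs for [u] cut off by a bounded
   box; the boxes exhaust the space. *)
suff loc N : {ae leb, forall x, (u x * \1_(obox (- N%:R) N%:R (- N%:R) N%:R (- N%:R) N%:R) x) = 0}.
  have := ae_foralln loc; apply: filterS => x H.
  have [N HN] : exists N : nat, `|x.1.1| + `|x.1.2| + `|x.2| < N%:R.
    exists (Num.bound (`|x.1.1| + `|x.1.2| + `|x.2|)).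
    by apply: archi_boundP; rewrite !addr_ge0.
  have := H N; rewrite indicE mem_set ?mulr1//.
  have := normr_ge0 x.1.1; have := normr_ge0 x.1.2; have := normr_ge0 x.2 => p1 p2 p3.
  by split; [split|]; rewrite /= in_itv/= -ltr_norml; lra.
set J := obox _ _ _ _ _ _; set g := fun x => u x * \1_J x.
have mJ : measurable J by exact: measurable_obox.
have lJ : l2 leb (\1_J) by apply: l2_indic => //; exact: leb_obox_lty.
have ig : intble leb g by exact: l2_mul.
(* Each factor is an open interval or the whole line. The latter is the total set of a coordinate in
   Dynkin's argument; as [g] vanishes outside [J], it acts as the interval []- N, N[]. *)
pose G0 : set (set R) := [set A | RGenOpens.G A \/ A = setT].
have base A1 A2 A3 : G0 A1 -> G0 A2 -> G0 A3 ->
    (\int[leb]_(x in (A1 `*` A2) `*` A3) (g x)%:E = 0)%E.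
  have cut (A : set R) : G0 A -> exists a b, A `&` `]- N%:R, N%:R[ = `]a, b[%classic.
    move=> [[a [b ->]]|->]; last by exists (- N%:R), N%:R; rewrite setTI.
    by apply: setI_closed_itv; [exists a, b|exists (- N%:R), N%:R].
  move=> /cut[a1 [b1 E1]] /cut[a2 [b2 E2]] /cut[a3 [b3 E3]].
  have := orth_obox a1 b1 a2 b2 a3 b3 lu ort => H.
  have H' : (rint leb (fun x => u x * \1_(obox a1 b1 a2 b2 a3 b3) x))%:E = 0%E by rewrite H.
  rewrite -[RHS]H' rintE; last first.
    by apply: l2_mul => //; apply: l2_indic; [exact: measurable_obox|exact: leb_obox_lty].
  rewrite [LHS]integral_mkcond; apply: eq_integral => x _; rewrite /g patchE.
  have -> : obox a1 b1 a2 b2 a3 b3 = (A1 `*` A2) `*` A3 `&` J.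
    rewrite /obox -E1 -E2 -E3; apply/seteqP; split=> -[[s t] r] /=.
      by move=> [[[? ?] [? ?]] [? ?]]; do !split.
    by move=> [[[? ?] ?] [[? ?] ?]]; do !split.
  move: ((A1 `*` A2) `*` A3) => S.
  rewrite [\1_(S `&` J) x]indicE in_setI; case: (x \in S); last by rewrite mulr0.
  by rewrite /= indicE.
have gen1 : @measurable _ (measurableTypeR R) = <<s RGenOpens.G (R := R)>> by exact: RGenOpens.measurableE.
have G0T : G0 setT by right.
have G0G A : RGenOpens.G A -> G0 A by left.
have mG0 A : G0 A -> measurable A.
  by move=> [[a [b ->]]|->]; [exact: measurable_itv|exact: measurableT].
have s1 A1 A2 A3 : measurable A1 -> G0 A2 -> G0 A3 ->
    (\int[leb]_(x in (A1 `*` A2) `*` A3) (g x)%:E = 0)%E.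
  move=> mA1 GA2 GA3.
  have Eq A : (A `*` A2) `*` A3 = ((setT `*` A2) `*` A3) `&` ((fun x : R3 => x.1.1) @^-1` A).
    by apply/seteqP; split=> -[[a b] c] /=; [move=> [[]]|move=> [[[]]]].
  rewrite Eq; apply: (integral_pi_system0 (G := RGenOpens.G (R := R))) => //.
  - exact: m11.
  - by apply: measurableX; [apply: measurableX|]; [exact: measurableT|exact: mG0|exact: mG0].
  - exact: setI_closed_itv.
  - exact: base.
  - by move=> A GA; rewrite -Eq; apply: base => //; exact: G0G.
have s2 A1 A2 A3 : measurable A1 -> measurable A2 -> G0 A3 ->
    (\int[leb]_(x in (A1 `*` A2) `*` A3) (g x)%:E = 0)%E.
  move=> mA1 mA2 GA3.
  have Eq A : (A1 `*` A) `*` A3 = ((A1 `*` setT) `*` A3) `&` ((fun x : R3 => x.1.2) @^-1` A).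
    by apply/seteqP; split=> -[[a b] c] /=; [move=> [[]]|move=> [[[]]]].
  rewrite Eq; apply: (integral_pi_system0 (G := RGenOpens.G (R := R))) => //.
  - exact: m12.
  - by apply: measurableX; [apply: measurableX|]; [|exact: measurableT|exact: mG0].
  - exact: setI_closed_itv.
  - exact: s1.
  - by move=> A GA; rewrite -Eq; apply: s1 => //; exact: G0G.
have s3 A1 A2 A3 : measurable A1 -> measurable A2 -> measurable A3 ->
    (\int[leb]_(x in (A1 `*` A2) `*` A3) (g x)%:E = 0)%E.
  move=> mA1 mA2 mA3.
  have Eq A : (A1 `*` A2) `*` A = ((A1 `*` A2) `*` setT) `&` ((fun x : R3 => x.2) @^-1` A).
    by apply/seteqP; split=> -[[a b] c] /=; [move=> [[]]|move=> [[[]]]].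
  rewrite Eq; apply: (integral_pi_system0 (G := RGenOpens.G (R := R))) => //.
  - exact: m2.
  - by apply: measurableX; [apply: measurableX|].
  - exact: setI_closed_itv.
  - exact: s2.
  - by move=> A GA; rewrite -Eq; apply: s2 => //; exact: G0G.
have sT : (\int[leb]_(x in setT) (g x)%:E = 0)%E.
  by have := s3 _ _ _ measurableT measurableT measurableT; rewrite !setXTT.
(* Rectangles generate the measurable sets of the plane, and products of these with sets of the line
   generate those of space; two further applications reach every measurable set. *)
have s4 E A3 : measurable E -> measurable A3 ->
    (\int[leb]_(x in E `*` A3) (g x)%:E = 0)%E.
  move=> mE mA3.
  have Eq (A : set (R * R)) : A `*` A3 = (setT `*` A3) `&` ((fun x : R3 => x.1) @^-1` A).
    by apply/seteqP; split=> -[a c] /=; [move=> []|move=> [[]]].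
  rewrite Eq; apply: (integral_pi_system0
     (G := [set A `*` B | A in @measurable _ (measurableTypeR R) & B in @measurable _ (measurableTypeR R)])) => //.
  - exact: measurable_fst.
  - exact: measurableX.
  - exact: measurable_prod_measurableType.
  - exact: setI_closed_rect.
  - by rewrite -setXTT; exact: s3.
  - by move=> _ [A mA [B mB <-]]; rewrite -Eq; exact: s3.
have s5 E : measurable E -> (\int[leb]_(x in E) (g x)%:E = 0)%E.
  move=> mE; rewrite -[E]setTI.
  apply: (integral_pi_system0 (p := idfun)
     (G := [set A `*` B | A in @measurable _ (measurableTypeR R * measurableTypeR R)%type & B in @measurable _ (measurableTypeR R)])) => //.
  - exact: measurable_id.
  - exact: measurable_prod_measurableType.
  - exact: setI_closed_rect.
  - by move=> _ [A mA [B mB <-]]; rewrite setTI; exact: s4.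
have := @integral_ae_eq _ _ _ leb setT measurableT (cst 0%E) (EFin \o g) ig (measurable_cst _).
have h E : E `<=` setT -> measurable E -> (\int[leb]_(x in E) (EFin \o g) x = \int[leb]_(x in E) cst 0 x)%E.
  by move=> _ mE; rewrite integral0; exact: s5.
by move=> /(_ h); apply: filterS => x /(_ I) /= [].
Qed.

(** On test functions, [ip leb u] is represented by some [G] in their closure. Then [G - u] is
    orthogonal to all of them, hence [G = u] almost everywhere. *)
Theorem tst_dense u : l2 leb u -> exists fs : nat -> R3 -> R, (forall n, tst (fs n)) /\
  (fun n => n2 leb (fun x => fs n x - u x)) @ \oo --> (0 : R).
Proof.
move=> lu.
have [||||| G [lG GP [fs [tfs cfs]]]] := @riesz_subspace _ _ _ leb [set f | tst f] (ip leb u) (nrm leb u).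
- exact: tst0.
- by move=> a f g; exact: tst_lin.
- by move=> f; exact: tst_l2.
- by move=> a f g /tst_l2 lf /tst_l2 lg; rewrite ipDr ?ipZr//; exact: l2Z.
- by move=> f /tst_l2 lf; exact: ip_le.
exists fs; split=> //.
have : {ae leb, forall x, G x - u x = 0}.
  apply: fundamental_lemma; first exact: l2B.
  by move=> phi tp; rewrite ipBl ?GP ?subrr//; exact: tst_l2.
move=> Gu; have E n : n2 leb (fun x => fs n x - u x) = n2 leb (fun x => fs n x - G x).
  have lf := tst_l2 (tfs n); apply: ae_n2; [exact: l2B|exact: l2B|].
  by apply: ae_imp Gu => x /eqP; rewrite subr_eq0 => /eqP ->.
by under eq_fun do rewrite E.
Qed.

Lemma tst_dense_le u e : l2 leb u -> 0 < e -> exists2 f, tst f & nrm leb (fun x => f x - u x) <= e.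
Proof.
move=> lu e0; have [fs [tfs /seq0P H]] := tst_dense lu.
have [|N HN] := H (fun n => n2_ge0 _ _) (e ^+ 2); first by rewrite exprn_gt0.
by exists (fs N) => //; apply/nrm_le_n2; [exact: ltW|exact: HN].
Qed.

Lemma nrm_le_dual u C : l2 leb u -> 0 <= C -> (forall f, tst f -> ip leb u f <= C * nrm leb f) -> nrm leb u <= C.
Proof.
move=> lu C0 H; have [fs [tfs cfs]] := tst_dense lu.
have c1 := cvg_n2_le (fun n => tst_l2 (tfs n)) lu lu cfs.
have c2 := cvg_nrm (fun n => tst_l2 (tfs n)) lu cfs.
have : ip leb u u <= C * nrm leb u.
  apply: (ler_cvg_to c1 (cvgM (cvg_cst C) c2)); apply: nearW => n.
  by rewrite ipC; exact: H.
rewrite -[ip _ _ _]/(n2 leb u) -nrm_sqr expr2.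
have [->//|u0] := eqVneq (nrm leb u) 0.
by rewrite ler_pM2r// lt_neqAle eq_sym u0 nrm_ge0.
Qed.

End fundamental.

(** * Translations in L2 and weak derivatives *)

Section translation.
Context {R : realType}.
Local Notation R3 := (R3 R).
Local Notation leb := (leb R).
Implicit Types (u v w g phi psi : R3 -> R) (x y h : R3).

Definition tau h u := fun x => u (add3 x h).

Definition i0 : 'I_3 := @Ordinal 3 0 erefl.
Definition i1 : 'I_3 := @Ordinal 3 1 erefl.
Definition i2 : 'I_3 := @Ordinal 3 2 erefl.

Lemma add3A x y h : add3 (add3 x y) h = add3 x (add3 y h).
Proof. by rewrite /add3/= !addrA. Qed.

Lemma add3C x y : add3 x y = add3 y x.
Proof. by rewrite /add3; congr ((_, _), _); rewrite addrC. Qed.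

Lemma add3K x h : add3 (add3 x h) (opp3 h) = x.
Proof. by case: x => [[a b] c]; rewrite /add3 /opp3/= !addrK. Qed.

Lemma add3_split x h :
  add3 x h = add3 (add3 (add3 x (e3 i0 h.1.1)) (e3 i1 h.1.2)) (e3 i2 h.2).
Proof. by rewrite /add3 /e3 /coord_line/= !addr0. Qed.

Lemma opp_e3 i (t : R) : opp3 (e3 i t) = e3 i (- t) :> R3.
Proof.
by rewrite /opp3 /e3 /coord_line; case: (val i == 0%N) => /=; case: (val i == 1%N) => /=; rewrite oppr0.
Qed.

Lemma box_le_e3 i (s t : R) : `|s| <= t -> box_le t (e3 i s).
Proof.
move=> st; have t0 : 0 <= t by exact: le_trans st.
by rewrite /box_le /e3 /coord_line; case: (val i == 0%N) => /=; case: (val i == 1%N) => /=; rewrite normr0.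
Qed.

Lemma tau_l2 h u : l2 leb u -> l2 leb (tau h u).
Proof. by move=> lu; exact: (mpres_l2 (mpres_shift h)). Qed.

Lemma tau_nrm h u : l2 leb u -> nrm leb (tau h u) = nrm leb u.
Proof. by move=> [mu _]; exact: (mpres_nrm (mpres_shift h)). Qed.

Lemma tau_ip h u v : l2 leb u -> l2 leb v -> ip leb (tau h u) v = ip leb u (tau (opp3 h) v).
Proof.
move=> [mu _] [mv _]; have mt := mpres_shift h.
rewrite -[RHS](mpres_ip mt); last 2 first.
- by [].
- exact: (mpres_meas (mpres_shift (opp3 h))).
by congr ip; apply/funext => x; rewrite /tau add3K.
Qed.

Lemma tau_nrmB h u v : l2 leb u -> l2 leb v ->
  nrm leb (fun x => tau h u x - tau h v x) = nrm leb (fun x => u x - v x).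
Proof. by move=> lu lv; rewrite -[RHS](tau_nrm h)//; exact: l2B. Qed.

Lemma tst_lip phi : tst phi -> exists2 K, 0 <= K &
  forall t x h, box_le t h -> `|phi (add3 x h) - phi x| <= K * t.
Proof.
move=> tp.
have [M0 M00 H0] := tst_bound (tst_pderiv i0 tp).
have [M1 M10 H1] := tst_bound (tst_pderiv i1 tp).
have [M2 M20 H2] := tst_bound (tst_pderiv i2 tp).
exists (M0 + M1 + M2) => [|t x h [b0 b1 b2]]; first by rewrite !addr_ge0.
rewrite add3_split.
have [s0 _ E0] := tst_mvt i0 x h.1.1 tp.
set x1 := add3 x _ in E0 *; have [s1 _ E1] := tst_mvt i1 x1 h.1.2 tp.
set x2 := add3 x1 _ in E1 *; have [s2 _ E2] := tst_mvt i2 x2 h.2 tp.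
rewrite (_ : phi _ - phi x = (phi (add3 x2 (e3 i2 h.2)) - phi x2) + (phi x2 - phi x1) + (phi x1 - phi x)); last by ring.
have B i s M y c : `|c| <= t -> 0 <= M -> (forall y, `|pderiv i phi y| <= M) ->
    `|c * pderiv i phi (add3 y (e3 i s))| <= M * t.
  by move=> ct M_0 H; rewrite normrM mulrC; apply: ler_pM.
rewrite E0 E1 E2 !mulrDl.
have := B i0 s0 M0 x _ b0 M00 H0; have := B i1 s1 M1 x1 _ b1 M10 H1.
have := B i2 s2 M2 x2 _ b2 M20 H2 => h2 h1 h0.
apply: le_trans (ler_normD _ _) _; apply: le_trans (lerD (ler_normD _ _) (lexx _)) _.
by rewrite addrC [X in _ <= X]addrC addrC -addrA; lra.
Qed.

Lemma bsupp_shift phi L h t : bsupp phi L -> box_le t h -> bsupp (tau h phi) (L + t).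
Proof.
move=> bL [b1 b2 b3] x /bL[/= h1 h2 h3].
have T (a b : R) : `|a + b| <= L -> `|b| <= t -> `|a| <= L + t.
  by move=> H bt; have := ler_normD (a + b) (- b); rewrite addrK normrN; lra.
by split; [exact: T h1 b1|exact: T h2 b2|exact: T h3 b3].
Qed.

Lemma nrm_bound_box u c L : l2 leb u -> 0 <= c -> (forall x, `|u x| <= c) -> bsupp u L ->
  nrm leb u <= c * nrm leb (\1_(cbox L)).
Proof.
move=> lu c0 uc bu.
have l1 : l2 leb (\1_(cbox L)) by apply: l2_indic; [exact: measurable_cbox|exact: leb_cbox_lty].
have -> : c * nrm leb (\1_(cbox L)) = nrm leb (fun x => c * \1_(cbox L) x).
  by rewrite nrmZ// ger0_norm.
rewrite /nrm ler_sqrt ?n2_ge0//; apply: n2_le => //; first exact: l2Z.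
move=> x; rewrite normrM indicE (ger0_norm c0).
have [->|ux] := eqVneq (u x) 0; first by rewrite normr0 mulr_ge0.
by rewrite mem_set ?normr1 ?mulr1//; apply/cboxP; exact: bu.
Qed.

Lemma tst_tau_cont phi : tst phi -> exists2 K, 0 <= K &
  forall t h, t <= 1 -> box_le t h -> nrm leb (fun x => tau h phi x - phi x) <= K * t.
Proof.
move=> tp; have [K K0 HK] := tst_lip tp; have [_ [L bL]] := tp.
exists (K * nrm leb (\1_(cbox (L + 1)))) => [|t h t1 bh]; first by rewrite mulr_ge0 ?nrm_ge0.
have t0 : 0 <= t by case: bh => /(le_trans (normr_ge0 _)).
rewrite mulrAC; apply: nrm_bound_box.
- by apply: l2B; [apply: tau_l2|]; exact: tst_l2.
- by rewrite mulr_ge0.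
- by move=> x; exact: HK.
move=> x; have W y (c d : R) : c <= d -> box_le c y -> box_le d y.
  by move=> cd [? ? ?]; split; exact: le_trans cd.
have [->|px _] := eqVneq (phi x) 0; last by apply: W (bL x px); rewrite lerDl.
by rewrite subr0 => /(bsupp_shift bL bh); apply: W; rewrite lerD2l.
Qed.

Lemma tst_tau_deriv phi i : tst phi -> exists2 K, 0 <= K &
  forall t, `|t| <= 1 ->
    nrm leb (fun x => tau (e3 i t) phi x - phi x - t * pderiv i phi x) <= K * t ^+ 2.
Proof.
move=> tp; have tq := tst_pderiv i tp.
have [K K0 HK] := tst_lip tq; have [_ [L bL]] := tp.
exists (K * nrm leb (\1_(cbox (L + 1)))) => [|t t1]; first by rewrite mulr_ge0 ?nrm_ge0.
rewrite mulrAC; apply: nrm_bound_box.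
- by apply: l2B; [apply: l2B; [apply: tau_l2|]; exact: tst_l2|apply: l2Z; exact: tst_l2].
- by rewrite mulr_ge0 ?sqr_ge0.
- move=> x; rewrite /tau; have [s st ->] := tst_mvt i x t tp.
  rewrite -mulrBr normrM -[t ^+ 2]real_normK ?num_real// expr2 mulrCA ler_wpM2l//.
  by apply: HK; exact: box_le_e3.
move=> x; have W y (c d : R) : c <= d -> box_le c y -> box_le d y.
  by move=> cd [? ? ?]; split; exact: le_trans cd.
have [nb|nb] := pselect (box_le (L + 1) x); first by [].
have p0 : phi x = 0.
  by apply: contra_notP nb => /eqP /bL; apply: W; rewrite lerDl.
have q0 : pderiv i phi x = 0.
  by apply: contra_notP nb => /eqP /(bsupp_pderiv bL); apply: W; rewrite lerDl.
have r0 : tau (e3 i t) phi x = 0.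
  apply: contra_notP nb => /eqP /(bsupp_shift bL (box_le_e3 i (lexx `|t|))).
  by apply: W; rewrite lerD2l.
by rewrite p0 q0 r0 mulr0 !subr0 eqxx.
Qed.

(** Translations are isometries, so their continuity on the dense set of test functions, where it is
    Lipschitz, carries over at the price of two errors [e / 4]. *)
Lemma tau_cont u e : l2 leb u -> 0 < e -> exists2 t, 0 < t <= 1 &
  forall h, box_le t h -> nrm leb (fun x => tau h u x - u x) <= e.
Proof.
move=> lu e0; have e4 : 0 < e / 4 by rewrite divr_gt0.
have [f tf fu] := tst_dense_le lu e4; have lf := tst_l2 tf.
have [K K0 HK] := tst_tau_cont tf.
pose t := Num.min 1 (e / 2 / (K + 1)).
have K1 : 0 < K + 1 by rewrite ltr_wpDl.
exists t; first by rewrite lt_min ltr01/= ge_min lexx divr_gt0// divr_gt0.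
move=> h bh; have t1 : t <= 1 by rewrite ge_min lexx.
have ltf := tau_l2 h lf; have ltu := tau_l2 h lu.
apply: le_trans (nrm_tri ltu ltf lu) _.
apply: le_trans (lerD (lexx _) (nrm_tri ltf lf lu)) _.
rewrite (tau_nrmB h lu lf) (nrmBC leb u f).
have : K * t <= e / 2.
  apply: (@le_trans _ _ ((K + 1) * t)).
    by rewrite ler_wpM2r ?lerDl//; case: bh => /(le_trans (normr_ge0 _)).
  by rewrite mulrC -ler_pdivlMr// ge_min lexx orbT.
by have := HK t h t1 bh; lra.
Qed.

Lemma pderiv_tau phi h i : tst phi -> pderiv i (tau h phi) = tau h (pderiv i phi).
Proof.
move=> tp; apply/funext => x.
have D1 := tst_shift_derive i x 0 (tst_shift h tp).
have D2 := tst_shift_derive i (add3 x h) 0 tp.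
have z y : add3 y (e3 i 0) = y by rewrite add3_coord addr0 coord_line_id.
rewrite !z in D1 D2.
have E : (fun s => phi (add3 (add3 x (e3 i s)) h)) = (fun s => phi (add3 (add3 x h) (e3 i s))).
  by apply/funext => s; congr phi; rewrite !add3A [add3 (e3 _ _) _]add3C.
rewrite E in D1.
by rewrite -(@derive_val _ _ _ _ _ _ _ D1) (@derive_val _ _ _ _ _ _ _ D2).
Qed.

Definition wpd i u g := forall phi, tst phi -> ip leb u (pderiv i phi) = - ip leb g phi.

Lemma is_derive_quad (F : R -> R) (s dF K : R) :
  (forall t, `|t| <= 1 -> `|F (s + t) - F s - t * dF| <= K * t ^+ 2) ->
  is_derive s (1 : R) F dF.
Proof.
move=> H; have K0 : 0 <= K by have := H 1; rewrite normr1 lexx expr1n mulr1 => /(_ isT); exact: le_trans.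
have C : h^-1 *: ((F \o shift s) (h *: (1 : R)) - F s) @[h --> (0:R)^'] --> dF.
  apply/cvgrPdist_le => e e0; near=> t.
  have t0 : t != 0 by near: t; exact: nbhs_dnbhs_neq.
  have t1 : `|t| <= 1 by near: t; apply: dnbhs0_le.
  have te : `|t| <= e / (K + 1) by near: t; apply: dnbhs0_le; rewrite divr_gt0// ltr_wpDl.
  have at0 : 0 < `|t| by rewrite normr_gt0.
  rewrite /= [t *: 1]mulr1 [t + s]addrC distrC.
  have -> : t^-1 *: (F (s + t) - F s) - dF = t^-1 * (F (s + t) - F s - t * dF).
    by rewrite /GRing.scale/=; field.
  rewrite normrM normfV mulrC ler_pdivrMr//; apply: le_trans (H t t1) _.
  rewrite -[t ^+ 2]real_normK ?num_real// expr2 mulrA ler_wpM2r//.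
  apply: (@le_trans _ _ ((K + 1) * `|t|)); first by rewrite ler_wpM2r// lerDl.
  by rewrite mulrC -ler_pdivlMr// ltr_wpDl.
by apply: DeriveDef; [apply/cvg_ex; exists dF|exact: cvg_lim C].
Unshelve. all: by end_near. Qed.

(** Paired with a test function, the translate becomes a differentiable function of the parameter,
    since shift and derivative can be moved to [psi]; the real mean value theorem applies. The point
    [s] depends on [psi], which is why norm bounds are then drawn by duality, through
    [nrm_le_dual]. *)
Lemma weak_mvt i u g psi t : l2 leb u -> l2 leb g -> wpd i u g -> tst psi ->
  exists2 s, `|s| <= `|t| &
    ip leb (fun x => tau (e3 i t) u x - u x) psi = t * ip leb (tau (e3 i s) g) psi.
Proof.
move=> lu lg wd tp; have lp := tst_l2 tp.
pose F s := ip leb (tau (e3 i s) u) psi.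
have tz v : tau (e3 i 0) v = v by apply/funext => x; rewrite /tau add3_coord addr0 coord_line_id.
have dF s : is_derive s (1 : R) F (ip leb (tau (e3 i s) g) psi).
  have [K K0 HK] := tst_tau_deriv i tp.
  apply: (@is_derive_quad _ _ _ (nrm leb u * K)) => r r1.
  have lus := tau_l2 (e3 i s) lu; have lp' := tau_l2 (e3 i (- r)) lp.
  have lq := tst_l2 (tst_pderiv i tp).
  have E1 : F (s + r) = ip leb (tau (e3 i s) u) (tau (e3 i (- r)) psi).
    rewrite /F -opp_e3 -tau_ip//; congr ip; apply/funext => x; rewrite /tau !add3A.
    rewrite (_ : add3 (e3 i r) (e3 i s) = e3 i (s + r))//.
    by rewrite add3_coord /e3 coord_line2 coord_lineK addrC.
  have E2 : ip leb (tau (e3 i s) g) psi = - ip leb (tau (e3 i s) u) (pderiv i psi).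
    rewrite !tau_ip// -pderiv_tau// wd ?opprK//; exact: tst_shift.
  have E3 : F (s + r) - F s - r * ip leb (tau (e3 i s) g) psi =
      ip leb (tau (e3 i s) u) (fun x => tau (e3 i (- r)) psi x - psi x - (- r) * pderiv i psi x).
    by rewrite E1 E2 ipBr ?ipZr ?ipBr//; [rewrite /F; ring|exact: l2B|exact: l2Z].
  rewrite E3; apply: le_trans (ip_le _ _) _ => //.
    by apply: l2B; [exact: l2B|exact: l2Z].
  rewrite tau_nrm// -mulrA ler_wpM2l ?nrm_ge0//.
  by have := HK (- r); rewrite normrN sqrrN; apply.
have E : ip leb (fun x => tau (e3 i t) u x - u x) psi = F t - F 0.
  by rewrite ipBl ?/F ?tz//; exact: tau_l2.
rewrite E.
have cF a b : {within `[a, b], continuous F}.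
  by apply: derivable_within_continuous => s _; apply: ex_derive.
have [t0|t0|<-] := ltgtP 0 t.
- have [s + ->] := MVT t0 (fun s _ => dF s) (cF 0 t).
  rewrite in_itv/= => /andP[s0 st]; exists s; first by rewrite !gtr0_norm ?ltW.
  by rewrite subr0 mulrC.
- have [s + E'] := MVT t0 (fun s _ => dF s) (cF t 0).
  rewrite in_itv/= => /andP[s0 st]; exists s; first by rewrite !ltr0_norm ?lerN2 ?ltW.
  by rewrite -opprB E'; ring.
- by exists 0; rewrite // subrr mul0r.
Qed.

Lemma weak_lip i u g t : l2 leb u -> l2 leb g -> wpd i u g ->
  nrm leb (fun x => tau (e3 i t) u x - u x) <= `|t| * nrm leb g.
Proof.
move=> lu lg wd; apply: nrm_le_dual.
- by apply: l2B => //; exact: tau_l2.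
- by rewrite mulr_ge0 ?nrm_ge0.
move=> psi tp; have [s _ ->] := weak_mvt t lu lg wd tp.
apply: le_trans (ler_norm _) _; rewrite normrM -mulrA ler_wpM2l//.
rewrite -(tau_nrm (e3 i s) lg); apply: ip_le; [exact: tau_l2|exact: tst_l2].
Qed.

Lemma weak_taylor i u g t e : l2 leb u -> l2 leb g -> wpd i u g -> 0 <= e ->
  (forall s, `|s| <= `|t| -> nrm leb (fun x => tau (e3 i s) g x - g x) <= e) ->
  nrm leb (fun x => tau (e3 i t) u x - u x - t * g x) <= `|t| * e.
Proof.
move=> lu lg wd e0 He; have lt := tau_l2 (e3 i t) lu.
have ltu : l2 leb (fun x => tau (e3 i t) u x - u x) by exact: l2B.
apply: nrm_le_dual.
- by apply: l2B => //; exact: l2Z.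
- by rewrite mulr_ge0.
move=> psi tp; have lp := tst_l2 tp; have [s st E] := weak_mvt t lu lg wd tp.
have lgs := tau_l2 (e3 i s) lg.
have /= -> := ipBl ltu (l2Z t lg) lp.
rewrite E ipZl// -mulrBr -ipBl//.
apply: le_trans (ler_norm _) _; rewrite normrM -mulrA ler_wpM2l//.
apply: le_trans (ip_le _ lp) _; first exact: l2B.
by rewrite ler_wpM2r ?nrm_ge0//; exact: He.
Qed.

Lemma tau_split h u : tau h u = tau (e3 i0 h.1.1) (tau (e3 i1 h.1.2) (tau (e3 i2 h.2) u)).
Proof. by apply/funext => x; rewrite /tau add3_split. Qed.

Lemma wpd_unique i u g g' : l2 leb g -> l2 leb g' -> wpd i u g -> wpd i u g' ->
  {ae leb, forall x, g x = g' x}.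
Proof.
move=> lg lg' H H'; have := @fundamental_lemma _ (fun x => g x - g' x) (l2B lg lg').
have K phi : tst phi -> ip leb (fun x => g x - g' x) phi = 0.
  move=> tp; rewrite ipBl//; last exact: tst_l2.
  by have := H _ tp; rewrite (H' _ tp) => /oppr_inj ->; rewrite subrr.
by move=> /(_ K); apply: ae_imp => x /eqP; rewrite subr_eq0 => /eqP.
Qed.

Lemma wpd_lin i a u g v k : l2 leb u -> l2 leb g -> l2 leb v -> l2 leb k ->
  wpd i u g -> wpd i v k -> wpd i (fun x => a * u x + v x) (fun x => a * g x + k x).
Proof.
move=> lu lg lv lk H K phi tp; have lp := tst_l2 tp; have lq := tst_l2 (tst_pderiv i tp).
by rewrite !ipDl ?ipZl ?H ?K//; [ring|exact: l2Z|exact: l2Z].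
Qed.

Lemma wpd_lim i us gs u g : (forall n, l2 leb (us n)) -> (forall n, l2 leb (gs n)) ->
  l2 leb u -> l2 leb g -> (forall n, wpd i (us n) (gs n)) ->
  (fun n => n2 leb (fun x => us n x - u x)) @ \oo --> (0 : R) ->
  (fun n => n2 leb (fun x => gs n x - g x)) @ \oo --> (0 : R) -> wpd i u g.
Proof.
move=> lus lgs lu lg H cu cg phi tp.
have c1 := cvg_n2_le lus lu (tst_l2 (tst_pderiv i tp)) cu.
have c2 := cvgN (cvg_n2_le lgs lg (tst_l2 tp) cg).
have E : (fun n => ip leb (us n) (pderiv i phi)) = (fun n => - ip leb (gs n) phi).
  by apply/funext => n; exact: H.
rewrite E in c1; rewrite -(cvg_lim _ c1)//; apply: cvg_lim => //; exact: c2.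
Qed.

(** Up to sign, [ip leb w (pderiv i f)] is the limit of the pairings of [f] with difference
    quotients of [w]. It is therefore bounded by [C * nrm leb f], and Riesz representation produces
    the derivative. *)
Lemma wpd_exists i w C : l2 leb w -> 0 <= C ->
  (forall t, `|t| <= 1 -> nrm leb (fun x => tau (e3 i t) w x - w x) <= C * `|t|) ->
  exists2 g, l2 leb g & wpd i w g.
Proof.
move=> lw C0 HC.
have [||||| g [lg Hg _]] := @riesz_subspace _ _ _ leb [set f | tst f] (fun f => - ip leb w (pderiv i f)) C.
- exact: tst0.
- by move=> a f g; exact: tst_lin.
- by move=> f; exact: tst_l2.
- move=> a f g tf tg; have E : pderiv i (fun x => a * f x + g x) = (fun x => a * pderiv i f x + pderiv i g x).
    apply/funext => x.
    have := @tst_shift_derive _ i _ x 0 (tst_lin a tf tg).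
    have D1 := @tst_shift_derive _ i _ x 0 tf; have D2 := @tst_shift_derive _ i _ x 0 tg.
    have z y : add3 y (e3 i 0) = y by rewrite add3_coord addr0 coord_line_id.
    rewrite !z in D1 D2 *; have D3 := is_deriveD (is_deriveZ a D1) D2 => D4.
    by rewrite -(@derive_val _ _ _ _ _ _ _ D4) -(@derive_val _ _ _ _ _ _ _ D3).
  have lf := tst_l2 (tst_pderiv i tf); have lg := tst_l2 (tst_pderiv i tg).
  by rewrite E (ipDr (l2Z a lf) lg lw) (ipZr a lf lw) opprD mulrN.
- move=> f tf; rewrite normrN; have lf := tst_l2 tf; have lq := tst_l2 (tst_pderiv i tf).
  have [K K0 HK] := tst_tau_deriv i tf.
  (* Moving the shift from [f] to [w] leaves a remainder of order [t] after division by [t], which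
     is then sent to 0. *)
  have B t : 0 < t <= 1 -> `|ip leb w (pderiv i f)| <= C * nrm leb f + nrm leb w * K * t.
    move=> /andP[t0 t1]; have at1 : `|t| <= 1 by rewrite gtr0_norm.
    have lft := tau_l2 (e3 i t) lf; have lwt := tau_l2 (e3 i (- t)) lw.
    rewrite -(ler_pM2l t0) -{1}(gtr0_norm t0) -normrM.
    have -> : t * ip leb w (pderiv i f) = ip leb (fun x => tau (e3 i (- t)) w x - w x) f
        - ip leb w (fun x => tau (e3 i t) f x - f x - t * pderiv i f x).
      rewrite ipBl// ipBr ?ipBr ?ipZr//; [|exact: l2B|exact: l2Z].
      by rewrite tau_ip// opp_e3 opprK; ring.
    apply: le_trans (ler_normB _ _) _; rewrite mulrDr; apply: lerD.
      apply: le_trans (ip_le _ lf) _; first exact: l2B.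
      rewrite mulrA ler_wpM2r ?nrm_ge0// mulrC -{2}(gtr0_norm t0) -normrN.
      by apply: HC; rewrite normrN.
    apply: le_trans (ip_le lw _) _; first by apply: l2B; [exact: l2B|exact: l2Z].
    have -> : t * (nrm leb w * K * t) = nrm leb w * (K * t ^+ 2) by ring.
    by rewrite ler_wpM2l ?nrm_ge0//; exact: HK.
  apply/ler_addgt0Pr => e e0.
  have p : 0 < nrm leb w * K + 1 by rewrite ltr_wpDl// mulr_ge0// nrm_ge0.
  pose t := Num.min 1 (e / (nrm leb w * K + 1)).
  have t0 : 0 < t by rewrite lt_min ltr01 divr_gt0.
  have := B t; rewrite t0 ge_min lexx => /(_ isT) /le_trans; apply.
  rewrite lerD2l; apply: (@le_trans _ _ ((nrm leb w * K + 1) * t)).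
    by rewrite ler_wpM2r ?lerDl// ltW.
  by rewrite mulrC -ler_pdivlMr// ge_min lexx orbT.
by exists g => // phi tp; rewrite Hg// opprK.
Qed.

End translation.

(** * Volume and second moments of balls *)

Section energy.
Context {R : realType}.
Local Notation R3 := (R3 R).
Local Notation leb := (leb R).
Implicit Types (u v w phi psi : R3 -> R) (x y h k : R3).

Definition sq3 x : R := x.1.1 ^+ 2 + x.1.2 ^+ 2 + x.2 ^+ 2.

Lemma sq3_ge0 x : 0 <= sq3 x.
Proof. by rewrite !addr_ge0 ?sqr_ge0. Qed.

Lemma measurable_sq3 : measurable_fun setT sq3.
Proof.
by apply: measurable_funD; [apply: measurable_funD|]; apply: measurable_funX; [exact: m11|exact: m12|exact: m2].
Qed.

Definition bt (t : R) h : R := (sq3 h <= t ^+ 2)%R%:R.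

Lemma bt01 t h : 0 <= bt t h <= 1.
Proof. by rewrite /bt; case: (sq3 h <= _); rewrite ?lexx ?ler01. Qed.

Lemma bt_ge0 t h : 0 <= bt t h.
Proof. by have /andP[] := bt01 t h. Qed.

Lemma bt_meas t : measurable_fun setT (bt t).
Proof.
rewrite (_ : bt t = \1_([set h | sq3 h <= t ^+ 2])).
  apply: measurable_indic; rewrite -[X in measurable X]setTI.
  have -> : [set h | sq3 h <= t ^+ 2] = sq3 @^-1` `]-oo, t ^+ 2].
    by apply/seteqP; split=> h; rewrite /= in_itv/=.
  by apply: measurable_sq3 => //; exact: measurable_itv.
apply/funext => h; rewrite indicE /bt.
by have [H|H] := boolP (sq3 h <= t ^+ 2); [rewrite mem_set|rewrite memNset//; exact/negP].
Qed.

Lemma bt_box t h : 0 <= t -> bt t h != 0 -> box_le t h.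
Proof.
move=> t0; rewrite /bt; case: (boolP (sq3 h <= t ^+ 2)) => [H _|_]; last by rewrite eqxx.
rewrite /sq3 in H.
have p := sqr_ge0 h.1.1; have q := sqr_ge0 h.1.2; have r := sqr_ge0 h.2.
by split; rewrite -(@ler_pXn2r _ 2)// ?nnegrE// real_normK ?num_real//; lra.
Qed.

Lemma bt_l2 t : 0 <= t -> l2 leb (bt t).
Proof.
move=> t0; apply: (@bounded_bsupp_l2 _ _ 1 t); first exact: bt_meas.
  by move=> h; have /andP[h0 h1] := bt01 t h; rewrite ger0_norm.
by move=> h; exact: bt_box.
Qed.

Lemma bt_sq t h : bt t h * bt t h = bt t h.
Proof. by rewrite /bt; case: (_ <= _); rewrite ?mulr1 ?mulr0. Qed.

Lemma bt_intble t (f : R3 -> R) M : 0 <= t -> measurable_fun setT f ->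
  (forall h, bt t h != 0 -> `|f h| <= M) -> intble leb (fun h => bt t h * f h).
Proof.
move=> t0 mf fM; have lb := bt_l2 t0.
have : intble leb (fun h => M * (bt t h * bt t h)) by apply: intbleZ; exact: l2_mul.
apply: intble_le; first by apply: measurable_funM => //; exact: bt_meas.
move=> h; rewrite bt_sq; have [->|b0] := eqVneq (bt t h) 0; first by rewrite mul0r normr0 mulr0.
rewrite normrM (ger0_norm (bt_ge0 t h)) mulrC ler_wpM2r ?bt_ge0//; exact: fM.
Qed.

Definition vol t : R := rint leb (bt t).

Lemma bt_int t : 0 <= t -> intble leb (bt t).
Proof.
move=> t0; have := @bt_intble t (fun=> 1) 1 t0 (measurable_cst _).
rewrite (_ : (fun h => bt t h * 1) = bt t); last by apply/funext => h; rewrite mulr1.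
by apply => h _; rewrite normr1.
Qed.

Lemma rint_indic (A : set R3) : measurable A -> rint leb (\1_A) = fine (leb A).
Proof. by move=> mA; rewrite /rint /Rintegral integral_indic// setIT. Qed.

Lemma intble_indic (A : set R3) : measurable A -> (leb A < +oo)%E -> intble leb (\1_A).
Proof.
move=> mA fA; apply: intble_ge0; first exact: measurable_indic.
  by move=> x; rewrite indicE.
by rewrite integral_indic// setIT.
Qed.

Lemma vol_le t : 0 <= t -> vol t <= 8 * t ^+ 3.
Proof.
move=> t0; have mc := measurable_cbox t.
apply: (@le_trans _ _ (rint leb (\1_(cbox t)))).
  apply: rint_le; [exact: bt_int|apply: intble_indic => //; exact: leb_cbox_lty|move=> h].
  rewrite indicE; have [->|b0] := eqVneq (bt t h) 0; first by [].
  by rewrite mem_set; [have /andP[] := bt01 t h|apply/cboxP; exact: bt_box].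
rewrite rint_indic// leb_prod//; try exact: measurable_itv.
rewrite !lebesgue_measure_itv/= lte_fin; case: ifP => _.
  by rewrite -!EFinB -!EFinM/= le_eqVlt; apply/orP; left; apply/eqP; ring.
by rewrite !mule0/= mulr_ge0 ?exprn_ge0.
Qed.

(** The cube of side [t / 2] with a corner at the origin lies in the ball, because [3 / 4 <= 1].
    Only the order [t ^+ 3] of the volume matters, so its exact value is never computed. *)
Lemma vol_ge t : 0 < t -> t ^+ 3 / 8 <= vol t.
Proof.
move=> t0; pose A : set R3 := (`[0, t / 2] `*` `[0, t / 2]) `*` `[0, t / 2].
have mA : measurable A by apply: measurableX; [apply: measurableX|]; exact: measurable_itv.
have t2 : 0 < t / 2 by rewrite divr_gt0.
have LA : leb A = ((t / 2) * (t / 2) * (t / 2))%:E.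
  rewrite leb_prod//; try exact: measurable_itv.
  by rewrite !lebesgue_measure_itv/= lte_fin t2 -!EFinB -!EFinM !subr0.
apply: (@le_trans _ _ (rint leb (\1_A))).
  by rewrite rint_indic// LA/= le_eqVlt; apply/orP; left; apply/eqP; field.
apply: rint_le; [|exact/bt_int/ltW|move=> h].
  by apply: intble_indic => //; rewrite LA ltry.
rewrite indicE; have [Ah|nAh] := boolP (h \in A); last exact: bt_ge0.
move: Ah; rewrite inE => -[[]]; rewrite /= !in_itv/= => /andP[a0 a1] /andP[b0 b1] /andP[c0 c1].
rewrite /bt; suff -> : sq3 h <= t ^+ 2 by [].
have S (z : R) : 0 <= z -> z <= t / 2 -> z ^+ 2 <= t ^+ 2 / 4.
  move=> z0 z1; have -> : t ^+ 2 / 4 = (t / 2) ^+ 2 by field.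
  by rewrite lerXn2r// nnegrE// ltW.
have := S _ a0 a1; have := S _ b0 b1; have := S _ c0 c1; have := sqr_ge0 t; rewrite /sq3; lra.
Qed.

Lemma sq3_refl0 a b x : sq3 (refl a b 0 x) = sq3 x.
Proof. by rewrite /sq3 /refl /refl_k /refl_l/=; field; exact: refl_n0. Qed.

Lemma bt_refl0 t a b x : bt t (refl a b 0 x) = bt t x.
Proof. by rewrite /bt sq3_refl0. Qed.

(** The exchanges of the third coordinate with the other two and its change of sign belong to the
    family [refl], so they preserve the measure and the balls centred at 0. The relations between
    moments below rest on them. *)
Lemma refl_swap02 x : refl (- 1) 0 0 x = ((x.2, x.1.2), x.1.1).
Proof. by rewrite /refl /refl_k /refl_l; congr ((_, _), _); field. Qed.
Lemma refl_swap12 x : refl 0 (- 1) 0 x = ((x.1.1, x.2), x.1.2).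
Proof. by rewrite /refl /refl_k /refl_l; congr ((_, _), _); field. Qed.
Lemma refl_flip2 x : refl 0 0 0 x = ((x.1.1, x.1.2), - x.2).
Proof. by rewrite /refl /refl_k /refl_l; congr ((_, _), _); field. Qed.

(** Second moment of the ball in one direction. By symmetry the moment matrix is [ct t] times the
    identity ([ct0], [ct1], [ct01], [ct02], [ct12]), so integrating the square of a linear form over
    the ball gives [ct t] times the squared length of its coefficients. This is the normalisation of
    [Enr t]. *)
Definition ct t : R := rint leb (fun h => bt t h * h.2 ^+ 2).

Lemma bt_mono t (f : R3 -> R) M : 0 <= t -> measurable_fun setT f ->
  (forall h, box_le t h -> `|f h| <= M) -> intble leb (fun h => bt t h * f h).
Proof. by move=> t0 mf H; apply: (bt_intble t0 mf (M := M)) => h /(bt_box t0) /H. Qed.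

Lemma bt_coord_mul t (p q : R3 -> R) : 0 <= t -> measurable_fun setT p -> measurable_fun setT q ->
  (forall h, box_le t h -> `|p h| <= t) -> (forall h, box_le t h -> `|q h| <= t) ->
  intble leb (fun h => bt t h * (p h * q h)).
Proof.
move=> t0 mp mq Hp Hq; apply: (@bt_mono _ _ (t * t)) => //; first exact: measurable_funM.
by move=> h bh; rewrite normrM ler_pM// ?Hp ?Hq.
Qed.

Lemma bt_refl_rint t a b (f : R3 -> R) : measurable_fun setT f ->
  rint leb (fun h => bt t h * f (refl a b 0 h)) = rint leb (fun h => bt t h * f h).
Proof.
move=> mf; rewrite -[RHS](mpres_rint (mpres_refl a b 0)).
  by congr rint; apply/funext => h; rewrite bt_refl0.
by apply: measurable_funM => //; exact: bt_meas.
Qed.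

Lemma ct0 t : rint leb (fun h => bt t h * h.1.1 ^+ 2) = ct t.
Proof.
rewrite /ct -(bt_refl_rint t (- 1) 0 (f := fun h => h.2 ^+ 2)).
  by congr rint; apply/funext => h; rewrite refl_swap02.
by apply: measurable_funX; exact: m2.
Qed.

Lemma ct1 t : rint leb (fun h => bt t h * h.1.2 ^+ 2) = ct t.
Proof.
rewrite /ct -(bt_refl_rint t 0 (- 1) (f := fun h => h.2 ^+ 2)).
  by congr rint; apply/funext => h; rewrite refl_swap12.
by apply: measurable_funX; exact: m2.
Qed.

Lemma odd0 (f : R3 -> R) : intble leb f -> rint leb (fun h => - f h) = rint leb f -> rint leb f = 0.
Proof.
move=> fi H; have := rintZ (-1) fi; have -> : (fun h => -1 * f h) = (fun h => - f h).
  by apply/funext => h; rewrite mulN1r.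
rewrite H; lra.
Qed.

Lemma box11 t h : box_le t h -> `|h.1.1| <= t. Proof. by case. Qed.
Lemma box12 t h : box_le t h -> `|h.1.2| <= t. Proof. by case. Qed.
Lemma box2 t h : box_le t h -> `|h.2| <= t. Proof. by case. Qed.

Lemma ct02 t : 0 <= t -> rint leb (fun h => bt t h * (h.1.1 * h.2)) = 0.
Proof.
move=> t0; apply: odd0.
  exact: (bt_coord_mul t0 m11 m2 (@box11 t) (@box2 t)).
rewrite -[RHS](bt_refl_rint t 0 0 (f := fun h => h.1.1 * h.2)).
  by congr rint; apply/funext => h; rewrite refl_flip2/=; ring.
by apply: measurable_funM; [exact: m11|exact: m2].
Qed.

Lemma ct12 t : 0 <= t -> rint leb (fun h => bt t h * (h.1.2 * h.2)) = 0.
Proof.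
move=> t0; apply: odd0.
  exact: (bt_coord_mul t0 m12 m2 (@box12 t) (@box2 t)).
rewrite -[RHS](bt_refl_rint t 0 0 (f := fun h => h.1.2 * h.2)).
  by congr rint; apply/funext => h; rewrite refl_flip2/=; ring.
by apply: measurable_funM; [exact: m12|exact: m2].
Qed.

Lemma ct01 t : 0 <= t -> rint leb (fun h => bt t h * (h.1.1 * h.1.2)) = 0.
Proof.
move=> t0; rewrite -(ct02 t0) -[RHS](bt_refl_rint t 0 (- 1) (f := fun h => h.1.1 * h.2)).
  by congr rint; apply/funext => h; rewrite refl_swap12.
by apply: measurable_funM; [exact: m11|exact: m2].
Qed.

Lemma bt_sqr_int t (p : R3 -> R) : 0 <= t -> measurable_fun setT p ->
  (forall h, box_le t h -> `|p h| <= t) -> intble leb (fun h => bt t h * p h ^+ 2).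
Proof. by move=> t0 mp Hp; apply: (bt_coord_mul t0 mp mp). Qed.

Lemma bt_sq3_int t : 0 <= t -> intble leb (fun h => bt t h * sq3 h).
Proof.
move=> t0; apply: (@bt_intble t _ (t ^+ 2)) => //; first exact: measurable_sq3.
move=> h; rewrite /bt ger0_norm ?sq3_ge0//.
by case: (boolP (sq3 h <= t ^+ 2)) => // _; rewrite eqxx.
Qed.

Lemma ct_sq3 t : 0 <= t -> rint leb (fun h => bt t h * sq3 h) = 3 * ct t.
Proof.
move=> t0.
have h1 := bt_sqr_int t0 m11 (@box11 t).
have h2 := bt_sqr_int t0 m12 (@box12 t).
have h3 := bt_sqr_int t0 m2 (@box2 t).
have -> : (fun h => bt t h * sq3 h) =
    (fun h => (bt t h * h.1.1 ^+ 2 + bt t h * h.1.2 ^+ 2) + bt t h * h.2 ^+ 2).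
  by apply/funext => h; rewrite /sq3; ring.
by rewrite rintD ?rintD ?ct0 ?ct1 -?/(ct t)//; [ring|exact: intbleD].
Qed.

(** The shell between the radii [t / 8] and [t] has positive volume already by the crude bounds: at
    least [t ^+ 3 / 8] against at most [8 * (t / 8) ^+ 3 = t ^+ 3 / 64]. *)
Lemma ct_gt0 t : 0 < t -> 0 < ct t.
Proof.
move=> t0; have tn := ltW t0.
have V0 : 0 < vol (t / 8).
  by apply: lt_le_trans (vol_ge _); rewrite ?divr_gt0// exprn_gt0// divr_gt0.
have i1 := bt_sq3_int tn.
have t4 : 0 <= t / 8 by rewrite divr_ge0.
have : (t / 8) ^+ 2 * (vol t - vol (t / 8)) <= 3 * ct t.
  rewrite -ct_sq3// -rintB; [|exact: bt_int|exact: bt_int].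
  rewrite -rintZ; last by apply: intbleB; exact: bt_int.
  apply: rint_le => //; first by apply/intbleZ/intbleB; exact: bt_int.
  move=> h; rewrite /bt.
  have q : (t / 8) ^+ 2 <= t ^+ 2.
    by rewrite lerXn2r ?nnegrE//; have := t0; lra.
  have [h1|h1] := leP (sq3 h) ((t / 8) ^+ 2).
    by rewrite (le_trans h1 q) subrr mulr0 mul1r sq3_ge0.
  case: (sq3 h <= t ^+ 2); rewrite ?subr0 ?mulr1 ?mul1r ?subrr ?mulr0 ?mul0r//; exact: ltW.
have : 0 < vol t - vol (t / 8).
  have := vol_ge t0; have := vol_le t4.
  have -> : 8 * (t / 8) ^+ 3 = t ^+ 3 / 64 by field.
  by have := exprn_gt0 3 t0; lra.
move=> p H; have : 0 < (t / 8) ^+ 2 * (vol t - vol (t / 8)) by rewrite mulr_gt0// exprn_gt0// divr_gt0.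
by move=> /lt_le_trans/(_ H); rewrite pmulr_rgt0.
Qed.

End energy.

(** * Nonlocal energies and the Dirichlet integral *)

Section energy2.
Context {R : realType}.
Local Notation R3 := (R3 R).
Local Notation leb := (leb R).
Implicit Types (u v w phi psi : R3 -> R) (x y h k : R3).

Lemma measurable_add3 d (T : measurableType d) (f g : T -> R3) :
  measurable_fun setT f -> measurable_fun setT g -> measurable_fun setT (fun z => add3 (f z) (g z)).
Proof.
move=> mf mg; apply: mpair; apply: measurable_funD.
- exact: (measurableT_comp m11 mf).
- exact: (measurableT_comp m11 mg).
- exact: (measurableT_comp m12 mf).
- exact: (measurableT_comp m12 mg).
- exact: (measurableT_comp m2 mf).
- exact: (measurableT_comp m2 mg).
Qed.

Lemma measurable_sub3 d (T : measurableType d) (f g : T -> R3) :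
  measurable_fun setT f -> measurable_fun setT g -> measurable_fun setT (fun z => sub3 (f z) (g z)).
Proof.
move=> mf mg; apply: mpair; apply: measurable_funB.
- exact: (measurableT_comp m11 mf).
- exact: (measurableT_comp m11 mg).
- exact: (measurableT_comp m12 mf).
- exact: (measurableT_comp m12 mg).
- exact: (measurableT_comp m2 mf).
- exact: (measurableT_comp m2 mg).
Qed.

Lemma leb_swap (F : R3 * R3 -> \bar R) : measurable_fun setT F -> (forall p, 0 <= F p)%E ->
  (\int[leb]_x \int[leb]_y F (x, y) = \int[leb]_y \int[leb]_x F (x, y))%E.
Proof. by move=> mF F0; rewrite -(tonelli1 leb leb)// tonelli2. Qed.

Definition dn w h : R := n2 leb (fun x => tau h w x - w x).

Lemma dn_ge0 w h : 0 <= dn w h. Proof. exact: n2_ge0. Qed.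

Lemma dn_l2 w h : l2 leb w -> l2 leb (fun x => tau h w x - w x).
Proof. by move=> lw; apply: l2B => //; exact: tau_l2. Qed.

Lemma dn_meas w : l2 leb w -> measurable_fun setT (dn w).
Proof.
move=> lw; apply/measurable_EFinP.
have -> : EFin \o dn w = (fun h => \int[leb]_x ((tau h w x - w x) ^+ 2)%:E)%E.
  by apply/funext => h; rewrite /= /dn n2E//; exact: dn_l2.
apply: (tonelli_meas2 (f := fun p : R3 * R3 => ((w (add3 p.1 p.2) - w p.1) ^+ 2)%:E) leb).
  have mw : measurable_fun setT w by case: lw.
  apply/measurable_EFinP; apply: measurable_funX; apply: measurable_funB.
    by apply: (measurableT_comp mw); apply: measurable_add3.
  exact: (measurableT_comp mw measurable_fst).
by move=> p; rewrite lee_fin sqr_ge0.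
Qed.

Lemma dn_le w h : l2 leb w -> dn w h <= 4 * n2 leb w.
Proof.
move=> lw; have lt := tau_l2 h lw; rewrite /dn n2B//.
have := n2_ge0 leb (fun x => tau h w x + w x); rewrite n2D//.
have -> : n2 leb (tau h w) = n2 leb w by rewrite -!nrm_sqr tau_nrm.
lra.
Qed.

Lemma dn_int t w : 0 <= t -> l2 leb w -> intble leb (fun h => bt t h * dn w h).
Proof.
move=> t0 lw; apply: (@bt_intble _ t _ (4 * n2 leb w)) => //; first exact: dn_meas.
by move=> h _; rewrite ger0_norm ?dn_ge0// dn_le.
Qed.

(** With the integral in [x] gathered in [dn w h], a bounded function of the shift, the energy is a
    finite real and Taylor expansion in [h] applies. [En] is the same energy as an integral over
    pairs of points ([EnE]), the form suited to polarisation. *)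
Definition Enr t w : R := rint leb (fun h => bt t h * dn w h).
Definition En t w : \bar R := (\int[leb]_x \int[leb]_y (bt t (sub3 x y) * (w x - w y) ^+ 2)%:E)%E.

Lemma Enr_ge0 t w : 0 <= Enr t w.
Proof. by apply: rint_ge0 => h; rewrite mulr_ge0 ?bt_ge0 ?dn_ge0. Qed.

Lemma Enr_shift t w : 0 <= t -> l2 leb w ->
  (\int[leb]_x \int[leb]_h (bt t h * (tau h w x - w x) ^+ 2)%:E = (Enr t w)%:E)%E.
Proof.
move=> t0 lw; have mw : measurable_fun setT w by case: lw.
have mF : measurable_fun setT (fun p : R3 * R3 => (bt t p.2 * (tau p.2 w p.1 - w p.1) ^+ 2)%:E).
  apply/measurable_EFinP; apply: measurable_funM; first exact: (measurableT_comp (bt_meas t) measurable_snd).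
  apply: measurable_funX; apply: measurable_funB.
    by apply: (measurableT_comp mw); apply: measurable_add3.
  exact: (measurableT_comp mw measurable_fst).
have F0 p : (0 <= (bt t p.2 * (tau p.2 w p.1 - w p.1) ^+ 2)%:E)%E.
  by rewrite lee_fin mulr_ge0 ?bt_ge0 ?sqr_ge0.
rewrite (leb_swap mF F0) /Enr rintE; last exact: dn_int.
apply: eq_integral => h _ /=.
under eq_integral do rewrite EFinM.
rewrite ge0_integralZl_EFin ?bt_ge0//.
- by rewrite -(n2E (dn_l2 h lw)).
- by move=> x _; rewrite lee_fin sqr_ge0.
- by apply/measurable_EFinP; apply: measurable_funX; case: (dn_l2 h lw).
Qed.

Lemma EnE t w : 0 <= t -> l2 leb w -> En t w = (Enr t w)%:E.
Proof.
move=> t0 lw; have mw : measurable_fun setT w by case: lw.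
rewrite -(Enr_shift t0 lw).
apply: eq_integral => x _.
have [_ <-] := mpres_shift x.
- apply: eq_integral => h _; congr EFin.
  have -> : bt t (sub3 x (add3 h x)) = bt t h.
    by rewrite /bt /sq3 /sub3 /add3/=; congr ((_ <= _)%R%:R); ring.
  by rewrite /tau [add3 x h]add3C -sqrrN opprB.
- apply/measurable_EFinP; apply: measurable_funM.
    by apply: (measurableT_comp (bt_meas t)); apply: measurable_sub3.
  by apply: measurable_funX; apply: measurable_funB.
- by move=> y; rewrite lee_fin mulr_ge0 ?bt_ge0 ?sqr_ge0.
Qed.

Lemma n2_young (eta : R) u v : l2 leb u -> l2 leb v -> 0 < eta ->
  n2 leb (fun x => u x + v x) <= (1 + eta) * n2 leb u + (1 + eta^-1) * n2 leb v.
Proof.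
move=> lu lv e0; rewrite n2D//.
have := n2_ge0 leb (fun x => eta * u x - v x).
rewrite (n2B (l2Z eta lu) lv) (n2Z eta lu) (ipZl eta lu lv).
move=> H; have : 0 <= eta^-1 * (eta ^+ 2 * n2 leb u - 2 * (eta * ip leb u v) + n2 leb v).
  by apply: mulr_ge0 => //; rewrite invr_ge0 ltW.
have -> : eta^-1 * (eta ^+ 2 * n2 leb u - 2 * (eta * ip leb u v) + n2 leb v) =
   eta * n2 leb u - 2 * ip leb u v + eta^-1 * n2 leb v by field; exact: lt0r_neq0.
by move: (eta^-1) => z; lra.
Qed.

Definition hdot (g : 'I_3 -> R3 -> R) h x : R := h.1.1 * g i0 x + h.1.2 * g i1 x + h.2 * g i2 x.
Definition G3 (g : 'I_3 -> R3 -> R) : R := n2 leb (g i0) + n2 leb (g i1) + n2 leb (g i2).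
Definition gradof u (g : 'I_3 -> R3 -> R) := forall i, l2 leb (g i) /\ wpd i u (g i).

Lemma hdot_l2 g h : (forall i, l2 leb (g i)) -> l2 leb (hdot g h).
Proof. by move=> lg; apply: l2D; [apply: l2D|]; exact: l2Z. Qed.

Lemma G3_ge0 g : 0 <= G3 g.
Proof. by rewrite !addr_ge0 ?n2_ge0. Qed.

Lemma n2_hdot g h : (forall i, l2 leb (g i)) -> n2 leb (hdot g h) =
  h.1.1 ^+ 2 * n2 leb (g i0) + h.1.2 ^+ 2 * n2 leb (g i1) + h.2 ^+ 2 * n2 leb (g i2)
  + 2 * ip leb (g i0) (g i1) * (h.1.1 * h.1.2)
  + 2 * ip leb (g i0) (g i2) * (h.1.1 * h.2) + 2 * ip leb (g i1) (g i2) * (h.1.2 * h.2).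
Proof.
move=> lg.
have z0 := l2Z h.1.1 (lg i0); have z1 := l2Z h.1.2 (lg i1); have z2 := l2Z h.2 (lg i2).
rewrite /hdot (n2D (l2D z0 z1) z2) (n2D z0 z1) !n2Z//.
rewrite (ipDl z0 z1 z2) (ipZl _ (lg i0) z1) (ipZl _ (lg i0) z2) (ipZl _ (lg i1) z2).
by rewrite !(ipZr _ (lg _) (lg _)); ring.
Qed.

Lemma hdot_int t g : 0 <= t -> (forall i, l2 leb (g i)) ->
  intble leb (fun h => bt t h * n2 leb (hdot g h)) /\
  rint leb (fun h => bt t h * n2 leb (hdot g h)) = ct t * G3 g.
Proof.
move=> t0 lg.
have -> : (fun h => bt t h * n2 leb (hdot g h)) = (fun h =>
   (n2 leb (g i0) * (bt t h * h.1.1 ^+ 2) + n2 leb (g i1) * (bt t h * h.1.2 ^+ 2))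
  + (n2 leb (g i2) * (bt t h * h.2 ^+ 2)
  + ((2 * ip leb (g i0) (g i1)) * (bt t h * (h.1.1 * h.1.2))
  + ((2 * ip leb (g i0) (g i2)) * (bt t h * (h.1.1 * h.2))
  + (2 * ip leb (g i1) (g i2)) * (bt t h * (h.1.2 * h.2)))))).
  by apply/funext => h; rewrite n2_hdot//; ring.
have h0 := bt_sqr_int t0 m11 (@box11 R t); have h1 := bt_sqr_int t0 m12 (@box12 R t).
have h2 := bt_sqr_int t0 m2 (@box2 R t).
have h01 := bt_coord_mul t0 m11 m12 (@box11 R t) (@box12 R t).
have h02 := bt_coord_mul t0 m11 m2 (@box11 R t) (@box2 R t).
have h12 := bt_coord_mul t0 m12 m2 (@box12 R t) (@box2 R t).
have a0 := intbleZ (n2 leb (g i0)) h0; have a1 := intbleZ (n2 leb (g i1)) h1.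
have a2 := intbleZ (n2 leb (g i2)) h2.
have b01 := intbleZ (2 * ip leb (g i0) (g i1)) h01.
have b02 := intbleZ (2 * ip leb (g i0) (g i2)) h02.
have b12 := intbleZ (2 * ip leb (g i1) (g i2)) h12.
have c1 := intbleD b02 b12; have c2 := intbleD b01 c1; have c3 := intbleD a2 c2.
have c4 := intbleD a0 a1.
split; first exact: intbleD c4 c3.
rewrite (rintD c4 c3) (rintD a0 a1) (rintD a2 c2) (rintD b01 c1) (rintD b02 b12).
rewrite (rintZ _ h0) (rintZ _ h1) (rintZ _ h2) (rintZ _ h01) (rintZ _ h02) (rintZ _ h12).
by rewrite (ct01 t0) (ct02 t0) (ct12 t0) ct0 ct1 -/(ct t) /G3; ring.
Qed.

Lemma dn_taylor u g e : l2 leb u -> gradof u g -> 0 < e ->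
  exists2 t, 0 < t <= 1 & forall h, box_le t h ->
    nrm leb (fun x => tau h u x - u x - hdot g h x) <= e * (`|h.1.1| + `|h.1.2| + `|h.2|).
Proof.
move=> lu Hg e0; have lg i := (Hg i).1; have wd i := (Hg i).2.
have e2 : 0 < e / 2 by rewrite divr_gt0.
have [t0 /andP[t00 t01] H0] := tau_cont (lg i0) e2.
have [t1 /andP[t10 t11] H1] := tau_cont (lg i1) e2.
have [t2 /andP[t20 t21] H2] := tau_cont (lg i2) e2.
pose t := Num.min t0 (Num.min t1 t2).
exists t; first by rewrite !lt_min t00 t10 t20/= ge_min t01.
have W y (c d : R) : c <= d -> box_le c y -> box_le d y.
  by move=> cd [? ? ?]; split; exact: le_trans cd.
have K0 h : box_le t h -> nrm leb (fun x => tau h (g i0) x - g i0 x) <= e / 2.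
  by move=> bh; apply: H0; apply: W bh; rewrite ge_min lexx.
have K1 h : box_le t h -> nrm leb (fun x => tau h (g i1) x - g i1 x) <= e / 2.
  by move=> bh; apply: H1; apply: W bh; rewrite !ge_min lexx orbT.
have K2 h : box_le t h -> nrm leb (fun x => tau h (g i2) x - g i2 x) <= e / 2.
  by move=> bh; apply: H2; apply: W bh; rewrite !ge_min lexx !orbT.
move=> h [b0 b1 b2].
have tp : 0 <= t by exact: le_trans b0.
have T0 := weak_taylor (t := h.1.1) lu (lg i0) (wd i0) (ltW e2)
  (fun s hs => K0 _ (box_le_e3 i0 (le_trans hs b0))).
have T1 := weak_taylor (t := h.1.2) lu (lg i1) (wd i1) (ltW e2)
  (fun s hs => K1 _ (box_le_e3 i1 (le_trans hs b1))).
have T2 := weak_taylor (t := h.2) lu (lg i2) (wd i2) (ltW e2)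
  (fun s hs => K2 _ (box_le_e3 i2 (le_trans hs b2))).
set A := e3 i0 h.1.1 in T0 *; set B := e3 i1 h.1.2 in T1 *; set C := e3 i2 h.2 in T2 *.
have bA : box_le t A by apply: box_le_e3.
have bAB : box_le t (add3 A B).
  by rewrite /A /B /add3 /e3 /coord_line/=; split=> /=; rewrite ?addr0 ?add0r ?normr0.
have S1 := K1 _ bA; have S2 := K2 _ bAB.
set p0 := (fun x => tau A u x - u x - h.1.1 * g i0 x) in T0.
set p1 := (fun x => tau B u x - u x - h.1.2 * g i1 x) in T1.
set p2 := (fun x => tau C u x - u x - h.2 * g i2 x) in T2.
set q1 := (fun x => tau A (g i1) x - g i1 x) in S1.
set q2 := (fun x => tau (add3 A B) (g i2) x - g i2 x) in S2.
have lp0 : l2 leb p0 by apply: l2B; [exact: dn_l2|exact: l2Z].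
have lp1 : l2 leb p1 by apply: l2B; [exact: dn_l2|exact: l2Z].
have lp2 : l2 leb p2 by apply: l2B; [exact: dn_l2|exact: l2Z].
have lq1 : l2 leb q1 by exact: dn_l2.
have lq2 : l2 leb q2 by exact: dn_l2.
have l1 := tau_l2 A lp1; have l2' := tau_l2 (add3 A B) lp2.
have z1 := l2Z h.1.2 lq1; have z2 := l2Z h.2 lq2.
(* The shift is made one coordinate at a time. The [p] terms are Taylor remainders in one direction,
   the [q] terms the change of a derivative under the shifts already made; each contributes with the
   factor [e / 2]. *)
have -> : (fun x => tau h u x - u x - hdot g h x) =
    (fun x => (p0 x + (tau A p1 x + h.1.2 * q1 x)) + (tau (add3 A B) p2 x + h.2 * q2 x)).
  apply/funext => x; rewrite (tau_split h) -/A -/B -/C /p0 /p1 /p2 /q1 /q2 /hdot /tau !add3A.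
  have -> : add3 B C = add3 C B by rewrite add3C.
  ring.
have E1 := nrmD l1 z1; have E2 := nrmD l2' z2.
have E3 := nrmD lp0 (l2D l1 z1); have E4 := nrmD (l2D lp0 (l2D l1 z1)) (l2D l2' z2).
rewrite (nrmZ _ lq1) (tau_nrm A lp1) in E1.
rewrite (nrmZ _ lq2) (tau_nrm (add3 A B) lp2) in E2.
have F1 : `|h.1.2| * nrm leb q1 <= `|h.1.2| * (e / 2) by rewrite ler_wpM2l.
have F2 : `|h.2| * nrm leb q2 <= `|h.2| * (e / 2) by rewrite ler_wpM2l.
have := normr_ge0 h.1.1 => hp.
apply: le_trans E4 _.
have G1 : `|h.1.1| * (e / 2) >= 0 by rewrite mulr_ge0// ltW.
move: G1 E1 E2 E3 F1 F2 T0 T1 T2; rewrite /=; clear.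
move: (nrm leb p0) (nrm leb p1) (nrm leb p2) => *; lra.
Qed.

Lemma abs_sum3_sqr h : (`|h.1.1| + `|h.1.2| + `|h.2|) ^+ 2 <= 3 * sq3 h.
Proof.
rewrite /sq3 -[h.1.1 ^+ 2]real_normK ?num_real// -[h.1.2 ^+ 2]real_normK ?num_real//.
rewrite -[h.2 ^+ 2]real_normK ?num_real//.
move: `|h.1.1| `|h.1.2| `|h.2| => a b c.
have := sqr_ge0 (a - b); have := sqr_ge0 (a - c); have := sqr_ge0 (b - c); nra.
Qed.

(* That is, Enr t u / ct t tends to the Dirichlet integral as t tends to 0. *)
Lemma Enr_asym u g e : l2 leb u -> gradof u g -> 0 < e ->
  exists2 d, 0 < d <= 1 & forall t, 0 < t <= d ->
    Enr t u <= (1 + e) * (ct t * G3 g) + e * ct t /\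
    ct t * G3 g <= (1 + e) * Enr t u + e * ct t.
Proof.
move=> lu Hg e0; have lg i := (Hg i).1.
have ei : 0 < 1 + e^-1 by rewrite addr_gt0 ?invr_gt0.
(* Young's inequality with parameter [e] puts the factor [1 + e^-1] on the squared remainder, at
   most [3 * c ^+ 2 * sq3 h], whose integral over the ball is [9 * c ^+ 2 * ct t]; [c] makes the
   total [e * ct t]. *)
pose c := Num.sqrt (e / (9 * (1 + e^-1))).
have c0 : 0 < c by rewrite sqrtr_gt0 divr_gt0// mulr_gt0.
have c2 : 9 * (1 + e^-1) * c ^+ 2 = e.
  rewrite sqr_sqrtr; last by rewrite ltW// divr_gt0// mulr_gt0.
  by rewrite mulrC divfK//; apply: lt0r_neq0; rewrite mulr_gt0.
have [d d01 H] := dn_taylor lu Hg c0.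
exists d => // t /andP[t0 td].
have tn := ltW t0.
have [hi hE] := hdot_int tn lg.
have key h : bt t h != 0 -> n2 leb (fun x => tau h u x - u x - hdot g h x) <= 3 * c ^+ 2 * sq3 h.
  move=> /(bt_box tn)[b0 b1 b2].
  have /H : box_le d h by split; exact: le_trans td.
  have cs : 0 <= c * (`|h.1.1| + `|h.1.2| + `|h.2|) by apply: mulr_ge0; [exact: ltW|rewrite !addr_ge0].
  move=> /(nrm_le_n2 _ _ cs) /le_trans; apply.
  have := ler_wpM2l (sqr_ge0 c) (abs_sum3_sqr h).
  by rewrite exprMn; move: (_ ^+ 2) (c ^+ 2) (sq3 h) => p q r; lra.
have lz h := hdot_l2 h lg; have ld h := dn_l2 h lu.
have ldz h : l2 leb (fun x => tau h u x - u x - hdot g h x) by exact: l2B.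
have P1 h : bt t h * dn u h <= (1 + e) * (bt t h * n2 leb (hdot g h)) + (1 + e^-1) * (3 * c ^+ 2) * (bt t h * sq3 h).
  have [->|b0] := eqVneq (bt t h) 0; first by rewrite !mul0r !mulr0 addr0.
  have := n2_young (lz h) (ldz h) e0.
  have -> : (fun x => hdot g h x + (tau h u x - u x - hdot g h x)) = (fun x => tau h u x - u x).
    by apply/funext => x; ring.
  have := ler_wpM2l (ltW ei) (key h b0) => k1 k2.
  have := le_trans k2 (lerD (lexx _) k1) => /(ler_wpM2l (bt_ge0 t h)) /le_trans; apply.
  by rewrite le_eqVlt; apply/orP; left; apply/eqP; move: (e^-1) => z; ring.
have P2 h : bt t h * n2 leb (hdot g h) <= (1 + e) * (bt t h * dn u h) + (1 + e^-1) * (3 * c ^+ 2) * (bt t h * sq3 h).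
  have [->|b0] := eqVneq (bt t h) 0; first by rewrite !mul0r !mulr0 addr0.
  have := n2_young (ld h) (l2N (ldz h)) e0.
  have -> : (fun x => tau h u x - u x + - (tau h u x - u x - hdot g h x)) = hdot g h.
    by apply/funext => x; ring.
  rewrite n2N; have := ler_wpM2l (ltW ei) (key h b0) => k1 k2.
  have := le_trans k2 (lerD (lexx _) k1) => /(ler_wpM2l (bt_ge0 t h)) /le_trans; apply.
  by rewrite le_eqVlt; apply/orP; left; apply/eqP; rewrite -/(dn u h); move: (e^-1) => z; ring.
have i1 := dn_int tn lu; have i2 := bt_sq3_int tn.
have E3 : (1 + e^-1) * (3 * c ^+ 2) * (3 * ct t) = e * ct t.
  by rewrite -[in RHS]c2; move: (e^-1) => z; ring.
split.
  rewrite -hE -E3 -(ct_sq3 tn) -(rintZ (1 + e) hi) -(rintZ _ i2) -rintD; [|exact: intbleZ|exact: intbleZ].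
  by apply: rint_le => //; apply: intbleD; exact: intbleZ.
rewrite -hE -E3 -(ct_sq3 tn) /Enr -(rintZ (1 + e) i1) -(rintZ _ i2) -rintD; [|exact: intbleZ|exact: intbleZ].
by apply: rint_le => //; apply: intbleD; exact: intbleZ.
Qed.

Lemma dn_le_grad u g h : l2 leb u -> gradof u g -> dn u h <= 3 * sq3 h * G3 g.
Proof.
move=> lu Hg; have lg i := (Hg i).1.
have N0 := weak_lip h.1.1 lu (lg i0) (Hg i0).2.
have N1 := weak_lip h.1.2 lu (lg i1) (Hg i1).2.
have N2 := weak_lip h.2 lu (lg i2) (Hg i2).2.
set A := e3 i0 h.1.1 in N0; set B := e3 i1 h.1.2 in N1; set C := e3 i2 h.2 in N2.
have d0 := dn_l2 A lu; have d1 := tau_l2 A (dn_l2 B lu); have d2 := tau_l2 (add3 A B) (dn_l2 C lu).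
rewrite -(tau_nrm A (dn_l2 B lu)) in N1; rewrite -(tau_nrm (add3 A B) (dn_l2 C lu)) in N2.
have E : (fun x => tau h u x - u x) = (fun x => (tau A u x - u x) + tau A (fun x => tau B u x - u x) x +
    tau (add3 A B) (fun x => tau C u x - u x) x).
  apply/funext => x; rewrite (tau_split h) -/A -/B -/C /tau !add3A.
  have -> : add3 B C = add3 C B by rewrite add3C.
  ring.
have T := nrmD (l2D d0 d1) d2; have T' := nrmD d0 d1.
rewrite -E in T; rewrite /dn -nrm_sqr.
have M : nrm leb (fun x => tau h u x - u x) <=
    `|h.1.1| * nrm leb (g i0) + `|h.1.2| * nrm leb (g i1) + `|h.2| * nrm leb (g i2).
  move: T T' N0 N1 N2; rewrite /=; lra.
have q0 := nrm_ge0 leb (g i0); have q1 := nrm_ge0 leb (g i1); have q2 := nrm_ge0 leb (g i2).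
have : nrm leb (fun x => tau h u x - u x) ^+ 2 <=
   (`|h.1.1| * nrm leb (g i0) + `|h.1.2| * nrm leb (g i1) + `|h.2| * nrm leb (g i2)) ^+ 2.
  by rewrite lerXn2r ?nnegrE ?nrm_ge0 ?addr_ge0 ?mulr_ge0.
move=> /le_trans; apply; rewrite /G3 -!nrm_sqr /sq3.
rewrite -[h.1.1 ^+ 2]real_normK ?num_real// -[h.1.2 ^+ 2]real_normK ?num_real//.
rewrite -[h.2 ^+ 2]real_normK ?num_real//.
move: `|h.1.1| `|h.1.2| `|h.2| (nrm leb (g i0)) (nrm leb (g i1)) (nrm leb (g i2)) => a b c p q r.
apply: (@le_trans _ _ ((a ^+ 2 + b ^+ 2 + c ^+ 2) * (p ^+ 2 + q ^+ 2 + r ^+ 2))).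
  rewrite -subr_ge0.
  have -> : (a ^+ 2 + b ^+ 2 + c ^+ 2) * (p ^+ 2 + q ^+ 2 + r ^+ 2) - (a * p + b * q + c * r) ^+ 2 =
    (a * q - b * p) ^+ 2 + (a * r - c * p) ^+ 2 + (b * r - c * q) ^+ 2 by ring.
  by rewrite !addr_ge0 ?sqr_ge0.
rewrite ler_wpM2r ?addr_ge0 ?sqr_ge0//.
have := sqr_ge0 a; have := sqr_ge0 b; have := sqr_ge0 c; lra.
Qed.

Lemma Enr_le_grad u g t : 0 <= t -> l2 leb u -> gradof u g -> Enr t u <= 24 * G3 g * t ^+ 5.
Proof.
move=> t0 lu Hg.
apply: (@le_trans _ _ (rint leb (fun h => 3 * t ^+ 2 * G3 g * bt t h))).
  apply: rint_le; [exact: dn_int|exact/intbleZ/bt_int|move=> h].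
  have [h1|h1] := boolP (sq3 h <= t ^+ 2); last by rewrite /bt (negbTE h1) mul0r mulr0.
  rewrite /bt h1 mul1r mulr1; apply: le_trans (dn_le_grad h lu Hg) _.
  by rewrite ler_wpM2r ?G3_ge0// ler_wpM2l.
rewrite rintZ; last exact: bt_int.
have := ler_wpM2l (_ : 0 <= 3 * t ^+ 2 * G3 g) (vol_le t0) => /(_ ltac:(by rewrite !mulr_ge0 ?G3_ge0 ?sqr_ge0)).
move=> /le_trans; apply; rewrite le_eqVlt; apply/orP; left; apply/eqP; ring.
Qed.

(** From averages to single shifts: [dn w h] is at most twice the sum of its values at [k + h] and
    [k]. This is integrated over [k] in the ball of radius [t], where [k + h] stays in that of
    radius [2 t]; hence the range of [s] up to 2. The exponent 5 is the order 3 of the volume plus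
    the 2 of a squared Lipschitz bound. *)
Lemma dn_of_Enr w C t h : l2 leb w -> 0 <= C ->
  (forall s, 0 < s <= 2 -> Enr s w <= C * s ^+ 5) -> 0 < t <= 1 -> sq3 h <= t ^+ 2 ->
  dn w h <= 2 ^+ 10 * C * t ^+ 2.
Proof.
move=> lw C0 H /andP[t0 t1] ht; have tn := ltW t0.
have P k : dn w h <= 2 * dn w (add3 k h) + 2 * dn w k.
  have lk := dn_l2 k lw; have lkh := dn_l2 (add3 k h) lw; have lh := dn_l2 h lw.
  have E1 : dn w h = n2 leb (fun x => (tau (add3 k h) w x - w x) - (tau k w x - w x)).
    rewrite /dn -!nrm_sqr -(tau_nrm k lh); congr (nrm _ _ ^+ 2); apply/funext => x.
    by rewrite /tau add3A; ring.
  rewrite E1 (n2B lkh lk).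
  have := n2_ge0 leb (fun x => (tau (add3 k h) w x - w x) + (tau k w x - w x)).
  rewrite (n2D lkh lk) -/(dn w (add3 k h)) -/(dn w k).
  by move: (ip _ _ _) (dn w _) (dn w k) => *; lra.
have t2 : 0 <= 2 * t by rewrite mulr_ge0.
have mt := mpres_shift h.
have i2 := dn_int t2 lw.
have m2t : measurable_fun setT (fun k => bt (2 * t) k * dn w k).
  by apply: measurable_funM; [exact: bt_meas|exact: dn_meas].
have i3 : intble leb (fun k => bt (2 * t) (add3 k h) * dn w (add3 k h)).
  apply: intble_ge0.
  - exact: (mpres_meas mt m2t).
  - by move=> k; rewrite mulr_ge0 ?bt_ge0 ?dn_ge0.
  - have [_ mtE] := mt.
    rewrite (mtE (fun k => (bt (2 * t) k * dn w k)%:E)).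
    + exact: intble_lty.
    + exact/measurable_EFinP.
    + by move=> k; rewrite lee_fin mulr_ge0 ?bt_ge0 ?dn_ge0.
have e3' : rint leb (fun k => bt (2 * t) (add3 k h) * dn w (add3 k h)) = Enr (2 * t) w.
  exact: (mpres_rint mt m2t).
have i1 := dn_int tn lw.
have : vol t * dn w h <= 2 * Enr (2 * t) w + 2 * Enr t w.
  rewrite mulrC -rintZ; last exact: bt_int.
  apply: (@le_trans _ _ (rint leb (fun k => 2 * (bt (2 * t) (add3 k h) * dn w (add3 k h)) + 2 * (bt t k * dn w k)))); last first.
    by rewrite (rintD (intbleZ 2 i3) (intbleZ 2 i1)) (rintZ 2 i3) (rintZ 2 i1) e3'.
  apply: rint_le; [exact/intbleZ/bt_int|exact: (intbleD (intbleZ 2 i3) (intbleZ 2 i1))|move=> k].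
  have [h1|h1] := boolP (sq3 k <= t ^+ 2); last first.
    by rewrite /bt (negbTE h1) mulr0 mul0r mulr0 addr0 !mulr_ge0 ?dn_ge0//.
  have h2 : sq3 (add3 k h) <= (2 * t) ^+ 2.
    move: ht h1; rewrite /sq3 /add3/=.
    have := sqr_ge0 (k.1.1 - h.1.1); have := sqr_ge0 (k.1.2 - h.1.2); have := sqr_ge0 (k.2 - h.2); nra.
  by rewrite /bt h1 h2 mulr1 !mul1r; exact: P.
move=> h3.
have h2 : Enr (2 * t) w <= 32 * (C * t ^+ 5).
  have -> : 32 * (C * t ^+ 5) = C * (2 * t) ^+ 5 by ring.
  by apply: H; apply/andP; split; lra.
have h1 : Enr t w <= C * t ^+ 5 by apply: H; apply/andP; split; lra.
have v1 := ler_wpM2r (dn_ge0 w h) (vol_ge t0).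
(* The constant [2 * 32 + 2 = 66] is rounded up to 128, and division by [t ^+ 3 / 8] gives
   [2 ^+ 10]. *)
have : t ^+ 3 / 8 * dn w h <= t ^+ 3 / 8 * (2 ^+ 10 * C * t ^+ 2).
  apply: le_trans v1 _; apply: le_trans h3 _.
  have -> : t ^+ 3 / 8 * (2 ^+ 10 * C * t ^+ 2) = 128 * (C * t ^+ 5) by field.
  have c5 := mulr_ge0 C0 (exprn_ge0 5 tn).
  move: (Enr _ _) (Enr t w) (C * _) h1 h2 c5 => *; lra.
have p8 : 0 < t ^+ 3 / 8 by exact: (divr_gt0 (exprn_gt0 3 t0) (ltr0n _ 8)).
by rewrite (ler_pM2l p8).
Qed.

Lemma gradof_of_Enr w C : l2 leb w -> 0 <= C ->
  (forall s, 0 < s <= 2 -> Enr s w <= C * s ^+ 5) -> exists g, gradof w g.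
Proof.
move=> lw C0 H.
have ex i : exists g, l2 leb g /\ wpd i w g.
  have [|g lg wg] := @wpd_exists _ i w (Num.sqrt (2 ^+ 10 * C)) lw (sqrtr_ge0 _); last by exists g.
  move=> t t1; have [->|t0] := eqVneq t 0.
    rewrite normr0 mulr0; rewrite (_ : (fun x => _) = (fun=> 0)).
      by rewrite /nrm /n2 (_ : (fun x => 0 ^+ 2) = cst 0) ?/rint ?Rintegral_cst// ?mul0r ?sqrtr0//; apply/funext => x; rewrite expr0n.
    by apply/funext => x; rewrite /tau add3_coord addr0 coord_line_id subrr.
  have at0 : 0 < `|t| by rewrite normr_gt0.
  apply/nrm_le_n2; first by rewrite mulr_ge0 ?sqrtr_ge0.
  have C528 : 0 <= 2 ^+ 10 * C by apply: mulr_ge0 C0; exact: exprn_ge0.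
  rewrite exprMn (sqr_sqrtr C528).
  apply: (@dn_of_Enr w C `|t| (e3 i t)) => //; first by rewrite at0.
  rewrite real_normK ?num_real// /sq3 /e3 /coord_line.
  by case: (val i == 0%N) => /=; case: (val i == 1%N) => /=; rewrite expr0n/= ?addr0 ?add0r.
by have /choice[g Hg] := ex; exists g.
Qed.

(** The bound [24 * G3 g * t ^+ 5] inherited from [u] gives [w] a weak gradient; then [Enr_asym]
    applies to both functions and the common factor [ct t] cancels for small [t]. Through this
    result rearrangements act on gradients without being differentiated. *)
Theorem gradof_compare u g w : l2 leb u -> gradof u g -> l2 leb w ->
  (forall t, 0 < t -> Enr t w <= Enr t u) -> exists2 k, gradof w k & G3 k <= G3 g.
Proof.
move=> lu Hg lw H.
have [||k Hk] := @gradof_of_Enr w (24 * G3 g) lw.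
- by rewrite mulr_ge0 ?G3_ge0.
- move=> s /andP[s0 _]; apply: le_trans (H s s0) _; apply: Enr_le_grad => //; exact: ltW.
exists k => //; apply/ler_addgt0Pr => e e0.
(* For [d <= 1] the excess [(2 d + d^2) G3 g + 2 d + d^2] is at most [3 d (G3 g + 1)], which
   [4 * M * d <= e] absorbs. *)
pose M := G3 g + 2.
have M0 : 0 < M by rewrite ltr_wpDl ?G3_ge0.
pose d := Num.min 1 (e / (4 * M)).
have d0 : 0 < d by rewrite lt_min ltr01 divr_gt0// mulr_gt0.
have d1 : d <= 1 by rewrite ge_min lexx.
have dM : 4 * M * d <= e by rewrite mulrC -ler_pdivlMr ?mulr_gt0// ge_min lexx orbT.
have [s1 /andP[s10 _] H1] := Enr_asym lu Hg d0.
have [s2 /andP[s20 _] H2] := Enr_asym lw Hk d0.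
pose t := Num.min s1 s2.
have t0 : 0 < t by rewrite lt_min s10.
have [|A _] := H1 t; first by rewrite t0 ge_min lexx.
have [|_ B] := H2 t; first by rewrite t0 ge_min lexx orbT.
have ctp := ct_gt0 t0.
have d1p : 0 <= 1 + d by rewrite addr_ge0// ltW.
have C := le_trans B (lerD (ler_wpM2l d1p (le_trans (H t t0) A)) (lexx _)).
have : ct t * G3 k <= ct t * (G3 g + e).
  apply: le_trans C _.
  have -> : (1 + d) * ((1 + d) * (ct t * G3 g) + d * ct t) + d * ct t =
    ct t * ((1 + d) ^+ 2 * G3 g + (1 + d) * d + d) by ring.
  rewrite ler_pM2l//; have := G3_ge0 g; move: dM; rewrite /M.
  have : d * d <= d by rewrite ler_piMl// ltW.
  move: (G3 g) => z dd H3 z0.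
  have : d * d * z <= d * z by rewrite ler_wpM2r.
  by nra.
by rewrite ler_pM2l.
Qed.

End energy2.

(** * Rellich compactness on balls *)

Section rellich.
Context {R : realType}.
Local Notation R3 := (R3 R).
Local Notation leb := (leb R).
Implicit Types (u v w : R3 -> R) (x y h : R3).

Lemma vol_gt0 (t : R) : 0 < t -> 0 < vol t.
Proof. by move=> t0; apply: lt_le_trans (vol_ge t0); rewrite divr_gt0// exprn_gt0. Qed.

Lemma n2_bt (t : R) : n2 leb (bt t) = vol t.
Proof. by congr rint; apply/funext => x; rewrite expr2 bt_sq. Qed.

Definition avg (t : R) u x : R := (vol t)^-1 * ip leb (bt t) (tau x u).

Lemma avg_ip (t : R) u x : 0 < t -> l2 leb u ->
  avg t u x = (vol t)^-1 * ip leb u (tau (opp3 x) (bt t)).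
Proof. by move=> t0 lu; rewrite /avg ipC tau_ip//; apply: bt_l2; exact: ltW. Qed.

Lemma avgB (t : R) u v x : 0 < t -> l2 leb u -> l2 leb v ->
  avg t (fun x => u x - v x) x = avg t u x - avg t v x.
Proof.
move=> t0 lu lv; rewrite /avg -mulrBr; congr (_ * _).
by rewrite -ipBr//; [exact: tau_l2|exact: tau_l2|apply: bt_l2; exact: ltW].
Qed.

(** The average is a scalar product with a translate of the indicator of the ball, so its modulus of
    continuity is that of the translations of [bt t] in L2, the same for all [u] of bounded norm. *)
Lemma avg_equi (t : R) u x y : 0 < t -> l2 leb u ->
  `|avg t u x - avg t u y| <=
  (vol t)^-1 * nrm leb (fun h => tau (sub3 y x) (bt t) h - bt t h) * nrm leb u.
Proof.
move=> t0 lu; have lb := bt_l2 (ltW t0).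
rewrite !avg_ip// -mulrBr normrM ger0_norm ?invr_ge0 ?(ltW (vol_gt0 t0))//.
rewrite -mulrA ler_wpM2l ?invr_ge0 ?(ltW (vol_gt0 t0))//.
have lx := tau_l2 (opp3 x) lb; have ly := tau_l2 (opp3 y) lb.
rewrite -(ipBr lx ly lu); apply: le_trans (ip_le lu (l2B lx ly)) _.
rewrite mulrC -(tau_nrmB (opp3 y) (tau_l2 (sub3 y x) lb) lb).
rewrite (_ : tau (opp3 y) (tau (sub3 y x) (bt t)) = tau (opp3 x) (bt t))//.
apply/funext => h; rewrite /tau; congr bt.
by rewrite /add3 /opp3 /sub3/=; congr ((_, _), _); ring.
Qed.

Lemma near_box (e : R) x : 0 < e -> \forall y \near x, box_le e (sub3 y x).
Proof.
move=> e0; have H (p : R3 -> R) : continuous p -> \forall y \near x, `|p y - p x| <= e.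
  by move=> cp; move: (cp x) => /cvgrPdist_le /(_ e e0); apply: filterS => y /=; rewrite distrC.
have h1 := H _ (@cont11 R); have h2 := H _ (@cont12 R); have h3 := H _ (@cont2 R).
apply: filterS (filterI h1 (filterI h2 h3)) => y [? [? ?]]; exact: And3.
Qed.

Lemma avg_cont (t : R) u : 0 < t -> l2 leb u -> continuous (avg t u).
Proof.
move=> t0 lu x; apply/cvgrPdist_le => e e0 /=.
have v0 := vol_gt0 t0.
have n0 : 0 < nrm leb u + 1 by rewrite ltr_wpDl ?nrm_ge0.
have e1 : 0 < e * vol t / (nrm leb u + 1) by rewrite divr_gt0// mulr_gt0.
have [d /andP[d0 _] H] := tau_cont (bt_l2 (ltW t0)) e1.
have := near_box x d0; apply: filterS => y /H /= K.
apply: le_trans (avg_equi _ _ t0 lu) _.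
rewrite ler_pdivlMr// in K.
rewrite -mulrA mulrC ler_pdivrMr//.
apply: le_trans K; rewrite ler_wpM2l ?nrm_ge0//; lra.
Qed.

Lemma avg_meas (t : R) u : 0 < t -> l2 leb u -> measurable_fun setT (avg t u).
Proof. by move=> t0 lu; apply: measurable_continuous3; exact: avg_cont. Qed.

(** At each [x], [vol t * (avg t u x - u x)] is the scalar product of [bt t] with
    [h |-> bt t h * (u (x + h) - u x)]. Cauchy-Schwarz and integration in [x] then produce the
    energy. *)
Lemma avg_jensen (t : R) u : 0 < t -> l2 leb u ->
  l2 leb (fun x => u x - avg t u x) /\
  n2 leb (fun x => u x - avg t u x) <= (vol t)^-1 * Enr t u.
Proof.
move=> t0 lu; have lb := bt_l2 (ltW t0); have v0 := vol_gt0 t0.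
have mu : measurable_fun setT u by case: lu.
have mD : measurable_fun setT (fun x => u x - avg t u x).
  by apply: measurable_funB => //; exact: avg_meas.
have lf x : l2 leb (fun h => bt t h * (tau h u x - u x)).
  have -> : (fun h => bt t h * (tau h u x - u x)) = (fun h => bt t h * tau x u h - u x * bt t h).
    by apply/funext => h; rewrite /tau add3C; ring.
  apply: l2B; last exact: l2Z.
  apply: l2_dom (tau_l2 x lu).
    by apply: measurable_funM; [exact: bt_meas|case: (tau_l2 x lu)].
  move=> h; rewrite normrM -[leRHS]mul1r ler_wpM2r//.
  by rewrite ger0_norm ?bt_ge0//; case/andP: (bt01 t h).
have key x : (u x - avg t u x) ^+ 2 <= (vol t)^-1 * n2 leb (fun h => bt t h * (tau h u x - u x)).
  have E : ip leb (bt t) (fun h => bt t h * (tau h u x - u x)) = vol t * (avg t u x - u x).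
    rewrite /avg mulrBr mulrA divff ?lt0r_neq0// mul1r.
    have -> : vol t * u x = ip leb (bt t) (fun h => u x * bt t h).
      by rewrite ipZr// mulrC -n2_ip n2_bt.
    rewrite -ipBr; [|exact: tau_l2|exact: l2Z|exact: lb].
    congr rint; apply/funext => h; rewrite mulrA bt_sq /tau (add3C h).
    have := bt_sq t h; move: (bt t h) (u x) (u _) => c p q E.
    by rewrite !mulrBr [c * (p * c)]mulrCA E; ring.
  have := ip_sqr_le lb (lf x); rewrite E n2_bt exprMn -[X in _ * X]sqrrN opprB.
  by rewrite expr2 -mulrA ler_pM2l// -ler_pdivlMl.
have B : (\int[leb]_x ((u x - avg t u x) ^+ 2)%:E <= ((vol t)^-1 * Enr t u)%:E)%E.
  rewrite EFinM -(Enr_shift (ltW t0) lu).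
  have mF : measurable_fun setT (fun p : R3 * R3 => (bt t p.2 * (tau p.2 u p.1 - u p.1) ^+ 2)%:E).
    apply/measurable_EFinP; apply: measurable_funM; first exact: (measurableT_comp (bt_meas t) measurable_snd).
    apply: measurable_funX; apply: measurable_funB.
      by apply: (measurableT_comp mu); apply: measurable_add3.
    exact: (measurableT_comp mu measurable_fst).
  have F0 p : (0 <= (bt t p.2 * (tau p.2 u p.1 - u p.1) ^+ 2)%:E)%E.
    by rewrite lee_fin mulr_ge0 ?bt_ge0 ?sqr_ge0.
  rewrite -ge0_integralZl_EFin ?invr_ge0 ?(ltW v0)//.
  - apply: ge0_le_integral => //.
    + by move=> x _; rewrite lee_fin sqr_ge0.
    + by apply/measurable_EFinP; exact: measurable_funX.
    + apply: emeasurable_funM => //; exact: (tonelli_meas1 (f := fun p : R3 * R3 => (bt t p.2 * (tau p.2 u p.1 - u p.1) ^+ 2)%:E) leb mF F0).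
    + move=> x _; apply: le_trans (_ : _ <= ((vol t)^-1 * n2 leb (fun h => bt t h * (tau h u x - u x)))%:E)%E _.
        by rewrite lee_fin.
      rewrite EFinM (n2E (lf x)) le_eqVlt; apply/orP; left; apply/eqP; congr (_ * _)%E.
      by apply: eq_integral => h _; rewrite exprMn expr2 bt_sq.
  - by move=> x _; apply: integral_ge0 => h _; exact: F0 (x, h).
  - exact: (tonelli_meas1 (f := fun p : R3 * R3 => (bt t p.2 * (tau p.2 u p.1 - u p.1) ^+ 2)%:E) leb mF F0).
have lD : l2 leb (fun x => u x - avg t u x).
  by split=> //; apply: le_lt_trans B _; rewrite ltry.
by split=> //; rewrite -lee_fin (n2E lD).
Qed.

Lemma EnrB (t : R) u v : 0 <= t -> l2 leb u -> l2 leb v ->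
  Enr t (fun x => u x - v x) <= 2 * Enr t u + 2 * Enr t v.
Proof.
move=> t0 lu lv; have iu := dn_int t0 lu; have iv := dn_int t0 lv.
have -> : 2 * Enr t u + 2 * Enr t v = rint leb (fun h => 2 * (bt t h * dn u h) + 2 * (bt t h * dn v h)).
  by rewrite (rintD (intbleZ 2 iu) (intbleZ 2 iv)) (rintZ 2 iu) (rintZ 2 iv).
apply: rint_le; [exact: dn_int (l2B lu lv)|by apply: intbleD; exact: intbleZ|].
move=> h; have du := dn_l2 h lu; have dv := dn_l2 h lv.
have -> : dn (fun x => u x - v x) h = n2 leb (fun x => (tau h u x - u x) - (tau h v x - v x)).
  by congr rint; apply/funext => x; rewrite /tau; congr (_ ^+ 2); ring.
have := n2_ge0 leb (fun x => (tau h u x - u x) + (tau h v x - v x)).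
rewrite (n2D du dv) (n2B du dv) -/(dn u h) -/(dn v h); have := bt_ge0 t h.
move: (bt t h) (ip leb _ _) (dn u h) (dn v h) => b p q r b0 H. have := mulr_ge0 b0 H. lra.
Qed.

(** The limit is the supremum of the reals that lie below [a] on a set of [U]; since [U] is an
    ultrafilter, a number above the supremum is an upper bound on a set of [U]. *)
Lemma ultra_lim (U : set_system nat) (a : nat -> R) M : UltraFilter U ->
  (forall n, `|a n| <= M) -> exists l, forall d, 0 < d -> U [set n | `|a n - l| <= d].
Proof.
move=> UU aM; have PF : ProperFilter U by exact: ultra_proper.
pose E := [set x | U [set n | x <= a n]].
have EM : E (- M).
  by apply: filterS (filterT : U setT) => n _ /=; have := aM n; rewrite ler_norml => /andP[].
have Eub : ubound E M.
  move=> x /= Ex; have [n /=] := filter_ex Ex.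
  by move=> /le_trans; apply; have := aM n; rewrite ler_norml => /andP[].
have hs : has_sup E by split; [exists (- M)|exists M].
exists (sup E) => d d0.
have [y Ey yd] := sup_adherent d0 hs.
have A2 : U [set n | a n < sup E + d].
  have [|] := in_ultra_setVsetC [set n | sup E + d <= a n] UU.
    move=> K; have := ub_le_sup hs.2 (K : E (sup E + d)); rewrite leNgt ltrDl.
    by rewrite d0.
  by apply: filterS => n /= /negP; rewrite -ltNge.
apply: filterS2 Ey A2 => n /= h1 h2; rewrite ler_norml; apply/andP; split; lra.
Qed.

Lemma grid1 (r eta : R) : 0 < eta -> exists N (p : 'I_N.+1 -> R),
  forall a, `|a| <= r -> exists i, `|p i - a| <= eta.
Proof.
move=> e0; exists (Num.truncn (2 * r / eta)), (fun i => - r + i%:R * eta) => a.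
rewrite ler_norml => /andP[a1 a2].
have b0 : 0 <= (a + r) / eta by rewrite divr_ge0 ?(ltW e0)//; lra.
have /andP[c1 c2] := truncn_itv b0.
have ci : (Num.truncn ((a + r) / eta) < (Num.truncn (2 * r / eta)).+1)%N.
  by rewrite ltnS; apply: le_truncn; rewrite ler_pM2r ?invr_gt0//; lra.
exists (Ordinal ci) => /=.
rewrite ler_pdivlMr// in c1; rewrite ltr_pdivrMr// -natr1 in c2.
move: (_%:R) c1 c2 => z c1 c2; rewrite ler_norml; apply/andP; split; lra.
Qed.

Lemma norm_le3 (p a b d : R) : `|p - (a - b)| <= d -> `|a| <= d -> `|b| <= d -> `|p| <= 3 * d.
Proof.
move=> h1 h2 h3; have -> : p = (p - (a - b)) + (a - b) by ring.
apply: le_trans (ler_normD _ _) _; have := ler_normB a b.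
by move: h1 h2 h3; move: `|_| `|_| `|_| `|_| => *; lra.
Qed.

(* The averages over balls of a small radius are uniformly close to the functions, by
   avg_jensen, and equicontinuous, by avg_equi, so that it suffices to take limits along
   the ultrafilter at the points of a finite grid. *)
Lemma rellich_net (U : set_system nat) us (M C r e : R) : UltraFilter U ->
  (forall n, l2 leb (us n)) -> (forall n, n2 leb (us n) <= M) -> 0 <= C ->
  (forall n t, 0 < t <= 1 -> Enr t (us n) <= C * t ^+ 5) -> 0 < r -> 0 < e ->
  exists2 A, U A & forall n k, A n -> A k ->
    rint leb (fun x => bt r x * (us n x - us k x) ^+ 2) <= e.
Proof.
move=> UU lus nM C0 EC r0 e0; have PF : ProperFilter U by exact: ultra_proper.
have M0 : 0 <= M by exact: le_trans (n2_ge0 _ _) (nM 0%N).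
(* The difference of two terms has energy at most [4 * C * t ^+ 5], so twice its squared distance to
   its averages is at most [64 * C * t ^+ 2 <= e / 2]. *)
pose t := Num.min 1 (e / (128 * C + 1 + e)).
have den : 0 < 128 * C + 1 + e by have := C0; lra.
have t0 : 0 < t by rewrite lt_min ltr01/= divr_gt0.
have t1 : t <= 1 by rewrite ge_min lexx.
have tE : t * (128 * C) <= e.
  have : t <= e / (128 * C + 1 + e) by rewrite ge_min lexx orbT.
  by rewrite ler_pdivlMr// => /(le_trans _); apply; rewrite ler_wpM2l ?(ltW t0)//; lra.
have v0 := vol_gt0 t0; have vr0 := vol_gt0 r0.
(* The averages of the difference will be at most [3 * d] on the ball: [d] for the passage to a grid
   point, and [d] for the distance of each of the two terms to its ultrafilter limit there. *)
pose d := Num.sqrt (e / (36 * (vol r + 1))).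
have dd : 0 < 36 * (vol r + 1) by lra.
have d0 : 0 < d by rewrite sqrtr_gt0 divr_gt0.
have d2 : 2 * (vol r * (3 * d) ^+ 2) <= e / 2.
  rewrite exprMn sqr_sqrtr; last by rewrite ltW// divr_gt0.
  have -> : 2 * (vol r * (3 ^+ 2 * (e / (36 * (vol r + 1))))) = e / 2 * (vol r / (vol r + 1)).
    by field; apply: lt0r_neq0; lra.
  by rewrite ler_piMr ?ltW ?divr_gt0// ltr_pdivrMr ?ltr_wpDr//; lra.
pose S := 2 * Num.sqrt M + 1.
have S0 : 0 < S by rewrite ltr_wpDl// mulr_ge0// sqrtr_ge0.
have lw n k : l2 leb (fun x => us n x - us k x) by exact: l2B.
have nus n : nrm leb (us n) <= Num.sqrt M by exact: ler_wsqrtr.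
have nw n k : nrm leb (fun x => us n x - us k x) <= S.
  by have := nrmB (lus n) (lus k); have := nus n; have := nus k; rewrite /S; lra.
have e1 : 0 < d * vol t / S by rewrite divr_gt0// mulr_gt0.
have [eta /andP[eta0 _] Heta] := tau_cont (bt_l2 (ltW t0)) e1.
have [N [p Hp]] := grid1 r eta0.
pose P (i : 'I_N.+1 * 'I_N.+1 * 'I_N.+1) : R3 := ((p i.1.1, p i.1.2), p i.2).
have Bd i n : `|avg t (us n) (P i)| <= (vol t)^-1 * (nrm leb (bt t) * Num.sqrt M).
  rewrite /avg normrM ger0_norm ?invr_ge0 ?(ltW v0)// ler_wpM2l ?invr_ge0 ?(ltW v0)//.
  apply: le_trans (ip_le (bt_l2 (ltW t0)) (tau_l2 (P i) (lus n))) _.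
  by rewrite ler_wpM2l ?nrm_ge0// tau_nrm.
have /choice[l Hl] : forall i, exists l, forall d, 0 < d -> U [set n | `|avg t (us n) (P i) - l| <= d].
  by move=> i; apply: ultra_lim (Bd i).
exists [set n | forall i, `|avg t (us n) (P i) - l i| <= d].
  by apply: filter_forall => i; apply: Hl.
move=> n k An Ak.
set w := fun x => us n x - us k x.
have lwn : l2 leb w := lw n k.
have [lj nj] := avg_jensen t0 lwn.
have Ew : Enr t w <= 4 * C * t ^+ 5.
  have := EnrB (ltW t0) (lus n) (lus k).
  have ht : 0 < t <= 1 by rewrite t0.
  have := EC n t ht; have := EC k t ht; rewrite -/w; clear.
  by move: (Enr _ w) (Enr _ _) (Enr _ _) (t ^+ 5) => *; lra.
have small : 2 * n2 leb (fun x => w x - avg t w x) <= e / 2.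
  have tv := vol_ge t0.
  apply: le_trans (_ : 2 * ((vol t)^-1 * (4 * C * t ^+ 5)) <= _).
    rewrite ler_pM2l//; apply: le_trans nj _.
    by rewrite ler_pM2l ?invr_gt0.
  apply: le_trans (_ : 2 * ((t ^+ 3 / 8)^-1 * (4 * C * t ^+ 5)) <= _).
    rewrite ler_pM2l//; apply: ler_wpM2r; first by apply: mulr_ge0; [exact: mulr_ge0|apply: exprn_ge0; exact: ltW].
    by rewrite lef_pV2 ?posrE// divr_gt0// exprn_gt0.
  have -> : 2 * ((t ^+ 3 / 8)^-1 * (4 * C * t ^+ 5)) = t * (64 * C) * t.
    by field; exact: lt0r_neq0.
  apply: le_trans (_ : t * (64 * C) * 1 <= _); last by lra.
  by rewrite ler_wpM2l// mulr_ge0 ?(ltW t0)// mulr_ge0.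
have avb x : bt r x != 0 -> `|avg t w x| <= 3 * d.
  move=> /(bt_box (ltW r0))[/Hp[j1 h1] /Hp[j2 h2] /Hp[j3 h3]].
  pose i := (j1, j2, j3).
  have q1 : `|avg t w x - avg t w (P i)| <= d.
    apply: le_trans (avg_equi x (P i) t0 lwn) _.
    have := Heta (sub3 (P i) x) (And3 h1 h2 h3).
    rewrite ler_pdivlMr// => K; rewrite -mulrA mulrC ler_pdivrMr//.
    by apply: le_trans K; rewrite ler_wpM2l ?nrm_ge0//; exact: nw.
  have q2 : avg t w (P i) = (avg t (us n) (P i) - l i) - (avg t (us k) (P i) - l i).
    by rewrite /w avgB//; ring.
  by rewrite q2 in q1; exact: norm_le3 q1 (An i) (Ak i).
have ir : intble leb (fun x => bt r x * (3 * d) ^+ 2).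
  by under eq_fun do rewrite mulrC; apply: intbleZ; apply: bt_int; exact: ltW.
have ij := l2_sq lj.
apply: (@le_trans _ _ (rint leb (fun x => 2 * (w x - avg t w x) ^+ 2 + 2 * (bt r x * (3 * d) ^+ 2)))).
  apply: rint_le.
  - apply: intble_le (l2_sq lwn).
      by apply: measurable_funM; [exact: bt_meas|apply: measurable_funX; case: lwn].
    move=> x; rewrite normrM [`|_ ^+ 2|]ger0_norm ?sqr_ge0// ger0_norm ?bt_ge0//.
    by rewrite ler_piMl ?sqr_ge0//; case/andP: (bt01 r x).
  - by apply: intbleD; apply: intbleZ.
  - move=> x; have [b0|b0] := eqVneq (bt r x) 0.
      by rewrite b0 !mul0r mulr0 addr0 mulr_ge0// sqr_ge0.
    have b1 : bt r x = 1 by move: b0; rewrite /bt; case: (sq3 x <= _); rewrite ?eqxx.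
    rewrite b1 !mul1r -/(w x).
    have : avg t w x ^+ 2 <= (3 * d) ^+ 2.
      by rewrite -[_ ^+ 2]real_normK ?num_real// lerXn2r ?nnegrE ?mulr_ge0 ?(ltW d0)// avb.
    move: (w x) (avg t w x) (3 * d) => a b c; have := sqr_ge0 (a - 2 * b); clear; nra.
rewrite (rintD (intbleZ 2 ij) (intbleZ 2 ir)) (rintZ 2 ij) (rintZ 2 ir).
have -> : rint leb (fun x => bt r x * (3 * d) ^+ 2) = vol r * (3 * d) ^+ 2.
  rewrite [RHS]mulrC /vol -(rintZ _ (bt_int (ltW r0))).
  by congr rint; apply/funext => x; rewrite mulrC.
move: small d2; rewrite /n2; lra.
Qed.

(** A single ultrafilter containing all tails serves every radius: the set [A j] found for radius
    [j + 1] and tolerance [1 / (j + 1)] belongs to it, finite intersections of such sets meet every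
    tail, and [s n] is chosen in the [A i] for all [i <= n]. *)
Theorem rellich us (M C : R) :
  (forall n, l2 leb (us n)) -> (forall n, n2 leb (us n) <= M) -> 0 <= C ->
  (forall n t, 0 < t <= 1 -> Enr t (us n) <= C * t ^+ 5) ->
  exists s : nat -> nat, (forall n, (s n < s n.+1)%N) /\
    forall r e, 0 < e -> exists N, forall n k, (N <= n)%N -> (N <= k)%N ->
      rint leb (fun x => bt r x * (us (s n) x - us (s k) x) ^+ 2) <= e.
Proof.
move=> lus nM C0 EC.
have [U [UU sU]] := ultraFilterLemma (eventually_filter : ProperFilter \oo).
have PF : ProperFilter U by exact: ultra_proper.
have /choice[A HA] : forall j : nat, exists A, U A /\ forall n k, A n -> A k ->
    rint leb (fun x => bt j.+1%:R x * (us n x - us k x) ^+ 2) <= j.+1%:R^-1.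
  by move=> j; have [//|//|A UA H] := @rellich_net U us M C j.+1%:R j.+1%:R^-1 UU lus nM C0 EC; exists A.
have /choice[nx Hnx] : forall jm : nat * nat, exists n, (jm.2 < n)%N /\ forall i, (i <= jm.1)%N -> A i n.
  move=> [j m]/=.
  have U1 : U [set n | forall i : 'I_j.+1, A i n] by apply: filter_forall => i; exact: (HA i).1.
  have U2 : U [set n | (m < n)%N] by apply: sU; exists m.+1.
  have [n /= [n1 n2]] := filter_ex (filterI U1 U2).
  by exists n; split=> // i ij; exact: (n1 (Ordinal (ij : (i < j.+1)%N))).
pose s := fix s n := if n is k.+1 then nx (n, s k) else nx (0%N, 0%N).
exists s; split; first by move=> n; exact: (Hnx (n.+1, s n)).1.
have As n i : (i <= n)%N -> A i (s n).
  by case: n => [|n] h; [exact: (Hnx (0%N, 0%N)).2|exact: (Hnx (n.+1, s n)).2].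
move=> r e e0.
pose N := (Num.truncn (Num.max `|r| e^-1)).+1.
have HN : Num.max `|r| e^-1 <= N%:R.
  by rewrite ltW// truncnS_gt.
move: HN; rewrite ge_max => /andP[rN eN].
exists N => n k Nn Nk.
have := (HA N).2 _ _ (As n N Nn) (As k N Nk).
have NS : (N%:R : R) <= N.+1%:R by rewrite ler_nat.
have eN1 : N.+1%:R^-1 <= e.
  by rewrite -[leRHS]invrK lef_pV2 ?posrE ?invr_gt0//; exact: le_trans eN NS.
move=> /le_trans /(_ eN1) /(le_trans _); apply.
have lw := l2B (lus (s n)) (lus (s k)).
have ib (q : R) : intble leb (fun x => bt q x * (us (s n) x - us (s k) x) ^+ 2).
  apply: intble_le (l2_sq lw).
    by apply: measurable_funM; [exact: bt_meas|apply: measurable_funX; case: lw].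
  move=> x; rewrite normrM [`|_ ^+ 2|]ger0_norm ?sqr_ge0// ger0_norm ?bt_ge0//.
  by rewrite ler_piMl ?sqr_ge0//; case/andP: (bt01 q x).
apply: rint_le => // x; rewrite ler_wpM2r ?sqr_ge0// /bt ler_nat.
case: (boolP (sq3 x <= r ^+ 2)) => // h; rewrite lt0b.
apply: le_trans h _; rewrite -[r ^+ 2]real_normK ?num_real// lerXn2r ?nnegrE//.
exact: le_trans NS.
Qed.

End rellich.

(** * The potential and its energy *)

Section mulb.
Context d (T : measurableType d) (R : realType) (m : {measure set T -> \bar R}).

Lemma intble_mulb (g f : T -> R) M : measurable_fun setT g -> (forall x, `|g x| <= M) ->
  intble m f -> intble m (fun x => g x * f x).
Proof.
move=> mg gM fi; apply: intble_le (intbleZ M (intble_norm fi)).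
  by apply: measurable_funM => //; exact: intble_meas fi.
by move=> x; rewrite normrM ler_wpM2r.
Qed.

Lemma rint_mulb (g f : T -> R) M : measurable_fun setT g -> (forall x, `|g x| <= M) ->
  intble m f -> `|rint m (fun x => g x * f x)| <= M * rint m (fun x => `|f x|).
Proof.
move=> mg gM fi; have gi := intble_mulb mg gM fi.
apply: le_trans (rint_norm gi) _; rewrite -(rintZ M (intble_norm fi)).
apply: rint_le; [exact: intble_norm|exact: intbleZ (intble_norm fi)|].
by move=> x; rewrite normrM ler_wpM2r.
Qed.

Lemma sqdiff (u w : T -> R) : l2 m u -> l2 m w ->
  intble m (fun x => u x ^+ 2 - w x ^+ 2) /\
  rint m (fun x => `|u x ^+ 2 - w x ^+ 2|) <= nrm m (fun x => u x - w x) * nrm m (fun x => u x + w x).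
Proof.
move=> lu lw; split; first exact: intbleB (l2_sq lu) (l2_sq lw).
have lm := l2_abs (l2B lu lw); have lp := l2_abs (l2D lu lw).
have E (v : T -> R) : nrm m (fun x => `|v x|) = nrm m v.
  by congr (Num.sqrt (rint _ _)); apply/funext => x; rewrite real_normK ?num_real.
rewrite -[in leRHS]E -[X in _ <= _ * X]E; apply: le_trans (le_trans (ler_norm _) (ip_le lm lp)).
by rewrite le_eqVlt; apply/orP; left; apply/eqP; congr rint; apply/funext => x; rewrite -normrM subr_sqr.
Qed.

Lemma n2_0 : n2 m (fun=> 0 : R) = 0.
Proof.
rewrite -[RHS](mul0r (n2 m (fun=> 0))) -[X in X * _](expr0n _ 2) -(n2Z 0 (l20 m)).
by congr rint; apply/funext => x; rewrite mul0r.
Qed.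

Lemma ae_n2B0 (u w : T -> R) : l2 m u -> l2 m w -> {ae m, forall x, u x = w x} ->
  n2 m (fun x => u x - w x) = 0.
Proof.
move=> lu lw uw; rewrite (ae_n2 (l2B lu lw) (l20 m)) ?n2_0//.
by apply: ae_imp uw => x ->; rewrite subrr.
Qed.

End mulb.

Section Denergy.
Context {R : realType}.
Local Notation R3 := (R3 R).
Local Notation leb := (leb R).
Implicit Types (u v w : R3 -> R) (x y h : R3).

Lemma kern_gt0 (r : R) : 0 <= r -> 0 < kern r.
Proof.
rewrite /kern; case: eqVneq => // r0 rp.
have r1 : 0 < r by rewrite lt_def r0.
by rewrite divr_gt0// subr_gt0 expR_lt1 oppr_lt0.
Qed.

Lemma kern_le1 (r : R) : 0 <= r -> kern r <= 1.
Proof.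
rewrite /kern; case: eqVneq => // r0 rp.
have r1 : 0 < r by rewrite lt_def r0.
by rewrite ler_pdivrMr// mul1r; have := expR_ge1Dx (- r); lra.
Qed.

Lemma kern_leV (r : R) : 0 < r -> kern r <= r^-1.
Proof.
by move=> r0; rewrite /kern gt_eqF// ler_pdivrMr// mulVf ?gt_eqF// gerBl expR_ge0.
Qed.

(** Once [exp(-s)] is replaced by its lower bound [exp(-r) (1 - (s - r))] and denominators are
    cleared, there remains [(s - r) (1 - exp(-r) (1 + r)) >= 0]. *)
Lemma kern_ni (r s : R) : 0 <= r -> r <= s -> kern s <= kern r.
Proof.
move=> r0 rs; have [->|rn] := eqVneq r 0.
  by rewrite {2}/kern eqxx; apply: kern_le1; exact: le_trans rs.
have rp : 0 < r by rewrite lt_def rn.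
have sp : 0 < s by exact: lt_le_trans rs.
rewrite /kern !gt_eqF// ler_pdivrMr// mulrAC ler_pdivlMr//.
have a := expR_ge1Dx (- (s - r)); have b := expR_ge1Dx r.
have e0 := expR_gt0 (- r).
have E : expR (- s) = expR (- r) * expR (- (s - r)) by rewrite -expRD; congr expR; ring.
have F : expR (- r) * expR r = 1 by rewrite -expRD addNr expR0.
have c : expR (- r) * (1 - (s - r)) <= expR (- s).
  by rewrite E ler_pM2l//; move: a; clear; lra.
have d : expR (- r) * (1 + r) <= 1 by rewrite -[leRHS]F ler_pM2l.
move: (expR (- r)) (expR (- s)) c d e0 => p q c d e0.
have := ler_wpM2l r0 c; have : 0 <= s - r by lra.
by move=> sr; have := ler_wpM2l sr d; clear; nra.
Qed.

(* The square root is 0 on negative numbers, so that kq is nonincreasing on the whole line. *)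
Definition kq (s : R) : R := kern (Num.sqrt s).

Lemma kq_ge0 s : 0 <= kq s. Proof. by apply/ltW/kern_gt0/sqrtr_ge0. Qed.
Lemma kq_gt0 s : 0 < kq s. Proof. by apply/kern_gt0/sqrtr_ge0. Qed.
Lemma kq_le1 s : kq s <= 1. Proof. by apply/kern_le1/sqrtr_ge0. Qed.
Lemma kq_ni (s t : R) : s <= t -> kq t <= kq s.
Proof. by move=> st; apply: kern_ni; [exact: sqrtr_ge0|exact: ler_wsqrtr]. Qed.
Lemma kq_meas : measurable_fun setT kq.
Proof. by apply: nonincreasing_measurable => //; move=> s t; exact: kq_ni. Qed.

Lemma kq_sub_meas1 x : measurable_fun setT (fun y => kq (sq3 (sub3 x y))).
Proof.
apply: (measurableT_comp kq_meas); apply: (measurableT_comp (@measurable_sq3 R)).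
exact: measurable_sub3.
Qed.

Lemma kq_norm s : `|kq s| <= 1. Proof. by rewrite ger0_norm ?kq_ge0// kq_le1. Qed.

(** Real-valued form of [phiu], legitimate for square integrable [u] because the kernel is at most
    1. *)
Definition ph u x : R := rint leb (fun y => kq (sq3 (sub3 x y)) * u y ^+ 2).

Lemma ph_intble u x : l2 leb u -> intble leb (fun y => kq (sq3 (sub3 x y)) * u y ^+ 2).
Proof.
move=> lu; apply: (intble_mulb (M := 1)) (l2_sq lu); first exact: kq_sub_meas1.
by move=> y; exact: kq_norm.
Qed.

Lemma phE u x : l2 leb u -> phiu u x = (ph u x)%:E.
Proof. by move=> lu; rewrite /ph (rintE (ph_intble x lu)). Qed.

Lemma ph_ge0 u x : 0 <= ph u x.
Proof. by apply: rint_ge0 => y; rewrite mulr_ge0 ?kq_ge0 ?sqr_ge0. Qed.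

Lemma ph_le u x : l2 leb u -> ph u x <= n2 leb u.
Proof.
move=> lu; apply: rint_le; [exact: ph_intble|exact: l2_sq|].
by move=> y; rewrite ler_piMl ?sqr_ge0 ?kq_le1.
Qed.

Lemma ph_norm u x : l2 leb u -> `|ph u x| <= n2 leb u.
Proof. by move=> lu; rewrite ger0_norm ?ph_ge0// ph_le. Qed.

Lemma kq_pair_meas (f g : R3 -> R) : measurable_fun setT f -> measurable_fun setT g ->
  measurable_fun setT (fun z : R3 * R3 => (kq (sq3 (sub3 z.1 z.2)) * (f z.1 * g z.2))%:E).
Proof.
move=> mf mg; apply/measurable_EFinP; apply: measurable_funM.
  apply: (measurableT_comp kq_meas); apply: (measurableT_comp (@measurable_sq3 R)).
  exact: measurable_sub3.
apply: measurable_funM; first exact: (measurableT_comp mf measurable_fst).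
exact: (measurableT_comp mg measurable_snd).
Qed.

Lemma ph_meas u : l2 leb u -> measurable_fun setT (ph u).
Proof.
move=> lu; apply/measurable_EFinP.
have mu : measurable_fun setT (fun x => u x ^+ 2) by apply: measurable_funX; case: lu.
have m1 : measurable_fun setT (fun _ : R3 => 1 : R) by exact: measurable_cst.
have := tonelli_meas1 leb (kq_pair_meas m1 mu).
rewrite (_ : (fun x => _) = EFin \o ph u); last first.
  apply/funext => x; rewrite /= /ph (rintE (ph_intble x lu)).
  by apply: eq_integral => y _; rewrite /= mul1r.
by apply => z; rewrite lee_fin; apply: mulr_ge0; [exact: kq_ge0|rewrite mul1r; exact: sqr_ge0].
Qed.

Definition DD u : R := rint leb (fun x => ph u x * u x ^+ 2).

Lemma DD_intble u w : l2 leb u -> l2 leb w -> intble leb (fun x => ph u x * w x ^+ 2).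
Proof.
move=> lu lw; apply: (intble_mulb (M := n2 leb u)) (l2_sq lw); first exact: ph_meas.
by move=> y; exact: ph_norm.
Qed.

Lemma DDE u : l2 leb u -> phi_energy u = (DD u)%:E.
Proof.
move=> lu; rewrite /DD (rintE (DD_intble lu lu)) /phi_energy.
by apply: eq_integral => x _; rewrite (phE x lu).
Qed.

Lemma DD_ge0 u : 0 <= DD u.
Proof. by apply: rint_ge0 => x; rewrite mulr_ge0 ?ph_ge0 ?sqr_ge0. Qed.

Lemma DD_le u : l2 leb u -> DD u <= n2 leb u ^+ 2.
Proof.
move=> lu; rewrite expr2 -[X in _ * X]/(rint leb _) -(rintZ (n2 leb u) (l2_sq lu)).
apply: rint_le; [exact: DD_intble|exact: intbleZ (l2_sq lu)|].
by move=> x; rewrite ler_wpM2r ?sqr_ge0// ph_le.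
Qed.

Lemma eq_DD u w : (forall x, u x ^+ 2 = w x ^+ 2) -> DD u = DD w.
Proof.
move=> E; congr rint; apply/funext => x; rewrite E; congr (_ * _).
by congr rint; apply/funext => y; rewrite E.
Qed.

Lemma DDZ c u : l2 leb u -> DD (fun x => c * u x) = c ^+ 4 * DD u.
Proof.
move=> lu; rewrite /DD -(rintZ _ (DD_intble lu lu)); congr rint; apply/funext => x.
have -> : ph (fun x => c * u x) x = c ^+ 2 * ph u x.
  by rewrite /ph -(rintZ _ (ph_intble x lu)); congr rint; apply/funext => y; ring.
ring.
Qed.

(** One factor [u ^+ 2] is exchanged at a time. The kernel is at most 1, and the integral of
    [|u^2 - w^2|] is bounded by Cauchy-Schwarz. *)
Lemma DD_dist u w : l2 leb u -> l2 leb w ->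
  `|DD u - DD w| <= nrm leb (fun x => u x - w x) * nrm leb (fun x => u x + w x) * (n2 leb u + n2 leb w).
Proof.
move=> lu lw; have [di dl] := sqdiff lu lw.
set dlt := nrm leb _ * nrm leb _ in dl *.
have dp x : `|ph u x - ph w x| <= dlt.
  rewrite /ph -(rintB (ph_intble x lu) (ph_intble x lw)).
  have -> : (fun y => kq (sq3 (sub3 x y)) * u y ^+ 2 - kq (sq3 (sub3 x y)) * w y ^+ 2) =
     (fun y => kq (sq3 (sub3 x y)) * (u y ^+ 2 - w y ^+ 2)) by apply/funext => y; ring.
  have := rint_mulb (m := leb) (kq_sub_meas1 x) (fun y => kq_norm (sq3 (sub3 x y))) di.
  by move=> /le_trans; apply; rewrite mul1r.
have md : measurable_fun setT (fun x => ph u x - ph w x) by apply: measurable_funB; exact: ph_meas.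
have i1 := intble_mulb (m := leb) (ph_meas lu) (fun x => ph_norm x lu) di.
have i2 := intble_mulb (m := leb) md dp (l2_sq lw).
have b1 := rint_mulb (m := leb) (ph_meas lu) (fun x => ph_norm x lu) di.
have b2 := rint_mulb (m := leb) md dp (l2_sq lw).
have -> : DD u - DD w = rint leb (fun x => ph u x * (u x ^+ 2 - w x ^+ 2)) +
    rint leb (fun x => (ph u x - ph w x) * w x ^+ 2).
  rewrite -(rintD i1 i2) /DD -(rintB (DD_intble lu lu) (DD_intble lw lw)).
  by congr rint; apply/funext => x; ring.
have E : rint leb (fun x => `|w x ^+ 2|) = n2 leb w.
  by congr rint; apply/funext => x; rewrite ger0_norm ?sqr_ge0.
rewrite E in b2.
apply: le_trans (ler_normD _ _) _; apply: le_trans (lerD b1 b2) _.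
by have := ler_wpM2l (n2_ge0 leb u) dl; lra.
Qed.

Lemma DD_ae u w : l2 leb u -> l2 leb w -> {ae leb, forall x, u x = w x} -> DD u = DD w.
Proof.
move=> lu lw uw; have := DD_dist lu lw.
rewrite {1}/nrm (ae_n2B0 lu lw uw) sqrtr0.
by rewrite !mul0r normr_le0 subr_eq0 => /eqP.
Qed.

Lemma DD_cvg (us : nat -> R3 -> R) u : (forall n, l2 leb (us n)) -> l2 leb u ->
  (fun n => n2 leb (fun x => us n x - u x)) @ \oo --> (0 : R) ->
  (fun n => DD (us n)) @ \oo --> DD u.
Proof.
move=> lus lu cu; have cn := cvg_n2 lus lu cu; have cm := cvg_nrm lus lu cu.
have c0 : (fun n => nrm leb (fun x => us n x - u x)) @ \oo --> (0 : R).
  by rewrite -[X in _ --> X]sqrtr0; apply: continuous_cvg cu; exact: sqrt_continuous.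
have cb : (fun n => nrm leb (fun x => us n x - u x) * (nrm leb (us n) + nrm leb u) * (n2 leb (us n) + n2 leb u)) @ \oo --> (0 : R).
  rewrite -[X in _ --> X](mul0r (n2 leb u + n2 leb u)); apply: cvgM; last first.
    by apply: cvgD => //; exact: cvg_cst.
  rewrite -[X in _ --> X](mul0r (nrm leb u + nrm leb u)); apply: cvgM => //.
  by apply: cvgD => //; exact: cvg_cst.
apply/cvgrPdist_le => e e0; move/cvgrPdist_le: cb => /(_ e e0); apply: filterS => n.
rewrite sub0r normrN ger0_norm; last by rewrite !mulr_ge0 ?addr_ge0 ?nrm_ge0 ?n2_ge0.
apply: le_trans; rewrite distrC; apply: le_trans (DD_dist (lus n) lu) _.
by rewrite ler_wpM2r ?addr_ge0 ?n2_ge0// ler_wpM2l ?nrm_ge0//; exact: nrmD.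
Qed.

End Denergy.

(** * Double integrals with a kernel depending on the distance *)

Section mpres_intble.
Context d (T : measurableType d) (R : realType) (m : {measure set T -> \bar R}).

Lemma mpres_intble (t : T -> T) (f : T -> R) : mpres m t -> intble m f -> intble m (fun x => f (t x)).
Proof.
move=> ht fi; have mf := intble_meas fi; apply/integrableP; split.
  by apply/measurable_EFinP; exact: (measurableT_comp mf ht.1).
rewrite (mpres_int ht (f := fun x => `|(f x)%:E|%E)); first by case/integrableP: fi.
by apply: measurableT_comp => //; exact/measurable_EFinP.
Qed.

End mpres_intble.

Section mpres_prod.
Context d1 d2 (T1 : measurableType d1) (T2 : measurableType d2) (R : realType).
Variables (m1 : {sigma_finite_measure set T1 -> \bar R}) (m2 : {sigma_finite_measure set T2 -> \bar R}).

Lemma mpres_fst (t : T1 -> T1) : mpres m1 t -> mpres (sf_prod m1 m2) (fun z => (t z.1, z.2)).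
Proof.
move=> [mt Ht]; split.
  apply/measurable_fun_pairP; split; first exact: (measurableT_comp mt measurable_fst).
  exact: measurable_snd.
move=> f mf f0.
have mft : measurable_fun setT (fun z => f (t z.1, z.2)).
  apply: (measurableT_comp mf); apply/measurable_fun_pairP; split; last exact: measurable_snd.
  exact: (measurableT_comp mt measurable_fst).
rewrite (tonelli2 m1 m2 mft (fun z => f0 _)) (tonelli2 m1 m2 mf f0).
apply: eq_integral => y _; apply: (Ht (fun x => f (x, y))) => //.
by apply: (measurableT_comp mf); exact: measurable_pair2.
Qed.

Lemma mpres_snd (t : T2 -> T2) : mpres m2 t -> mpres (sf_prod m1 m2) (fun z => (z.1, t z.2)).
Proof.
move=> [mt Ht]; split.
  apply/measurable_fun_pairP; split; last exact: (measurableT_comp mt measurable_snd).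
  exact: measurable_fst.
move=> f mf f0.
have mft : measurable_fun setT (fun z => f (z.1, t z.2)).
  apply: (measurableT_comp mf); apply/measurable_fun_pairP; split; first exact: measurable_fst.
  exact: (measurableT_comp mt measurable_snd).
rewrite (tonelli1 m1 m2 mft (fun z => f0 _)) (tonelli1 m1 m2 mf f0).
apply: eq_integral => x _; apply: (Ht (fun y => f (x, y))) => //.
by apply: (measurableT_comp mf); exact: measurable_pair1.
Qed.

End mpres_prod.

(** Meant for double integrals [B] and [B'] not known to be finite: an equation with a finite total
    excludes the infinite values. *)
Lemma ereal_sum_le (R : realType) (e1 e2 c : R) (B B' : \bar R) :
  (e1%:E + 2%:E * B = c%:E)%E -> (e2%:E + 2%:E * B' = c%:E)%E -> (B <= B')%E -> e2 <= e1.
Proof.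
case: B B' => [p| |] [q| |] //=.
- by move=> [E1] [E2]; rewrite lee_fin => h; lra.
- by move=> _; rewrite mulry gtr0_sg// mul1e addey.
- by rewrite mulry gtr0_sg// mul1e addey.
- by rewrite mulrNy gtr0_sg// mul1e.
- by rewrite mulrNy gtr0_sg// mul1e.
- by rewrite mulrNy gtr0_sg// mul1e.
Qed.

Section BK.
Context {R : realType}.
Local Notation R3 := (R3 R).
Local Notation leb := (leb R).
Implicit Types (u v w f : R3 -> R) (x y h : R3) (kappa : R -> R).

(** The kernel takes the squared distance, a polynomial in the coordinates. Both [DD] and the cross
    term of [Enr] have this form, so that the single inequality [BK_pol] covers them. *)
Definition kfun kappa f (z : R3 * R3) : R := kappa (sq3 (sub3 z.1 z.2)) * (f z.1 * f z.2).
Definition BK kappa f : \bar R := (\int[sf_prod leb leb]_z (kfun kappa f z)%:E)%E.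

Lemma kfun_meas kappa f : measurable_fun setT kappa -> measurable_fun setT f ->
  measurable_fun setT (kfun kappa f).
Proof.
move=> mk mf; apply: measurable_funM.
  apply: (measurableT_comp mk); apply: (measurableT_comp (@measurable_sq3 R)).
  exact: measurable_sub3.
by apply: measurable_funM; [exact: (measurableT_comp mf measurable_fst)|exact: (measurableT_comp mf measurable_snd)].
Qed.

Lemma kfun_ge0 kappa f z : (forall r, 0 <= kappa r) -> (forall x, 0 <= f x) -> 0 <= kfun kappa f z.
Proof. by move=> k0 f0; apply: mulr_ge0 => //; exact: mulr_ge0. Qed.

Lemma DD_BK u : l2 leb u -> (DD u)%:E = BK (@kq R) (fun x => u x ^+ 2).
Proof.
move=> lu; have mu : measurable_fun setT (fun x => u x ^+ 2) by apply: measurable_funX; case: lu.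
have mk := kfun_meas (@kq_meas R) mu.
rewrite /BK (tonelli1 leb leb (f := fun z => (kfun (@kq R) (fun x => u x ^+ 2) z)%:E)).
- rewrite /DD (rintE (DD_intble lu lu)); apply: eq_integral => x _.
  rewrite mulrC EFinM /ph (rintE (ph_intble x lu)) -ge0_integralZl_EFin ?sqr_ge0//.
  + by apply: eq_integral => y _; rewrite -EFinM /kfun/= mulrCA.
  + by move=> y _; rewrite lee_fin mulr_ge0 ?kq_ge0 ?sqr_ge0.
  + by apply/measurable_EFinP; case/integrableP : (ph_intble x lu) => /measurable_EFinP.
- exact/measurable_EFinP.
- by move=> z; rewrite lee_fin; apply: kfun_ge0 => [r|x]; [exact: kq_ge0|exact: sqr_ge0].
Qed.

Definition kbt (t r : R) : R := (r <= t ^+ 2)%R%:R.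

Lemma kbt_ni t (r s : R) : r <= s -> kbt t s <= kbt t r.
Proof.
move=> rs; rewrite /kbt ler_nat; case: (boolP (s <= t ^+ 2)) => // st.
by rewrite (le_trans rs st).
Qed.

Lemma kbt_ge0 t r : 0 <= kbt t r. Proof. exact: ler0n. Qed.

Lemma kbt_meas t : measurable_fun setT (kbt t).
Proof. by apply: nonincreasing_measurable => //; move=> r s; exact: kbt_ni. Qed.

(** In the expansion of [(w x - w y)^2] each square contributes [vol t * n2 leb w] by Tonelli. The
    cross term is moved to the side of the energy, so that all integrands are nonnegative and no
    integrability has to be known beforehand. At fixed L2 norm, decreasing [Enr t] thus means
    increasing [BK]. *)
Lemma Enr_BK t w : 0 <= t -> l2 leb w -> (forall x, 0 <= w x) ->
  ((Enr t w)%:E + 2%:E * BK (kbt t) w = (2 * (vol t * n2 leb w))%:E)%E.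
Proof.
move=> t0 lw w0; have mw : measurable_fun setT w by case: lw.
pose P := sf_prod leb leb.
have mk z : kbt t (sq3 (sub3 z.1 z.2)) = bt t (sub3 z.1 z.2) by [].
have mb : measurable_fun setT (fun z : R3 * R3 => bt t (sub3 z.1 z.2)).
  by apply: (measurableT_comp (bt_meas t)); exact: measurable_sub3.
have mw1 : measurable_fun setT (fun z : R3 * R3 => w z.1) by exact: (measurableT_comp mw measurable_fst).
have mw2 : measurable_fun setT (fun z : R3 * R3 => w z.2) by exact: (measurableT_comp mw measurable_snd).
have mE : measurable_fun setT (fun z : R3 * R3 => (bt t (sub3 z.1 z.2) * (w z.1 - w z.2) ^+ 2)%:E).
  by apply/measurable_EFinP; apply: measurable_funM => //; apply: measurable_funX; exact: measurable_funB.
have mK : measurable_fun setT (fun z => (kfun (kbt t) w z)%:E).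
  by apply/measurable_EFinP; apply: kfun_meas => //; exact: kbt_meas.
have m1 : measurable_fun setT (fun z : R3 * R3 => (bt t (sub3 z.1 z.2) * w z.1 ^+ 2)%:E).
  by apply/measurable_EFinP; apply: measurable_funM => //; exact: measurable_funX.
have m2' : measurable_fun setT (fun z : R3 * R3 => (bt t (sub3 z.1 z.2) * w z.2 ^+ 2)%:E).
  by apply/measurable_EFinP; apply: measurable_funM => //; exact: measurable_funX.
have p1 (z : R3 * R3) : (0 <= (bt t (sub3 z.1 z.2) * w z.1 ^+ 2)%:E)%E.
  by rewrite lee_fin mulr_ge0 ?bt_ge0 ?sqr_ge0.
have p2 (z : R3 * R3) : (0 <= (bt t (sub3 z.1 z.2) * w z.2 ^+ 2)%:E)%E.
  by rewrite lee_fin mulr_ge0 ?bt_ge0 ?sqr_ge0.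
have pE (z : R3 * R3) : (0 <= (bt t (sub3 z.1 z.2) * (w z.1 - w z.2) ^+ 2)%:E)%E.
  by rewrite lee_fin mulr_ge0 ?bt_ge0 ?sqr_ge0.
have pK z : (0 <= (kfun (kbt t) w z)%:E)%E by rewrite lee_fin; apply: kfun_ge0 => // r; exact: kbt_ge0.
have volx x : (\int[leb]_y (bt t (sub3 y x))%:E = (vol t)%:E)%E.
  rewrite /vol (rintE (bt_int t0)); have [_ <-] := mpres_shift (opp3 x).
  - by apply: eq_integral => y _.
  - by apply/measurable_EFinP; exact: bt_meas.
  - by move=> y; rewrite lee_fin bt_ge0.
have btC x y : bt t (sub3 x y) = bt t (sub3 y x).
  by rewrite /bt /sq3 /sub3/=; congr ((_ <= _)%R%:R); ring.
have mbx x : measurable_fun setT (fun y => bt t (sub3 y x)).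
  by apply: (measurableT_comp (bt_meas t)); exact: measurable_sub3.
have W (p : R3 -> R3 -> R) : (forall x y, p x y = bt t (sub3 y x)) ->
    (\int[leb]_x \int[leb]_y (p x y * w x ^+ 2)%:E = (vol t * n2 leb w)%:E)%E.
  move=> E; rewrite EFinM (n2E lw) -ge0_integralZl_EFin.
  - apply: eq_integral => x _; rewrite muleC -(volx x) -ge0_integralZl_EFin ?sqr_ge0//.
    + by apply: eq_integral => y _; rewrite -EFinM E mulrC.
    + by move=> y _; rewrite lee_fin bt_ge0.
    + by apply/measurable_EFinP; exact: mbx.
  - by [].
  - by move=> x _; rewrite lee_fin sqr_ge0.
  - by apply/measurable_EFinP; exact: measurable_funX.
  - by apply: rint_ge0 => x; exact: bt_ge0.
have I1 : (\int[P]_z (bt t (sub3 z.1 z.2) * w z.1 ^+ 2)%:E = (vol t * n2 leb w)%:E)%E.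
  by rewrite (tonelli1 leb leb m1 p1); apply: (W (fun x y => bt t (sub3 x y))) => x y; exact: btC.
have I2 : (\int[P]_z (bt t (sub3 z.1 z.2) * w z.2 ^+ 2)%:E = (vol t * n2 leb w)%:E)%E.
  by rewrite (tonelli2 leb leb m2' p2); apply: (W (fun x y => bt t (sub3 y x))).
have IE : (\int[P]_z (bt t (sub3 z.1 z.2) * (w z.1 - w z.2) ^+ 2)%:E = (Enr t w)%:E)%E.
  by rewrite (tonelli1 leb leb mE pE) -(EnE t0 lw).
rewrite -IE /BK -ge0_integralZl_EFin//.
rewrite -ge0_integralD//; [|by move=> z _; apply: mule_ge0|by apply: emeasurable_funM].
transitivity (\int[P]_z ((bt t (sub3 z.1 z.2) * w z.1 ^+ 2)%:E + (bt t (sub3 z.1 z.2) * w z.2 ^+ 2)%:E))%E.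
  by apply: eq_integral => z _; rewrite -EFinM -!EFinD /kfun mk; congr EFin; ring.
by rewrite ge0_integralD// I1 I2 -EFinD; congr EFin; ring.
Qed.

End BK.

(** * Polarisation across a plane that avoids the origin *)

Section polarization.
Context {R : realType}.
Local Notation R3 := (R3 R).
Local Notation leb := (leb R).
Variables a b s : R.
Hypothesis s0 : s != 0.
Local Notation sg := (refl a b s).
Local Notation l := (refl_l a b s).
Local Notation c := (refl_k a b).
Implicit Types (u v w f : R3 -> R) (x y h : R3) (kappa : R -> R).

Lemma refl_k_gt0 : 0 < c.
Proof. by rewrite divr_gt0//; have := sqr_ge0 a; have := sqr_ge0 b; lra. Qed.

Lemma refl_kE : c * (a ^+ 2 + b ^+ 2 + 1) = 2.
Proof. by rewrite /refl_k divfK// refl_n0. Qed.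

(** The sign of [l x * s] tells which of [x] and its image is nearer to the origin: it is [x] when
    the product is negative. *)
Lemma sq3_refl x : sq3 (sg x) = sq3 x - 2 * c * (l x * s).
Proof.
have -> : sq3 (sg x) = sq3 x - 2 * c * l x * (l x + s) + c * l x ^+ 2 * (c * (a ^+ 2 + b ^+ 2 + 1)).
  by rewrite /sq3 /refl /refl_l/=; ring.
by rewrite refl_kE; ring.
Qed.

(** As [c] is positive, two points on the same side of the mirror are nearer to each other than to
    each other's images. *)
Lemma sq3_sub_refl x y : sq3 (sub3 x (sg y)) = sq3 (sub3 x y) + 2 * c * (l x * l y).
Proof.
have -> : sq3 (sub3 x (sg y)) = sq3 (sub3 x y) + 2 * c * l y * (l x - l y) +
    c * l y ^+ 2 * (c * (a ^+ 2 + b ^+ 2 + 1)).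
  by rewrite /sq3 /sub3 /refl /refl_l/=; ring.
by rewrite refl_kE; ring.
Qed.

Lemma sub3C x y : sq3 (sub3 x y) = sq3 (sub3 y x).
Proof. by rewrite /sq3 /sub3/=; ring. Qed.

Lemma sq3_refl_sub x y : sq3 (sub3 (sg x) y) = sq3 (sub3 x y) + 2 * c * (l x * l y).
Proof. by rewrite sub3C sq3_sub_refl sub3C [l y * _]mulrC. Qed.

Lemma sq3_refl_refl x y : sq3 (sub3 (sg x) (sg y)) = sq3 (sub3 x y).
Proof. by rewrite sq3_sub_refl sq3_refl_sub refl_lK; ring. Qed.

(* As refl_l vanishes on the mirror and takes the value - s at 0, the half-space
   refl_l x * s <= 0 is the one that contains the origin. *)
Definition pol u x : R := if l x * s <= 0 then Num.max (u x) (u (sg x)) else Num.min (u x) (u (sg x)).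
Definition side x : R := if l x * s <= 0 then 1 else -1.

Lemma refl_fix x : l x = 0 -> sg x = x.
Proof. by move=> E; rewrite /refl E !mulr0 !mul0r !subr0; case: x E => [[]]. Qed.

(** The integral inequalities below use polarisation only through these two identities. The
    assumption that [s] is nonzero serves on the mirror: it turns [l x * s = 0] into [l x = 0], so
    that [x] is its own image. *)
Lemma pol_eqs u x : pol u x + pol u (sg x) = u x + u (sg x) /\
  pol u x - pol u (sg x) = side x * `|u x - u (sg x)|.
Proof.
rewrite /pol /side refl_lK reflK mulNr oppr_le0.
have [h|h|h] := ltgtP (l x * s) 0.
- rewrite maxC minEle maxEle; case: (leP (u (sg x)) (u x)) => k.
    by rewrite ger0_norm ?subr_ge0// mul1r; split; ring.
  by rewrite ltr0_norm ?subr_lt0// mul1r; split; ring.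
- rewrite [Num.max (u (sg x)) _]maxC minEle maxEle; case: (leP (u x) (u (sg x))) => k.
    by rewrite ler0_norm ?subr_le0//; split; ring.
  by rewrite gtr0_norm ?subr_gt0//; split; ring.
- have /refl_fix -> : l x = 0 by move/eqP: h; rewrite mulf_eq0 (negbTE s0) orbF => /eqP.
  by rewrite maxxx subrr normr0 mulr0; split; ring.
Qed.

Lemma measurable_side : measurable_fun setT (fun x => l x * s <= 0).
Proof.
apply: measurable_fun_ler => //; apply: measurable_funM => //; apply: measurable_funB => //.
apply: measurable_funD; last exact: m2.
by apply: measurable_funD; apply: measurable_funM => //; [exact: m11|exact: m12].
Qed.

Lemma pol_meas u : measurable_fun setT u -> measurable_fun setT (pol u).
Proof.
move=> mu; have ms := mpres_meas (mpres_refl a b s) mu.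
apply: measurable_fun_ifT; first exact: measurable_side.
  exact: measurable_maxr.
exact: measurable_minr.
Qed.

Lemma pol_ge0 u x : (forall x, 0 <= u x) -> 0 <= pol u x.
Proof. by move=> u0; rewrite /pol; case: ifP => _; rewrite ?le_max ?le_min !u0. Qed.

Lemma pol_sqr u x : (forall x, 0 <= u x) -> pol u x ^+ 2 = pol (fun x => u x ^+ 2) x.
Proof.
move=> u0; rewrite /pol; have H p q : (u p ^+ 2 <= u q ^+ 2) = (u p <= u q).
  by rewrite ler_pXn2r ?nnegrE.
by rewrite !maxEle !minEle H; case: ifP; case: ifP.
Qed.

Lemma pol_le u x : `|pol u x| <= `|u x| + `|u (sg x)|.
Proof.
have := normr_ge0 (u x); have := normr_ge0 (u (sg x)).
by rewrite /pol maxEle minEle; case: ifP; case: ifP => _ _; lra.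
Qed.

Lemma pol_intble f : intble leb f -> intble leb (pol f).
Proof.
move=> fi; have mf := intble_meas fi.
have fs := mpres_intble (mpres_refl a b s) fi.
apply: intble_le (intbleD (intble_norm fi) (intble_norm fs)); first exact: pol_meas.
by move=> x; exact: pol_le.
Qed.

Lemma rint_pol f : intble leb f -> rint leb (pol f) = rint leb f.
Proof.
move=> fi; have pi := pol_intble fi.
have mf := intble_meas fi; have mp := intble_meas pi.
have S g := @mpres_intble _ _ _ leb _ g (mpres_refl a b s).
have E : rint leb (fun x => pol f x + pol f (sg x)) = rint leb (fun x => f x + f (sg x)).
  by congr rint; apply/funext => x; have [-> _] := pol_eqs f x.
move: E; rewrite (rintD pi (S _ pi)) (rintD fi (S _ fi)).
rewrite (mpres_rint (mpres_refl a b s) mp) (mpres_rint (mpres_refl a b s) mf).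
by move: (rint leb (pol f)) (rint leb f) => *; lra.
Qed.

Lemma pol_l2 w : l2 leb w -> (forall x, 0 <= w x) ->
  l2 leb (pol w) /\ n2 leb (pol w) = n2 leb w.
Proof.
move=> lw w0; have E : (fun x => pol w x ^+ 2) = pol (fun x => w x ^+ 2).
  by apply/funext => x; exact: pol_sqr.
split; last by rewrite /n2 E rint_pol//; exact: l2_sq.
apply: l2P; first by apply: pol_meas; case: lw.
by rewrite E; apply: pol_intble; exact: l2_sq.
Qed.

(** Summing the integrand over the four pairs made of [x], [y] and their images leaves two terms.
    One contains the sums over mirror pairs, which [pol] keeps. The other is [kappa r - kappa q]
    times a product of differences, which [pol] replaces by its absolute value, because
    [kappa r - kappa q] has the sign of [side x * side y]. *)
Lemma BK_pol kappa f : measurable_fun setT kappa -> (forall r, 0 <= kappa r) ->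
  (forall r q, r <= q -> kappa q <= kappa r) ->
  measurable_fun setT f -> (forall x, 0 <= f x) -> (BK kappa f <= BK kappa (pol f))%E.
Proof.
move=> mk k0 kni mf f0; pose P := sf_prod leb leb.
have h1 : mpres P (fun z => (sg z.1, z.2)) := mpres_fst leb (mpres_refl a b s).
have h2 : mpres P (fun z => (z.1, sg z.2)) := mpres_snd leb (mpres_refl a b s).
(* Four times the integrals are compared, and nothing is subtracted, since they may be infinite. *)
have S (G : R3 * R3 -> R) : measurable_fun setT G -> (forall z, 0 <= G z) ->
   (4%:E * \int[P]_z (G z)%:E = \int[P]_z (G z + G (sg z.1, z.2) + (G (z.1, sg z.2) + G (sg z.1, sg z.2)))%:E)%E.
  move=> mG G0.
  have mG1 := mpres_meas h1 mG; have mG2 := mpres_meas h2 mG; have mG3 := mpres_meas h1 mG2.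
  have n0 (t : R3 * R3 -> R3 * R3) z : (0 <= (G (t z))%:E)%E by rewrite lee_fin.
  have E1 : (\int[P]_z (G (sg z.1, z.2))%:E = \int[P]_z (G z)%:E)%E.
    by apply: (mpres_int h1 (f := fun z => (G z)%:E)); exact/measurable_EFinP.
  have E2 : (\int[P]_z (G (z.1, sg z.2))%:E = \int[P]_z (G z)%:E)%E.
    by apply: (mpres_int h2 (f := fun z => (G z)%:E)); exact/measurable_EFinP.
  have E3 : (\int[P]_z (G (sg z.1, sg z.2))%:E = \int[P]_z (G (z.1, sg z.2))%:E)%E.
    by apply: (mpres_int h1 (f := fun z => (G (z.1, sg z.2))%:E)); exact/measurable_EFinP.
  under [RHS]eq_integral do rewrite !EFinD.
  have a0 z : (0 <= (G z)%:E)%E by rewrite lee_fin.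
  have a1 z : (0 <= (G (sg z.1, z.2))%:E)%E by rewrite lee_fin.
  have a2 z : (0 <= (G (z.1, sg z.2))%:E)%E by rewrite lee_fin.
  have a3 z : (0 <= (G (sg z.1, sg z.2))%:E)%E by rewrite lee_fin.
  have b0 : measurable_fun setT (fun z => (G z)%:E) by exact/measurable_EFinP.
  have b1 : measurable_fun setT (fun z => (G (sg z.1, z.2))%:E) by exact/measurable_EFinP.
  have b2 : measurable_fun setT (fun z => (G (z.1, sg z.2))%:E) by exact/measurable_EFinP.
  have b3 : measurable_fun setT (fun z => (G (sg z.1, sg z.2))%:E) by exact/measurable_EFinP.
  have L1 : (\int[P]_z ((G z)%:E + (G (sg z.1, z.2))%:E) = \int[P]_z (G z)%:E + \int[P]_z (G (sg z.1, z.2))%:E)%E.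
    exact: ge0_integralD.
  have L2 : (\int[P]_z ((G (z.1, sg z.2))%:E + (G (sg z.1, sg z.2))%:E) =
      \int[P]_z (G (z.1, sg z.2))%:E + \int[P]_z (G (sg z.1, sg z.2))%:E)%E.
    exact: ge0_integralD.
  rewrite ge0_integralD//; [rewrite L1 L2|by move=> z _; apply: adde_ge0|by apply: emeasurable_funD|by move=> z _; apply: adde_ge0|by apply: emeasurable_funD].
  rewrite E1 E3 E2 (mule_natl _ 4); move: (\int[P]_z (G z)%:E)%E => A.
  by transitivity (A + (A + (A + A)))%E; [by []|rewrite !addeA].
have mpf := pol_meas mf; have pf0 x := pol_ge0 x f0.
have mF := kfun_meas mk mf; have mF' := kfun_meas mk mpf.
have F0 z : 0 <= kfun kappa f z by exact: kfun_ge0.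
have F0' z : 0 <= kfun kappa (pol f) z by exact: kfun_ge0.
have four : (0 < 4%:E :> \bar R)%E by rewrite lte_fin.
rewrite -(lee_pmul2l _ four)// /BK S// (S _ mF' F0').
apply: ge0_le_integral => //.
- by move=> z _; rewrite lee_fin !addr_ge0.
- apply/measurable_EFinP; have m1 := mpres_meas h1 mF; have m2' := mpres_meas h2 mF.
  have m3 := mpres_meas h1 m2'.
  by apply: measurable_funD; apply: measurable_funD.
- apply/measurable_EFinP; have m1 := mpres_meas h1 mF'; have m2' := mpres_meas h2 mF'.
  have m3 := mpres_meas h1 m2'.
  by apply: measurable_funD; apply: measurable_funD.
move=> [x y] _; rewrite lee_fin /kfun/= sq3_sub_refl sq3_refl_sub sq3_refl_refl.
have [px dx] := pol_eqs f x; have [py dy] := pol_eqs f y.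
set r := sq3 _; set q := r + _.
have key : `|(kappa r - kappa q)| = (kappa r - kappa q) * (side x * side y).
  have c2 : 0 <= 2 * c by rewrite mulr_ge0// ltW// refl_k_gt0.
  have ss : 0 < s ^+ 2 by rewrite exprn_even_gt0.
  (* Multiplying by [s ^+ 2 > 0] expresses the sign of [l x * l y] by the products [l x * s] and
     [l y * s] that define [side]. *)
  have E : 2 * c * (l x * l y) * s ^+ 2 = 2 * c * ((l x * s) * (l y * s)) by ring.
  rewrite /side; case: (leP (l x * s) 0) => hx; case: (leP (l y * s) 0) => hy;
    rewrite ?mulr1 ?mul1r ?mulrNN ?mulr1 ?mulrN1.
  - rewrite ger0_norm// subr_ge0 kni// /q lerDl -(pmulr_lge0 _ ss) E.
    by apply: mulr_ge0 c2 _; exact: mulr_le0.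
  - rewrite ler0_norm// subr_le0 kni// /q gerDl -(pmulr_lle0 _ ss) E.
    by apply: mulr_ge0_le0 c2 _; exact: mulr_le0_ge0 hx (ltW hy).
  - rewrite ler0_norm// subr_le0 kni// /q gerDl -(pmulr_lle0 _ ss) E.
    by apply: mulr_ge0_le0 c2 _; exact: mulr_ge0_le0 (ltW hx) hy.
  - rewrite ger0_norm// subr_ge0 kni// /q lerDl -(pmulr_lge0 _ ss) E.
    by apply: mulr_ge0 c2 _; exact: mulr_ge0 (ltW hx) (ltW hy).
have main : (kappa r - kappa q) * ((f x - f (sg x)) * (f y - f (sg y))) <=
    (kappa r - kappa q) * ((pol f x - pol f (sg x)) * (pol f y - pol f (sg y))).
  rewrite dx dy; apply: le_trans (ler_norm _) _; rewrite !normrM key.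
  by rewrite le_eqVlt; apply/orP; left; apply/eqP; ring.
have split4 (p p' z z' k1 k2 : R) : k1 * (p * z) + k2 * (p' * z) + (k2 * (p * z') + k1 * (p' * z')) =
    ((k1 + k2) * ((p + p') * (z + z')) + (k1 - k2) * ((p - p') * (z - z'))) / 2 by field.
by rewrite !split4 px py ler_pM2r ?invr_gt0// lerD2l.
Qed.

Lemma pol_Enr t w : 0 <= t -> l2 leb w -> (forall x, 0 <= w x) -> Enr t (pol w) <= Enr t w.
Proof.
move=> t0 lw w0; have [lp np] := pol_l2 lw w0; have p0 x := pol_ge0 x w0.
have mw : measurable_fun setT w by case: lw.
apply: (@ereal_sum_le _ _ _ (2 * (vol t * n2 leb w)) (BK (kbt t) w) (BK (kbt t) (pol w))).
- exact: Enr_BK.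
- by rewrite -np; exact: Enr_BK.
- exact: BK_pol (kbt_meas t) (kbt_ge0 t) (@kbt_ni _ t) mw w0.
Qed.

Lemma pol_DD w : l2 leb w -> (forall x, 0 <= w x) -> DD w <= DD (pol w).
Proof.
move=> lw w0; have [lp np] := pol_l2 lw w0.
rewrite -lee_fin (DD_BK lw) (DD_BK lp).
have -> : (fun x => pol w x ^+ 2) = pol (fun x => w x ^+ 2) by apply/funext => x; exact: pol_sqr.
apply: BK_pol; [exact: kq_meas|exact: kq_ge0|exact: kq_ni| |by move=> x; exact: sqr_ge0].
by apply: measurable_funX; case: lw.
Qed.

Definition gw (gamma : R -> R) f : R := rint leb (fun x => gamma (sq3 x) * f x).

Lemma gamma_meas (gamma : R -> R) : (forall r q, r <= q -> gamma q <= gamma r) ->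
  measurable_fun setT (fun x : R3 => gamma (sq3 x)).
Proof.
move=> gni; apply: (measurableT_comp _ (@measurable_sq3 R)).
by apply: nonincreasing_measurable => // r q; exact: gni.
Qed.

(** Pairing each point with its image writes twice the gain of weighted mass as the integral of a
    nonnegative function: the nearer point of a pair has the larger weight and receives the larger
    value. Monotonicity and the case of equality are both read off it. *)
Lemma pol_gw_gap (gamma : R -> R) f : (forall r q, r <= q -> gamma q <= gamma r) ->
  (forall r, 0 <= gamma r <= 1) -> intble leb f ->
  exists g, [/\ intble leb g, forall x, g x = (gamma (sq3 x) - gamma (sq3 (sg x))) *
     (side x * `|f x - f (sg x)| - (f x - f (sg x))) / 2, forall x, 0 <= g x &
     rint leb g = 2 * (gw gamma (pol f) - gw gamma f)].
Proof.
move=> gni g01 fi; have pi := pol_intble fi; have hs := mpres_refl a b s.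
have mg := gamma_meas gni.
have gn x : `|gamma (sq3 x)| <= 1 by rewrite ger0_norm; case/andP: (g01 (sq3 x)).
have i1 := intble_mulb (m := leb) mg gn pi; have i2 := intble_mulb (m := leb) mg gn fi.
have j1 := mpres_intble hs i1; have j2 := mpres_intble hs i2.
pose g x := (gamma (sq3 x) * pol f x - gamma (sq3 x) * f x) +
   (gamma (sq3 (sg x)) * pol f (sg x) - gamma (sq3 (sg x)) * f (sg x)).
have gE x : g x = (gamma (sq3 x) - gamma (sq3 (sg x))) *
     (side x * `|f x - f (sg x)| - (f x - f (sg x))) / 2.
  rewrite /g; have [E <-] := pol_eqs f x.
  have -> : f (sg x) = pol f x + pol f (sg x) - f x by rewrite E; ring.
  by field.
exists g; split=> //.
- exact: intbleD (intbleB i1 i2) (intbleB j1 j2).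
- move=> x; rewrite gE sq3_refl; apply: mulr_ge0; last by rewrite invr_ge0.
  have c2 : 0 <= 2 * c by rewrite mulr_ge0// ltW// refl_k_gt0.
  rewrite /side; case: (leP (l x * s) 0) => h.
    rewrite mul1r; apply: mulr_ge0; last by rewrite subr_ge0 ler_norm.
    by rewrite subr_ge0 gni// lerDl oppr_ge0; exact: mulr_ge0_le0.
  rewrite mulN1r; apply: mulr_le0.
    by rewrite subr_le0 gni// gerDl oppr_le0; apply: mulr_ge0 => //; exact: ltW.
  by rewrite subr_le0 lerNl -normrN ler_norm.
- rewrite (rintD (intbleB i1 i2) (intbleB j1 j2)) (rintB i1 i2) (rintB j1 j2).
  rewrite (mpres_rint hs (intble_meas i1)) (mpres_rint hs (intble_meas i2)) /gw.
  by move: (rint _ _) (rint _ _) => p q; ring.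
Qed.

Lemma pol_gw (gamma : R -> R) f : (forall r q, r <= q -> gamma q <= gamma r) ->
  (forall r, 0 <= gamma r <= 1) -> intble leb f -> gw gamma f <= gw gamma (pol f).
Proof.
move=> gni g01 fi; have [g [_ _ g0 gE]] := pol_gw_gap gni g01 fi.
by have := rint_ge0 leb g0; rewrite gE pmulr_rge0// subr_ge0.
Qed.

(** The gap function vanishes almost everywhere. If its weight factor is zero, strictness of [gamma]
    puts [x] on the mirror, as [s] is nonzero; otherwise [f] and [pol f] have the same difference
    over the mirror pair, and they always have the same sum. *)
Lemma pol_gw_eq (gamma : R -> R) f : (forall r q, r <= q -> gamma q <= gamma r) ->
  (forall r q, 0 <= r -> r < q -> gamma q < gamma r) ->
  (forall r, 0 <= gamma r <= 1) -> intble leb f -> gw gamma (pol f) <= gw gamma f ->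
  {ae leb, forall x, pol f x = f x}.
Proof.
move=> gni gst g01 fi le; have [g [gi gE g0 rE]] := pol_gw_gap gni g01 fi.
have r0 : rint leb g = 0.
  by apply/eqP; rewrite eq_le rint_ge0// rE pmulr_rle0// subr_le0 le.
have := rint_eq0 gi g0 r0; apply: ae_imp => x; rewrite gE => /eqP.
have [E <-] := pol_eqs f x.
rewrite mulf_eq0 invr_eq0 pnatr_eq0 orbF mulf_eq0 !subr_eq0 => /orP[/eqP k|/eqP k]; last first.
  by move: E k; move: (pol f x) (pol f (sg x)) => p q *; lra.
have l0 : l x = 0.
  have c0 := refl_k_gt0; apply/eqP; rewrite -(mulIr_eq0 _ (mulIf s0)).
  have E' := sq3_refl x.
  have [h|h|h] := ltgtP (sq3 x) (sq3 (sg x)).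
  - by have := gst _ _ (sq3_ge0 x) h; rewrite k ltxx.
  - by have := gst _ _ (sq3_ge0 _) h; rewrite k ltxx.
  - move: E'; rewrite -h => E'; have c2 : 2 * c != 0 by rewrite gt_eqF// mulr_gt0.
    by apply/eqP/(mulfI c2); rewrite mulr0; move: E'; clear; lra.
by rewrite /pol l0 mul0r lexx (refl_fix l0) maxxx.
Qed.

End polarization.

(** * A maximiser in the class of rearrangements *)

Section symmetrization.
Context {R : realType}.
Local Notation R3 := (R3 R).
Local Notation leb := (leb R).
Implicit Types (u v w f : R3 -> R) (x y h : R3).

Lemma le_cvg (a : nat -> R) (l c : R) : a @ \oo --> l -> (forall n, c <= a n) -> c <= l.
Proof. by move=> al H; apply: (cvgr_to_ge al); exact: nearW. Qed.

Lemma cvg_le (a : nat -> R) (l c : R) : a @ \oo --> l -> (forall n, a n <= c) -> l <= c.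
Proof. by move=> al H; apply: (cvgr_to_le al); exact: nearW. Qed.

Lemma cvg_of_sqbound (Phi : (R3 -> R) -> R) (C : R) (us : nat -> R3 -> R) u : 0 <= C ->
  (forall u w, l2 leb u -> l2 leb w ->
    `|Phi u - Phi w| <= C * (nrm leb (fun x => u x - w x) * (nrm leb u + nrm leb w))) ->
  (forall n, l2 leb (us n)) -> l2 leb u ->
  (fun n => n2 leb (fun x => us n x - u x)) @ \oo --> (0 : R) ->
  (fun n => Phi (us n)) @ \oo --> Phi u.
Proof.
move=> C0 H lus lu cu; have cm := cvg_nrm lus lu cu.
have c0 : (fun n => nrm leb (fun x => us n x - u x)) @ \oo --> (0 : R).
  by rewrite -[X in _ --> X]sqrtr0; apply: continuous_cvg cu; exact: sqrt_continuous.
have cb : (fun n => C * (nrm leb (fun x => us n x - u x) * (nrm leb (us n) + nrm leb u))) @ \oo --> (0 : R).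
  rewrite -[X in _ --> X](mulr0 C); apply: cvgMr.
  rewrite -[X in _ --> X](mul0r (nrm leb u + nrm leb u)); apply: cvgM => //.
  by apply: cvgD => //; exact: cvg_cst.
apply/cvgrPdist_le => e e0; move/cvgrPdist_le: cb => /(_ e e0); apply: filterS => n.
rewrite sub0r normrN ger0_norm; last by rewrite !mulr_ge0 ?addr_ge0 ?nrm_ge0.
by apply: le_trans; rewrite distrC; exact: H.
Qed.

Lemma gw_dist (gamma : R -> R) u w : (forall r q, r <= q -> gamma q <= gamma r) ->
  (forall r, 0 <= gamma r <= 1) -> l2 leb u -> l2 leb w ->
  `|gw gamma (fun x => u x ^+ 2) - gw gamma (fun x => w x ^+ 2)| <=
    1 * (nrm leb (fun x => u x - w x) * (nrm leb u + nrm leb w)).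
Proof.
move=> gni g01 lu lw; have [di dl] := sqdiff lu lw.
have mg := gamma_meas gni.
have gn x : `|gamma (sq3 x)| <= 1 by rewrite ger0_norm; case/andP: (g01 (sq3 x)).
have i1 := intble_mulb (m := leb) mg gn (l2_sq lu); have i2 := intble_mulb (m := leb) mg gn (l2_sq lw).
rewrite /gw -(rintB i1 i2).
have -> : (fun x => gamma (sq3 x) * u x ^+ 2 - gamma (sq3 x) * w x ^+ 2) =
   (fun x => gamma (sq3 x) * (u x ^+ 2 - w x ^+ 2)) by apply/funext => x; ring.
apply: le_trans (rint_mulb (m := leb) mg gn di) _; rewrite !mul1r; apply: le_trans dl _.
by rewrite ler_wpM2l ?nrm_ge0//; exact: nrmD.
Qed.

Lemma Enr_dist (t : R) u w : 0 <= t -> l2 leb u -> l2 leb w ->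
  `|Enr t u - Enr t w| <= (4 * vol t) * (nrm leb (fun x => u x - w x) * (nrm leb u + nrm leb w)).
Proof.
move=> t0 lu lw; have i1 := dn_int t0 lu; have i2 := dn_int t0 lw.
set N := nrm leb _ * _.
have D h : `|dn u h - dn w h| <= 4 * N.
  have du := dn_l2 h lu; have dw := dn_l2 h lw.
  have [di dl] := sqdiff du dw.
  rewrite /dn /n2 -(rintB (l2_sq du) (l2_sq dw)).
  apply: le_trans (rint_norm di) _; apply: le_trans dl _.
  have A (z : R3 -> R) : l2 leb z -> nrm leb (fun x => tau h z x - z x) <= 2 * nrm leb z.
    by move=> lz; have := nrmB (tau_l2 h lz) lz; rewrite (tau_nrm h lz); lra.
  have a1 := A _ (l2B lu lw); have a2 := A _ (l2D lu lw).
  have -> : (fun x => tau h u x - u x - (tau h w x - w x)) =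
     (fun x => tau h (fun x => u x - w x) x - (u x - w x)) by apply/funext => x; rewrite /tau; ring.
  have -> : (fun x => tau h u x - u x + (tau h w x - w x)) =
     (fun x => tau h (fun x => u x + w x) x - (u x + w x)) by apply/funext => x; rewrite /tau; ring.
  have := ler_pM (nrm_ge0 _ _) (nrm_ge0 _ _) a1 a2 => /le_trans; apply.
  have := nrmD lu lw; have := nrm_ge0 leb (fun x => u x - w x); rewrite /N; clear.
  move: (nrm leb (fun x => u x - w x)) (nrm leb (fun x => u x + w x)) (nrm _ _ + _) => p q r p0 qr; have := ler_wpM2l p0 qr; lra.
rewrite /Enr -(rintB i1 i2).
have ib : intble leb (fun h => 4 * N * bt t h) by apply: intbleZ; exact: bt_int.
have ->: 4 * vol t * N = rint leb (fun h => 4 * N * bt t h).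
  by rewrite (rintZ _ (bt_int t0)) /vol; ring.
have i3 := intbleB i1 i2.
apply: le_trans (rint_norm i3) _; apply: rint_le => //; first exact: intble_norm.
move=> h; rewrite -mulrBr normrM ger0_norm ?bt_ge0// mulrC; apply: ler_wpM2r => //.
Qed.

(** Strictly decreasing on the nonnegative reals, as [pol_gw_eq] asks, and constant on the negative
    ones, so as to be monotone on the whole line with values in [[0, 1]]. *)
Definition gam0 (r : R) : R := (1 + Num.max 0 r)^-1.

Lemma gam0_ni r q : r <= q -> gam0 q <= gam0 r.
Proof.
move=> rq; have a : 0 <= Num.max 0 r by rewrite le_max lexx.
have b : Num.max 0 r <= Num.max 0 q by rewrite ge_max !le_max lexx rq !orbT.
by rewrite /gam0 lef_pV2 ?posrE; lra.
Qed.

Lemma gam0_st r q : 0 <= r -> r < q -> gam0 q < gam0 r.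
Proof.
move=> r0 rq; have q0 : 0 <= q by lra.
by rewrite /gam0 !max_r// ltf_pV2 ?posrE; lra.
Qed.

Lemma gam0_01 r : 0 <= gam0 r <= 1.
Proof.
have a : 0 <= Num.max 0 r by rewrite le_max lexx.
by rewrite /gam0 invr_ge0 addr_ge0//= invf_le1; lra.
Qed.

Lemma kbt01 (t r : R) : 0 <= kbt t r <= 1.
Proof. by rewrite kbt_ge0/= /kbt lern1 leq_b1. Qed.

Definition weighted_mass w : R := gw gam0 (fun x => w x ^+ 2).

(* The last condition gives the tightness of the class. *)
Definition rearr_class v w := [/\ l2 leb w, forall x, 0 <= w x, n2 leb w = n2 leb v, DD v <= DD w &
  (forall t, 0 < t -> Enr t w <= Enr t v) /\
  forall t, gw (kbt t) (fun x => v x ^+ 2) <= gw (kbt t) (fun x => w x ^+ 2)].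

Lemma rearr_pol a b s v w : s != 0 -> rearr_class v w -> rearr_class v (pol a b s w).
Proof.
move=> s0 [lw w0 nw Dw [Ew Gw]]; have [lp np] := pol_l2 a b s0 lw w0; split.
- exact: lp.
- by move=> x; exact: pol_ge0.
- by rewrite np.
- exact: le_trans Dw (pol_DD a b s0 lw w0).
- split=> t; first by move=> t0; apply: le_trans (pol_Enr a b s0 (ltW t0) lw w0) (Ew t t0).
  apply: le_trans (Gw t) _.
  have -> : (fun x => pol a b s w x ^+ 2) = pol a b s (fun x => w x ^+ 2).
    by apply/funext => x; exact: pol_sqr.
  exact: (pol_gw a b s0 (@kbt_ni _ t) (kbt01 t) (l2_sq lw)).
Qed.

Lemma rearr_Enr v w (t : R) : rearr_class v w -> 0 < t -> Enr t w <= Enr t v.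
Proof. by move=> [_ _ _ _ [E _]]; exact: E. Qed.

Lemma rearr_gw v w (t : R) : rearr_class v w -> gw (kbt t) (fun x => v x ^+ 2) <= gw (kbt t) (fun x => w x ^+ 2).
Proof. by move=> [_ _ _ _ [_ G]]; exact: G. Qed.

Lemma rearr_n2 v w : rearr_class v w -> n2 leb w = n2 leb v.
Proof. by case. Qed.

Lemma rearr_DD v w : rearr_class v w -> DD v <= DD w.
Proof. by case. Qed.

Lemma rearr_refl v : l2 leb v -> (forall x, 0 <= v x) -> rearr_class v v.
Proof.
move=> lv v0; split; [exact: lv|exact: v0|reflexivity|exact: lexx|].
by split=> t; [move=> _|]; exact: lexx.
Qed.

Lemma rearr_lim v (ws : nat -> R3 -> R) W : (forall n, rearr_class v (ws n)) -> l2 leb W -> (forall x, 0 <= W x) ->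
  (fun n => n2 leb (fun x => ws n x - W x)) @ \oo --> (0 : R) -> rearr_class v W.
Proof.
move=> H lW W0 c; have lw n : l2 leb (ws n) by case: (H n).
split; [exact: lW|exact: W0| | |split=> t].
- have k := cvg_n2 lw lW c; apply/eqP; rewrite eq_le.
  by apply/andP; split; [apply: cvg_le k _|apply: le_cvg k _] => n; rewrite (rearr_n2 (H n)).
- by apply: le_cvg (DD_cvg lw lW c) _ => n; exact: rearr_DD (H n).
- move=> t0; have vt : 0 <= 4 * vol t by rewrite mulr_ge0// ltW// vol_gt0.
  have k := cvg_of_sqbound vt (fun u w => @Enr_dist t u w (ltW t0)) lw lW c.
  by apply: (cvg_le k) => n; exact: rearr_Enr (H n) t0.
- have k := cvg_of_sqbound ler01 (fun u w => @gw_dist (kbt t) u w (@kbt_ni _ t) (kbt01 t)) lw lW c.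
  by apply: (le_cvg k) => n; exact: rearr_gw (H n).
Qed.

Lemma btail v e : l2 leb v -> 0 < e -> exists t : R, n2 leb v - gw (kbt t) (fun x => v x ^+ 2) <= e.
Proof.
move=> lv e0; have li := l2_sq lv.
have mb (n : nat) : measurable_fun setT (fun x : R3 => kbt n%:R (sq3 x) * v x ^+ 2).
  by apply: measurable_funM; [apply: gamma_meas; exact: kbt_ni|exact: intble_meas li].
have [|||_ c] := @rint_dct _ _ _ leb (fun (n : nat) x => kbt n%:R (sq3 x) * v x ^+ 2) (fun x => v x ^+ 2) (fun x => v x ^+ 2) mb (intble_meas li).
- move=> x; apply: cvg_near_cst; exists (Num.truncn (1 + sq3 x)).+1 => // n /= Nn.
  rewrite /kbt; have s0 := sq3_ge0 x.
  have : 1 + sq3 x < n%:R.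
    by apply: lt_le_trans (truncnS_gt _) _; rewrite ler_nat.
  move=> h; have -> : sq3 x <= n%:R ^+ 2 by rewrite expr2; nra.
  by rewrite mul1r.
- move=> n x /=; rewrite normrM [`|v x ^+ 2|]ger0_norm ?sqr_ge0// ler_piMl ?sqr_ge0//.
  by rewrite ger0_norm; case/andP: (kbt01 n%:R (sq3 x)).
- exact: li.
move/cvgrPdist_le: c => /(_ e e0) [N _ /(_ N (leqnn N))] /= h.
by exists N%:R; apply: le_trans (ler_norm _) h.
Qed.

(** A maximising sequence has energies bounded by those of [v], hence a subsequence is Cauchy on
    balls; outside large balls its mass is at most that of [v]. The convergence therefore holds in
    L2, where the conditions of the class are closed and the weighted mass is continuous. *)
Lemma rearr_max v g : l2 leb v -> (forall x, 0 <= v x) -> gradof v g ->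
  exists2 W, rearr_class v W & forall w, rearr_class v w -> weighted_mass w <= weighted_mass W.
Proof.
move=> lv v0 gv.
have cv := rearr_refl lv v0.
pose E := [set weighted_mass w | w in rearr_class v].
have Jle w : rearr_class v w -> weighted_mass w <= n2 leb v.
  move=> [lw _ <- _ _]; apply: rint_le; [|exact: l2_sq|].
    apply: (intble_mulb (m := leb) (M := 1)) (l2_sq lw); first by apply: gamma_meas; exact: gam0_ni.
    by move=> x; rewrite ger0_norm; case/andP: (gam0_01 (sq3 x)).
  by move=> x; rewrite ler_piMl ?sqr_ge0//; case/andP: (gam0_01 (sq3 x)).
have hs : has_sup E.
  split; first by exists (weighted_mass v); exists v.
  by exists (n2 leb v) => _ [w cw <-]; exact: Jle.
have /choice[ws Hws] : forall n : nat, exists w, rearr_class v w /\ sup E - n.+1%:R^-1 < weighted_mass w.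
  move=> n; have n0 : 0 < n.+1%:R^-1 :> R by rewrite invr_gt0.
  by have [_ [w cw <-] h] := sup_adherent n0 hs; exists w.
have lws n : l2 leb (ws n) by case: (Hws n) => [[]].
have [s [si Hs]] : exists s : nat -> nat, (forall n, (s n < s n.+1)%N) /\
    forall r e : R, 0 < e -> exists N, forall n k, (N <= n)%N -> (N <= k)%N ->
      rint leb (fun x => bt r x * (ws (s n) x - ws (s k) x) ^+ 2) <= e.
  apply: (@rellich R ws (n2 leb v) (24 * G3 g)) => //.
  - by move=> n; rewrite (rearr_n2 (Hws n).1).
  - by rewrite mulr_ge0// G3_ge0.
  - move=> n t /andP[t0 t1].
    exact: le_trans (rearr_Enr (Hws n).1 t0) (Enr_le_grad (ltW t0) lv gv).
pose us n := ws (s n).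
have lus n : l2 leb (us n) by exact: lws.
have cus n : rearr_class v (us n) by case: (Hws (s n)).
have cau : l2cauchy leb us.
  move=> e e0; have e8 : 0 < e / 8 by rewrite divr_gt0.
  have e2 : 0 < e / 2 by rewrite divr_gt0.
  have [t Ht] := btail lv e8.
  have [N HN] := Hs t (e / 2) e2; exists N => n k Nn Nk.
  have T m : n2 leb (us m) - gw (kbt t) (fun x => us m x ^+ 2) <= e / 8.
    by rewrite (rearr_n2 (cus m)); apply: le_trans Ht; rewrite lerD2l lerN2; exact: rearr_gw (cus m).
  have := HN n k Nn Nk; rewrite -/(us n) -/(us k) => h.
  have ib z : l2 leb z -> intble leb (fun x => kbt t (sq3 x) * z x ^+ 2).
    move=> lz; apply: (intble_mulb (m := leb) (M := 1)) (l2_sq lz); first by apply: gamma_meas; exact: kbt_ni.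
    by move=> x; rewrite ger0_norm; case/andP: (kbt01 t (sq3 x)).
  have ld := l2B (lus n) (lus k).
  have i1 := intbleB (l2_sq (lus n)) (ib _ (lus n)); have i2 := intbleB (l2_sq (lus k)) (ib _ (lus k)).
  have i3 := ib _ ld.
  (* Inside the ball the squared difference is kept, outside it is bounded by twice the sum of the
     squares: [e / 2] from inside and four times [e / 8] from outside. *)
  apply: (@le_trans _ _ (rint leb (fun x => kbt t (sq3 x) * (us n x - us k x) ^+ 2 +
     (2 * (us n x ^+ 2 - kbt t (sq3 x) * us n x ^+ 2) + 2 * (us k x ^+ 2 - kbt t (sq3 x) * us k x ^+ 2))))).
    apply: rint_le; [exact: l2_sq|by apply: intbleD => //; apply: intbleD; exact: intbleZ|].
    move=> x; have := kbt01 t (sq3 x) => /andP[k0 k1].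
    move: (kbt t _) k0 k1 (us n x) (us k x) => q q0 q1 p r.
    have : 0 <= (1 - q) * (p + r) ^+ 2 by rewrite mulr_ge0 ?sqr_ge0// subr_ge0.
    clear; lra.
  rewrite (rintD i3 (intbleD (intbleZ 2 i1) (intbleZ 2 i2))) (rintD (intbleZ 2 i1) (intbleZ 2 i2)).
  rewrite (rintZ 2 i1) (rintZ 2 i2) (rintB (l2_sq (lus n)) (ib _ (lus n))) (rintB (l2_sq (lus k)) (ib _ (lus k))).
  have := T n; have := T k; rewrite /gw /n2.
  have h' : rint leb (fun x => kbt t (sq3 x) * (us n x - us k x) ^+ 2) <= e / 2 by exact: h.
  move: h'; clear; move: (rint _ _) (rint _ _) (rint _ _) (rint _ _) (rint _ _) => *; lra.
have [s' [si' []]] := l2_complete lus cau.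
set u := plim _ => lu cu _.
(* The class demands nonnegativity at every point. As the terms are nonnegative, the absolute value
   of the limit is at least as close to them. *)
pose W x := `|u x|.
have lW : l2 leb W := l2_abs lu.
have cW : (fun n => n2 leb (fun x => us n x - W x)) @ \oo --> (0 : R).
  apply: squeeze_cvgr (cvg_cst 0) cu; near=> n.
  rewrite n2_ge0/=; apply: n2_le; [exact: l2B|exact: l2B|move=> x].
  have us0 : 0 <= us n x by case: (cus n).
  by rewrite /W -{1}(ger0_norm us0); exact: ler_dist_dist.
have clW : rearr_class v W by apply: rearr_lim cus lW _ cW => x; exact: normr_ge0.
exists W => // w cw.
have cJ : (fun n => weighted_mass (us n)) @ \oo --> weighted_mass W.
  exact: cvg_of_sqbound ler01 (fun u w => @gw_dist gam0 u w gam0_ni gam0_01) lus lW cW.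
have JE : sup E <= weighted_mass W.
  have cS : (fun n => weighted_mass (us n) + (s n).+1%:R^-1) @ \oo --> weighted_mass W + 0.
    apply: cvgD => //.
    apply: squeeze_cvgr (cvg_cst 0) (cvg_harmonic : (fun n => n.+1%:R^-1 : R) @ \oo --> 0); near=> n.
    rewrite invr_ge0 ler0n/= lef_pV2 ?posrE// ler_nat ltnS; exact: increasing_seq_ge.
  rewrite -[weighted_mass W]addr0; apply: le_cvg cS _ => n.
  by have [_ h] := Hws (s n); rewrite -lerBlDr ltW.
by apply: le_trans JE; apply: ub_le_sup; [exact: hs.2|exists w].
Unshelve. all: by end_near. Qed.

End symmetrization.

(** * Radial symmetry of the maximiser *)

Section radialize.
Context {R : realType}.
Local Notation R3 := (R3 R).
Local Notation leb := (leb R).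
Implicit Types (u v w W f : R3 -> R) (x y h : R3).

(** The polarisation stays in the class, so maximality forces equality in [pol_gw] and [W] agrees
    almost everywhere with its polarisation. *)
Lemma max_pol_ae v W a b s : rearr_class v W -> (forall w, rearr_class v w -> weighted_mass w <= weighted_mass W) -> s != 0 ->
  {ae leb, forall x, (W x - W (refl a b s x)) * (refl_l a b s x * s) <= 0}.
Proof.
move=> cW mW s0; have [lW W0 _ _ _] := cW.
have := mW _ (rearr_pol a b s0 cW); rewrite /weighted_mass.
have -> : (fun x => pol a b s W x ^+ 2) = pol a b s (fun x => W x ^+ 2).
  by apply/funext => x; exact: pol_sqr.
move=> /(pol_gw_eq s0 (@gam0_ni R) (@gam0_st R) (@gam0_01 R) (l2_sq lW)).
apply: ae_imp => x; rewrite -pol_sqr// => /eqP.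
rewrite eqrXn2// ?pol_ge0// => /eqP; rewrite /pol.
case: (leP (refl_l a b s x * s) 0) => h E.
  by apply: mulr_ge0_le0 => //; rewrite subr_ge0 -E le_max lexx orbT.
by apply: mulr_le0_ge0; rewrite ?(ltW h)// subr_le0 -[leLHS]E ge_min lexx orbT.
Qed.

Lemma refl_shift a b (s : R) x : refl a b s x =
  add3 (refl a b 0 x) ((refl_k a b * s * a, refl_k a b * s * b), refl_k a b * s).
Proof. by rewrite /refl /refl_l /add3/=; congr ((_, _), _); ring. Qed.

(** Reflections in parallel mirrors differ by a translation along the normal ([refl_shift]), and
    translations are continuous in L2. *)
Lemma refl_l2_cvg a b (s : nat -> R) W : l2 leb W -> s @ \oo --> (0 : R) ->
  (fun n => n2 leb (fun x => W (refl a b (s n) x) - W (refl a b 0 x))) @ \oo --> (0 : R).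
Proof.
move=> lW cs; pose h (t : R) : R3 := ((refl_k a b * t * a, refl_k a b * t * b), refl_k a b * t).
have E t : n2 leb (fun x => W (refl a b t x) - W (refl a b 0 x)) = dn W (h t).
  have ld := dn_l2 (h t) lW.
  rewrite /dn -(mpres_n2 (mpres_refl a b 0) ld.1); congr rint; apply/funext => x.
  by rewrite refl_shift.
apply/cvgrPdist_le => e e0.
have se0 : 0 < Num.sqrt e by rewrite sqrtr_gt0.
have [d /andP[d0 _] H] := tau_cont lW se0.
pose M := refl_k a b * (1 + `|a| + `|b|).
have k0 := refl_k_gt0 a b.
have M0 : 0 < M by rewrite mulr_gt0// -addrA ltr_wpDr ?addr_ge0.
have dM : 0 < d / M by rewrite divr_gt0.
move/cvgrPdist_le: cs => /(_ _ dM); apply: filterS => n.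
rewrite !sub0r !normrN ler_pdivlMr// => sn.
rewrite E ger0_norm ?dn_ge0// -[leRHS](sqr_sqrtr (ltW e0)); apply/nrm_le_n2; first exact: ltW.
apply: H.
have B (c : R) : `|c| <= 1 + `|a| + `|b| -> `|refl_k a b * s n * c| <= d.
  move=> hc; apply: le_trans sn; rewrite normrM [`|_ * s n|]normrM (ger0_norm (ltW k0)) /M.
  rewrite [_ * `|s n|]mulrC -mulrA ler_wpM2l// ler_wpM2l// ltW//.
have a0 := normr_ge0 a; have b0 := normr_ge0 b.
split=> /=; [apply: B; lra|apply: B; lra|].
by rewrite -[_ * s n]mulr1; apply: B; rewrite normr1; lra.
Qed.

(** The mirrors [s = eps / (n + 1)] tend to the one through 0. Dropping the positive factor
    [1 / (n + 1)] before the limit keeps the sign of [eps] in the inequality; the two signs together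
    give the equality of [refl0_ae]. *)
Lemma refl0_half a b W (eps : R) : l2 leb W -> eps != 0 ->
  (forall s, s != 0 -> {ae leb, forall x, (W x - W (refl a b s x)) * (refl_l a b s x * s) <= 0}) ->
  {ae leb, forall x, (W x - W (refl a b 0 x)) * (refl_l a b 0 x * eps) <= 0}.
Proof.
move=> lW e0 H.
pose s (n : nat) : R := eps * n.+1%:R^-1.
have cs : s @ \oo --> (0 : R).
  by rewrite -[X in _ --> X](mulr0 eps); apply: cvgMr; exact: cvg_harmonic.
have s0 n : s n != 0 by rewrite mulf_neq0// invr_neq0// pnatr_eq0.
have lr t : l2 leb (fun x => W (refl a b t x)) := mpres_l2 (mpres_refl a b t) lW.
have [p [pi pc]] := l2_cvg_ae (fun n => lr (s n)) (lr 0) (refl_l2_cvg a b lW cs).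
have A : {ae leb, forall x, forall n, (W x - W (refl a b (s n) x)) * (refl_l a b (s n) x * s n) <= 0}.
  by apply: ae_foralln => n; exact: H.
apply: ae_imp2 pc A => x cx Hx.
have csp : (s \o p) @ \oo --> (0 : R).
  have sub : p n @[n --> \oo] --> \oo.
    apply/cvgnyPge => N; exists N => // n /= Nn; exact: leq_trans Nn (increasing_seq_ge pi n).
  exact: cvg_comp sub cs.
have cl : (fun n => (W x - W (refl a b (s (p n)) x)) * ((refl_l a b 0 x - s (p n)) * eps)) @ \oo -->
    (W x - W (refl a b 0 x)) * ((refl_l a b 0 x - 0) * eps).
  apply: cvgM; first by apply: cvgB => //; exact: cvg_cst.
  by apply: cvgMl; apply: cvgB => //; exact: cvg_cst.
rewrite subr0 in cl; apply: (cvg_le cl) => n.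
have := Hx (p n); have -> : refl_l a b (s (p n)) x = refl_l a b 0 x - s (p n) by rewrite /refl_l subr0.
have n0 : 0 < (p n).+1%:R^-1 :> R by rewrite invr_gt0.
by rewrite {2}/s !mulrA pmulr_lle0.
Qed.

Lemma refl0_ae a b W : l2 leb W ->
  (forall s, s != 0 -> {ae leb, forall x, (W x - W (refl a b s x)) * (refl_l a b s x * s) <= 0}) ->
  {ae leb, forall x, W (refl a b 0 x) = W x}.
Proof.
move=> lW H; have h1 := refl0_half lW (oner_neq0 R) H.
have n1 : (-1 : R) != 0 by rewrite oppr_eq0 oner_neq0.
have h2 := refl0_half lW n1 H.
apply: ae_imp2 h1 h2 => x; rewrite mulr1 !mulrN1 mulrN oppr_le0 => p1 p2.
have /eqP : (W x - W (refl a b 0 x)) * refl_l a b 0 x = 0 by apply/eqP; rewrite eq_le p1 p2.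
rewrite mulf_eq0 subr_eq0 => /orP[/eqP//|/eqP l0].
by rewrite (refl_fix l0).
Qed.

Lemma refl0_add a b x y : refl a b 0 (add3 x y) = add3 (refl a b 0 x) (refl a b 0 y).
Proof. by rewrite /refl /refl_l /add3/=; congr ((_, _), _); ring. Qed.

(** Averages do not see null sets, so invariance of [W] almost everywhere becomes invariance of its
    averages at every point. *)
Lemma avg_refl t a b W x : 0 <= t -> l2 leb W -> {ae leb, forall x, W (refl a b 0 x) = W x} ->
  avg t W (refl a b 0 x) = avg t W x.
Proof.
move=> t0 lW H; rewrite /avg; congr (_ * _).
have hr := mpres_refl a b 0; have lb := bt_l2 t0.
have lWr := mpres_l2 hr lW.
rewrite /ip -(mpres_rint hr); last first.
  by apply: measurable_funM; [exact: bt_meas|case: (tau_l2 (refl a b 0 x) lW)].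
transitivity (ip leb (bt t) (tau x (fun y => W (refl a b 0 y)))).
  by congr rint; apply/funext => h; rewrite bt_refl0 /tau refl0_add.
rewrite ipC [RHS]ipC; apply: ae_ip; [exact: tau_l2|exact: tau_l2|exact: lb|].
exact: (mpres_ae (mpres_shift x) H).
Qed.

Lemma enorm_sq3 x : enorm3 x ^+ 2 = sq3 x.
Proof. by rewrite sqr_sqrtr// sq3_ge0. Qed.

(** Let [r = enorm3 x]. If [x.2 = r], then [x] is already the pole [(0, 0, r)]. Otherwise the mirror
    through 0 orthogonal to [x - (0, 0, r)] exchanges the two points; [a] and [b] come from scaling
    this normal to third component 1. *)
Lemma refl_pole f : (forall a b x, f (refl a b 0 x) = f x) ->
  forall x, f x = f ((0, 0), enorm3 x).
Proof.
move=> H x; have E := enorm_sq3 x; set r := enorm3 x in E *.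
have [d0|dn0] := eqVneq (x.2 - r) 0.
  have xr : x.2 = r by apply/eqP; rewrite -subr_eq0 d0.
  have : x.1.1 ^+ 2 + x.1.2 ^+ 2 = 0.
    by move: E; rewrite /sq3 xr; move=> E; apply: (addIr (r ^+ 2)); rewrite add0r -E.
  move=> /eqP; rewrite paddr_eq0 ?sqr_ge0// !expf_eq0 /= => /andP[/eqP a /eqP b].
  by move: xr a b; clearbody r; case: x {E d0} => [[x1 x2] x3] /= -> -> ->.
pose d := x.2 - r; pose a := x.1.1 / d; pose b := x.1.2 / d.
rewrite -(H a b x); congr f.
have kl : refl_k a b * refl_l a b 0 x = d.
  have N0 := refl_n0 a b; apply: (mulIf N0); rewrite mulrAC [refl_k a b * _]refl_kE.
  apply: (mulIf (expf_neq0 2 dn0)); rewrite -/d.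
  have E1 : a * d = x.1.1 by rewrite divfK.
  have E2 : b * d = x.1.2 by rewrite divfK.
  have -> : 2 * refl_l a b 0 x * d ^+ 2 = d * (2 * (a * d * x.1.1 + b * d * x.1.2 + x.2 * d)).
    by rewrite /refl_l; ring.
  have -> : d * (a ^+ 2 + b ^+ 2 + 1) * d ^+ 2 = d * ((a * d) ^+ 2 + (b * d) ^+ 2 + d ^+ 2) by ring.
  rewrite E1 E2; congr (_ * _).
  have -> : x.1.1 * x.1.1 + x.1.2 * x.1.2 = r ^+ 2 - x.2 ^+ 2 by rewrite E /sq3; ring.
  by rewrite /d; ring.
rewrite /refl kl /a /b; congr ((_, _), _).
- by rewrite mulrC divfK// subrr.
- by rewrite mulrC divfK// subrr.
- by rewrite /d; ring.
Qed.

Lemma refl_radial f : (forall a b x, f (refl a b 0 x) = f x) -> radial f.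
Proof. by move=> H x y xy; rewrite (refl_pole H x) (refl_pole H y) xy. Qed.

Lemma wpd_ae i u w g : l2 leb u -> l2 leb w -> {ae leb, forall x, u x = w x} -> wpd i u g -> wpd i w g.
Proof.
move=> lu lw uw H phi tp; rewrite -H//; apply/esym; apply: ae_ip uw => //.
exact: tst_l2 (tst_pderiv i tp).
Qed.

(** By [avg_jensen] and [vol_ge] the squared distance for [t = 1 / (n + 1)] is at most
    [(8 / t^3) C t^5 = 8 C t^2]. *)
Lemma avg_cvg W (C : R) : l2 leb W -> (forall t, 0 < t <= 1 -> Enr t W <= C * t ^+ 5) ->
  (fun n : nat => n2 leb (fun x => avg n.+1%:R^-1 W x - W x)) @ \oo --> (0 : R).
Proof.
move=> lW H.
have C0 : 0 <= C.
  have := H 1; rewrite ltr01 lexx expr1n mulr1 => /(_ isT); apply: le_trans; exact: Enr_ge0.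
have ch := @cvg_harmonic R.
have cz : (fun n : nat => 8 * C * (n.+1%:R^-1 * n.+1%:R^-1) : R) @ \oo --> (0 : R).
  by rewrite [X in _ --> X](_ : 0 = 8 * C * (0 * 0)); [apply: cvgM; [exact: cvg_cst|apply: cvgM; exact: ch]|rewrite !mulr0].
apply: squeeze_cvgr (cvg_cst 0) cz; near=> n; rewrite n2_ge0/=.
set t : R := n.+1%:R^-1.
have t0 : 0 < t by rewrite invr_gt0.
have t1 : t <= 1 by rewrite invf_le1// ler1n.
have [_] := avg_jensen t0 lW.
have -> : n2 leb (fun x => W x - avg t W x) = n2 leb (fun x => avg t W x - W x).
  by rewrite -n2N; congr rint; apply/funext => x; rewrite opprB.
move=> /le_trans; apply.
have ht : 0 < t <= 1 by rewrite t0.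
have v0 := vol_gt0 t0.
apply: (@le_trans _ _ ((t ^+ 3 / 8)^-1 * (C * t ^+ 5))).
  apply: ler_pM; [by rewrite invr_ge0 ltW|exact: Enr_ge0| |exact: H].
  by rewrite lef_pV2 ?posrE ?vol_ge// divr_gt0// exprn_gt0.
by rewrite le_eqVlt; apply/orP; left; apply/eqP; field; exact: lt0r_neq0.
Unshelve. all: by end_near. Qed.

Theorem symmetrization v g : l2 leb v -> (forall x, 0 <= v x) -> gradof v g ->
  exists w k, [/\ radial w, l2 leb w, gradof w k & G3 k <= G3 g] /\
    n2 leb w = n2 leb v /\ DD v <= DD w.
Proof.
move=> lv v0 gv; have [W cW mW] := rearr_max lv v0 gv.
have [lW W0 nW DW _] := cW.
have inv a b : {ae leb, forall x, W (refl a b 0 x) = W x}.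
  by apply: refl0_ae => // s; exact: max_pol_ae mW.
have EW t : 0 < t -> Enr t W <= 24 * G3 g * t ^+ 5.
  by move=> t0; apply: le_trans (rearr_Enr cW t0) (Enr_le_grad (ltW t0) lv gv).
have ca : (fun n : nat => n2 leb (fun x => avg n.+1%:R^-1 W x - W x)) @ \oo --> (0 : R).
  by apply: (@avg_cvg W (24 * G3 g)) => // t /andP[t0 _]; exact: EW.
have la (n : nat) : l2 leb (avg (n.+1%:R^-1) W).
  have t0 : 0 < n.+1%:R^-1 :> R by rewrite invr_gt0.
  have [ld _] := avg_jensen t0 lW; have := l2B lW ld.
  by rewrite (_ : (fun x => W x - _) = avg n.+1%:R^-1 W)//; apply/funext => x; ring.
have [s [_ sc]] := l2_cvg_ae la lW ca.
(* The limit of the averages is taken instead of [W]: it equals [W] almost everywhere and is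
   invariant under the linear reflections at every point, hence exactly radial. *)
pose w := plim (fun n => avg (s n).+1%:R^-1 W).
have ww : {ae leb, forall x, W x = w x}.
  by apply: ae_imp sc => x cx; rewrite /w (plim_cvg cx).
have mw : measurable_fun setT w by apply: measurable_plim => n; case: (la (s n)).
have lw : l2 leb w.
  split=> //; have [mW' fW] := lW; apply: le_lt_trans fW.
  rewrite le_eqVlt; apply/orP; left; apply/eqP; apply: ae_eq_integral => //.
  - by apply/measurable_EFinP; exact: measurable_funX.
  - by apply/measurable_EFinP; exact: measurable_funX.
  - by apply: ae_imp ww => x /= -> _.
have [k gk Gk] := gradof_compare lv gv lW (fun t => @rearr_Enr _ v W t cW).
exists w, k; split; [split; [|exact: lw| |exact: Gk]|split].
- apply: refl_radial => a b x; rewrite /w /plim; congr (fine (limn_esup _)).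
  apply/funext => n; congr EFin; apply: avg_refl => //.
- move=> i; have [lk wk] := gk i; split=> //; exact: wpd_ae ww wk.
- by rewrite -nW; apply/esym; exact: ae_n2.
- by rewrite -(DD_ae lW lw ww).
Qed.

End radialize.

(** * Decay of radial potentials *)

Section rint_sum.
Context d (T : measurableType d) (R : realType) (m : {measure set T -> \bar R}).

Lemma rint_sum (I : Type) (s : seq I) (f : I -> T -> R) : (forall i, intble m (f i)) ->
  intble m (fun x => \sum_(i <- s) f i x) /\
  rint m (fun x => \sum_(i <- s) f i x) = \sum_(i <- s) rint m (f i).
Proof.
move=> fi; elim: s => [|i s [IH1 IH2]].
  under eq_fun do rewrite big_nil; rewrite big_nil; split.
    by rewrite /intble (_ : _ \o _ = cst 0%E)//; exact: integrable0.
  rewrite -[RHS](n2_0 m); congr rint; apply/funext => x; by rewrite expr0n.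
rewrite big_cons -IH2 -(rintD (fi i) IH1).
under eq_fun do rewrite big_cons.
by split=> //; exact: intbleD.
Qed.

End rint_sum.

Section radial_decay.
Context {R : realType}.
Local Notation R3 := (R3 R).
Local Notation leb := (leb R).
Implicit Types (u v w f : R3 -> R) (x y h : R3).

Lemma ph_sym u w : l2 leb u -> l2 leb w ->
  rint leb (fun x => ph u x * w x ^+ 2) = rint leb (fun x => ph w x * u x ^+ 2).
Proof.
move=> lu lw; apply: EFin_inj.
rewrite (rintE (DD_intble lu lw)) (rintE (DD_intble lw lu)).
have mu : measurable_fun setT (fun x => u x ^+ 2) by apply: measurable_funX; case: lu.
have mw : measurable_fun setT (fun x => w x ^+ 2) by apply: measurable_funX; case: lw.
have K (p q : R3 -> R) : l2 leb p -> (forall x, 0 <= q x) ->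
    (\int[leb]_x (ph p x * q x)%:E = \int[leb]_x \int[leb]_y (kq (sq3 (sub3 x y)) * (q x * p y ^+ 2))%:E)%E.
  move=> lp q0; apply: eq_integral => x _.
  rewrite mulrC EFinM /ph (rintE (ph_intble x lp)) -ge0_integralZl_EFin ?q0//.
  - by apply: eq_integral => y _; rewrite -EFinM mulrCA.
  - by move=> y _; rewrite lee_fin mulr_ge0 ?kq_ge0 ?sqr_ge0.
  - by apply/measurable_EFinP; exact: intble_meas (ph_intble x lp).
rewrite (K u _ lu (fun x => sqr_ge0 (w x))) (K w _ lw (fun x => sqr_ge0 (u x))).
rewrite (leb_swap (kq_pair_meas mw mu)).
  apply: eq_integral => y _; apply: eq_integral => x _ /=.
  by rewrite sub3C [w x ^+ 2 * _]mulrC.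
by move=> p; rewrite lee_fin; apply: mulr_ge0; [exact: kq_ge0|apply: mulr_ge0; exact: sqr_ge0].
Qed.

Lemma enorm_refl0 a b x : enorm3 (refl a b 0 x) = enorm3 x.
Proof. by have := sq3_refl0 a b x; rewrite /enorm3 /sq3 => ->. Qed.

Lemma ph_radial u : l2 leb u -> radial u -> radial (ph u).
Proof.
move=> lu ru; apply: refl_radial => a b x.
rewrite /ph -(mpres_rint (mpres_refl a b 0) (intble_meas (ph_intble (refl a b 0 x) lu))).
congr rint; apply/funext => y; rewrite sq3_refl_refl; congr (_ * _ ^+ 2).
exact: ru (enorm_refl0 a b y).
Qed.

Lemma sum_one_large (N : nat) (k : 'I_N -> R) (c : R) : 0 <= c ->
  (forall i, k i <= 1) -> (forall i j, i != j -> c < k i -> k j <= c) ->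
  \sum_i k i <= 1 + N%:R * c.
Proof.
move=> c0 k1 kc; have S : N%:R * c = \sum_(i < N) c by rewrite sumr_const card_ord mulr_natl.
have [[i hi]|no] := pselect (exists i, c < k i).
  rewrite (bigD1 i)//= S (bigD1 (i : 'I_N) (F := fun=> c))//=.
  apply: lerD (k1 i) _; apply: (@le_trans _ _ (\sum_(j < N | j != i) c)); last by rewrite lerDr.
  by apply: ler_sum => j ji; apply: kc hi; rewrite eq_sym.
apply: (@le_trans _ _ (N%:R * c)); last by rewrite lerDr.
by rewrite S; apply: ler_sum => i _; rewrite leNgt; apply/negP => h; apply: no; exists i.
Qed.

(* As ph u is radial, the kernel may be averaged over N + 1 points of the sphere at the heights
   rho * i / (N + 1); at most one of them is close to a given point. *)
Lemma ph_decay u (N : nat) (rho : R) x : l2 leb u -> radial u -> 0 < rho ->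
  enorm3 x = rho ->
  ph u x <= (N.+1%:R^-1 + 2 * N.+1%:R / rho) * n2 leb u.
Proof.
move=> lu ru r0 xr; set n : R := N.+1%:R.
have n0 : 0 < n by rewrite ltr0n.
pose z (i : 'I_N.+1) : R := rho * (i%:R / n).
pose p (i : 'I_N.+1) : R3 := ((Num.sqrt (rho ^+ 2 - z i ^+ 2), 0), z i).
have in1 (i : 'I_N.+1) : i%:R / n <= 1.
  by rewrite ler_pdivrMr// mul1r ler_nat ltnW.
have in0 (i : 'I_N.+1) : 0 <= i%:R / n by rewrite divr_ge0// ltW.
have zr i : z i ^+ 2 <= rho ^+ 2.
  rewrite lerXn2r ?nnegrE ?(ltW r0)//; first by rewrite /z mulr_ge0// ltW.
  by rewrite /z ler_piMr// ltW.
have pr i : enorm3 (p i) = rho.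
  rewrite /enorm3 /p/= sqr_sqrtr ?subr_ge0// expr0n/= addr0 subrK sqrtr_sqr.
  by rewrite ger0_norm// ltW.
have pe i : ph u (p i) = ph u x by apply: ph_radial => //; rewrite pr.
pose K i y := kq (sq3 (sub3 (p i) y)).
have Ki i : intble leb (fun y => K i y * u y ^+ 2) := ph_intble (p i) lu.
have [si sE] := rint_sum (index_enum 'I_N.+1) Ki.
have sumE : n * ph u x = \sum_(i < N.+1) rint leb (fun y => K i y * u y ^+ 2).
  rewrite (eq_bigr (fun=> ph u x)); last by move=> i _; exact: pe.
  by rewrite sumr_const card_ord mulr_natl.
(* Since [kern r <= 1 / r], a kernel above [c] means a distance below [1 / c = rho / (2 n)], half
   the spacing of the heights; two of the points cannot both be that close to [y]. *)
pose c : R := 2 * n / rho.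
have c0 : 0 < c by rewrite divr_gt0// mulr_gt0.
have near i y : c < K i y -> `|z i - y.2| < c^-1.
  rewrite /K /kq => h.
  have : `|z i - y.2| <= Num.sqrt (sq3 (sub3 (p i) y)).
    rewrite -sqrtr_sqr; apply: ler_wsqrtr; rewrite /sq3 /sub3/= lerDr.
    by rewrite addr_ge0 ?sqr_ge0.
  move: (Num.sqrt _) (sqrtr_ge0 (sq3 (sub3 (p i) y))) h => D D0 h hD.
  have [DE|Dn] := eqVneq D 0; first by apply: le_lt_trans hD _; rewrite DE invr_gt0.
  have Dp : 0 < D by rewrite lt_def Dn.
  apply: le_lt_trans hD _; rewrite -[D]invrK ltf_pV2 ?posrE ?invr_gt0//.
  exact: lt_le_trans h (kern_leV Dp).
have far i j y : i != j -> c < K i y -> K j y <= c.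
  move=> ij /near hi; rewrite leNgt; apply/negP => /near hj.
  have cE : c^-1 + c^-1 = rho / n.
    by rewrite /c; field; rewrite !gt_eqF.
  have : `|z i - z j| < rho / n.
    rewrite -cE; have -> : z i - z j = (z i - y.2) - (z j - y.2) by ring.
    by apply: le_lt_trans (ler_normB _ _) _; exact: ltrD.
  have -> : z i - z j = (rho / n) * (i%:R - j%:R) by rewrite /z; ring.
  have rn : 0 < rho / n by rewrite divr_gt0.
  rewrite normrM gtr0_norm// gtr_pMr//.
  apply/negP; rewrite -leNgt.
  have [h|h|h] := ltngtP i j.
  - rewrite distrC -natrB 1?ltnW// normr_nat ler1n subn_gt0//.
  - by rewrite -natrB 1?ltnW// normr_nat ler1n subn_gt0.
  - by move: ij; rewrite -val_eqE/= h eqxx.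
have le : n * ph u x <= (1 + n * c) * n2 leb u.
  rewrite sumE -sE -[n2 leb u]/(rint leb _) -(rintZ _ (l2_sq lu)).
  apply: rint_le => //; first exact: intbleZ (l2_sq lu).
  move=> y; rewrite -mulr_suml ler_wpM2r ?sqr_ge0//.
  apply: sum_one_large => [|i|i j ij]; [exact: ltW|exact: kq_le1|exact: far].
have -> : n^-1 + 2 * n / rho = n^-1 * (1 + n * c).
  by rewrite /c; field; rewrite !gt_eqF.
by rewrite -mulrA ler_pdivlMl.
Qed.

Lemma ph_tail (e : R) : 0 < e -> exists2 r : R, 0 < r &
  forall u x, l2 leb u -> radial u -> r < enorm3 x -> ph u x <= e * n2 leb u.
Proof.
move=> e0; pose N := Num.truncn (2 / e).
have nN : 2 / e < N.+1%:R by exact: truncnS_gt.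
have n0 : 0 < N.+1%:R :> R by rewrite ltr0n.
exists (4 * N.+1%:R / e); first by rewrite divr_gt0// mulr_gt0.
move=> u x lu ru rx.
have r0 : 0 < enorm3 x by apply: lt_trans rx; rewrite divr_gt0// mulr_gt0.
apply: le_trans (ph_decay N lu ru r0 erefl) _; rewrite ler_wpM2r ?n2_ge0//.
have a : N.+1%:R^-1 <= e / 2.
  by rewrite -[leRHS]invrK lef_pV2 ?posrE ?invr_gt0 ?divr_gt0// invf_div ltW.
have b : 2 * N.+1%:R / enorm3 x <= e / 2.
  rewrite ler_pdivrMr//; move: rx; rewrite ltr_pdivrMr//; move: (N.+1%:R) (enorm3 x) => p q; lra.
by apply: le_trans (lerD a b) _; rewrite -splitr.
Qed.

(** The indicator splits [u^2] into [U^2 + V^2], with [V] living outside the ball. The two terms of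
    [DD u] that involve [V] are each at most the integral of [ph u * V^2], the mixed one by the
    symmetry [ph_sym], and [ph u] is small where [V] lives. *)
Lemma DD_cutoff u (r e : R) : 0 <= r -> 0 <= e -> l2 leb u -> radial u ->
  (forall x, r < enorm3 x -> ph u x <= e * n2 leb u) ->
  DD u - 2 * e * n2 leb u ^+ 2 <= DD (fun x => bt r x * u x).
Proof.
move=> r0 e0 lu ru H.
have mb : measurable_fun setT (fun x => bt r x : R) by exact: bt_meas.
have mu : measurable_fun setT u by case: lu.
have mbc : measurable_fun setT (fun x : R3 => 1 - bt r x) by apply: measurable_funB.
have lU : l2 leb (fun x => bt r x * u x).
  apply: l2_dom (lu); first exact: measurable_funM.
  by move=> x; rewrite normrM ler_piMl// ger0_norm ?bt_ge0//; case/andP: (bt01 r x).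
have lV : l2 leb (fun x => (1 - bt r x) * u x).
  apply: l2_dom (lu); first exact: measurable_funM.
  move=> x; rewrite normrM ler_piMl// ger0_norm ?gerBl ?bt_ge0// subr_ge0.
  by case/andP: (bt01 r x).
set U := (fun x => bt r x * u x) in lU *; set V := (fun x => (1 - bt r x) * u x) in lV *.
have sq x : u x ^+ 2 = U x ^+ 2 + V x ^+ 2.
  rewrite /U /V; have := bt_sq r x; move: (bt r x) (u x) => b p E.
  by transitivity (p ^+ 2 * (2 * (b * b) - 2 * b + 1)); [rewrite E|]; ring.
have phs x : ph u x = ph U x + ph V x.
  rewrite /ph -(rintD (ph_intble x lU) (ph_intble x lV)); congr rint.
  by apply/funext => y; rewrite sq mulrDr.
have uV : rint leb (fun x => ph u x * V x ^+ 2) <= e * n2 leb u ^+ 2.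
  rewrite expr2 mulrA -[X in _ * X]/(rint leb (fun x => u x ^+ 2)) -(rintZ _ (l2_sq lu)).
  apply: rint_le; [exact: DD_intble|exact: intbleZ (l2_sq lu)|move=> x].
  rewrite /V /bt; case: (boolP (sq3 x <= r ^+ 2)) => h.
    rewrite subrr mul0r expr0n mulr0 mulr_ge0 ?sqr_ge0//.
    by rewrite mulr_ge0 ?n2_ge0.
  rewrite subr0 mul1r ler_wpM2r ?sqr_ge0//; apply: H.
  by rewrite ltNge; apply: contra h => h; rewrite -enorm_sq3 lerXn2r ?nnegrE ?sqrtr_ge0.
have UV : rint leb (fun x => ph V x * U x ^+ 2) <= rint leb (fun x => ph u x * V x ^+ 2).
  rewrite (ph_sym lV lU); apply: rint_le; [exact: DD_intble|exact: DD_intble|move=> x].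
  by rewrite ler_wpM2r ?sqr_ge0// phs lerDl ph_ge0.
have -> : DD u = DD U + rint leb (fun x => ph V x * U x ^+ 2) + rint leb (fun x => ph u x * V x ^+ 2).
  rewrite /DD -(rintD (DD_intble lU lU) (DD_intble lV lU)) -rintD; [| |exact: DD_intble].
    by congr rint; apply/funext => x; rewrite sq phs; ring.
  by apply: intbleD; exact: DD_intble.
move: UV uV; clear; move: (rint _ _) (rint _ _) (DD U) (n2 leb u ^+ 2) => *; lra.
Qed.

(** The kernel is positive everywhere, so a potential that vanishes at a single point already forces
    [u = 0] almost everywhere. *)
Lemma DD_gt0 u : l2 leb u -> 0 < n2 leb u -> 0 < DD u.
Proof.
move=> lu n0; rewrite lt_def DD_ge0 andbT; apply/negP => /eqP D0.
have pz x : ph u x = 0 -> False.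
  move=> p0; have g0 y : 0 <= kq (sq3 (sub3 x y)) * u y ^+ 2 by rewrite mulr_ge0 ?kq_ge0 ?sqr_ge0.
  have := rint_eq0 (ph_intble x lu) g0 p0 => H.
  have : {ae leb, forall y, u y = 0}.
    apply: ae_imp H => y /eqP; rewrite mulf_eq0 gt_eqF ?kq_gt0//= expf_eq0/=.
    by move/eqP.
  by move=> /(ae_n2 lu (l20 leb)) E; move: n0; rewrite E n2_0 ltxx.
have g0 x : 0 <= ph u x * u x ^+ 2 by rewrite mulr_ge0 ?ph_ge0 ?sqr_ge0.
have := rint_eq0 (DD_intble lu lu) g0 D0 => H.
have : {ae leb, forall y, u y = 0}.
  apply: ae_imp H => y /eqP; rewrite mulf_eq0 => /orP[/eqP/pz//|].
  by rewrite expf_eq0/= => /eqP.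
by move=> /(ae_n2 lu (l20 leb)) E; move: n0; rewrite E n2_0 ltxx.
Qed.

End radial_decay.

(** * Norm and constraint in terms of weak gradients; scaling *)

Section bridge.
Context {R : realType}.
Local Notation R3 := (R3 R).
Local Notation leb := (leb R).
Implicit Types (u v w f : R3 -> R) (x y h : R3) (g k : 'I_3 -> R3 -> R) (mu : R).

Lemma weak_pderivP i u (g : R3 -> R) : l2 leb u -> l2 leb g -> weak_pderiv i u g <-> wpd i u g.
Proof.
move=> lu lg.
have E phi : tst phi -> (\int[@leb3 R]_x (u x * pderiv i phi x)%:E = (ip leb u (pderiv i phi))%:E)%E /\
    (\int[@leb3 R]_x (g x * phi x)%:E = (ip leb g phi)%:E)%E.
  move=> tp; split; apply/esym; apply: (rintE (m := leb)); apply: l2_mul => //.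
    exact: tst_l2 (tst_pderiv i tp).
  exact: tst_l2.
split=> H phi tp.
  have [e1 e2] := E phi tp; have := H phi ((test_funP phi).2 tp).
  by rewrite e1 e2 -EFinN => -[].
have tp' := (test_funP phi).1 tp; have [-> ->] := E phi tp'.
by rewrite (H phi tp') EFinN.
Qed.

Lemma is_weak_gradP u g : l2 leb u -> is_weak_grad u g <-> gradof u g.
Proof.
move=> lu; split=> H i; have [lg wg] := H i; split=> //.
  exact/(weak_pderivP _ lu).
exact/(weak_pderivP _ lu).
Qed.

Lemma H1P u : H1 u <-> l2 leb u /\ exists g, gradof u g.
Proof.
split=> [[lu [g Hg]]|[lu [g Hg]]]; split=> //; exists g; first exact/(is_weak_gradP _ lu).
by apply/(is_weak_gradP _ lu).
Qed.

Lemma G3_uniq u g k : gradof u g -> gradof u k -> G3 g = G3 k.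
Proof.
move=> Hg Hk; rewrite /G3.
have E i : n2 leb (g i) = n2 leb (k i).
  by apply: ae_n2 (Hg i).1 (Hk i).1 _; exact: wpd_unique (Hg i).1 (Hk i).1 (Hg i).2 (Hk i).2.
by rewrite !E.
Qed.

(** [wgrad] is a chosen weak gradient; weak gradients agree almost everywhere, so any of them
    computes the norm. *)
Lemma hnorm2E mu u g : l2 leb u -> gradof u g -> hnorm2 mu u = G3 g + mu * n2 leb u.
Proof.
move=> lu Hg; have Hw : gradof u (wgrad u).
  by apply/(is_weak_gradP _ lu); apply: (@xgetPex _ _ (is_weak_grad u)); exists g; apply/(is_weak_gradP _ lu).
rewrite (G3_uniq Hg Hw) /hnorm2; congr (_ + _).
have lw i : l2 leb (wgrad u i) := (Hw i).1.
have [_] := rint_sum (m := leb) (index_enum 'I_3) (fun i => l2_sq (lw i)).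
rewrite -[X in _ = X -> _]/(\sum_(i < 3) n2 leb (wgrad u i)) /rint => ->.
rewrite !big_ord_recl big_ord0 addr0 addrA /G3.
by congr (n2 leb (wgrad u _) + n2 leb (wgrad u _) + n2 leb (wgrad u _)); exact: val_inj.
Qed.

Lemma gradof_comb (a b : R) u v g k : l2 leb u -> l2 leb v -> gradof u g -> gradof v k ->
  gradof (fun x => a * u x + b * v x) (fun i x => a * g i x + b * k i x).
Proof.
move=> lu lv Hu Hv i; have [lg wg] := Hu i; have [lk wk] := Hv i; split.
  by apply: l2D; exact: l2Z.
(* [wpd_lin] treats combinations [a u + v], so [b v] is written as [(b - 1) v + v]. *)
have E (z : R3 -> R) : (fun x => b * z x) = (fun x => (b - 1) * z x + z x).
  by apply/funext => x; ring.
apply: wpd_lin (lu) (lg) (l2Z b lv) (l2Z b lk) (wg) _.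
by rewrite (E v) (E (k i)); exact: wpd_lin.
Qed.

Lemma n2_comb (a b : R) u v : l2 leb u -> l2 leb v ->
  n2 leb (fun x => a * u x + b * v x) = a ^+ 2 * n2 leb u + 2 * (a * b * ip leb u v) + b ^+ 2 * n2 leb v.
Proof.
move=> lu lv; rewrite (n2D (l2Z a lu) (l2Z b lv)) (n2Z a lu) (n2Z b lv).
by rewrite (ipZl a lu (l2Z b lv)) (ipZr b lv lu); ring.
Qed.

Definition mid u v x : R := 2^-1 * u x + 2^-1 * v x.

Lemma gradof_B u v g k : l2 leb u -> l2 leb v -> gradof u g -> gradof v k ->
  gradof (fun x => u x - v x) (fun i x => g i x - k i x).
Proof.
move=> lu lv Hu Hv; have H := gradof_comb 1 (-1) lu lv Hu Hv.
have E (p q : R3 -> R) : (fun x => p x - q x) = (fun x => 1 * p x + -1 * q x).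
  by apply/funext => x; ring.
rewrite E (_ : (fun i x => _) = (fun i x => 1 * g i x + -1 * k i x))//.
by apply/funext => i; exact: E.
Qed.

Lemma parallelogram mu u v g k : l2 leb u -> l2 leb v -> gradof u g -> gradof v k ->
  hnorm2 mu (fun x => u x - v x) = 2 * hnorm2 mu u + 2 * hnorm2 mu v - 4 * hnorm2 mu (mid u v).
Proof.
move=> lu lv Hu Hv.
have hm := gradof_comb (2^-1) (2^-1) lu lv Hu Hv; have hb := gradof_B lu lv Hu Hv.
rewrite (hnorm2E mu lu Hu) (hnorm2E mu lv Hv) (hnorm2E mu (l2B lu lv) hb).
rewrite (hnorm2E mu (l2D (l2Z _ lu) (l2Z _ lv)) hm) /G3.
have lg i := (Hu i).1; have lk i := (Hv i).1.
rewrite !(n2B (lg _) (lk _)) !(n2_comb _ _ (lg _) (lk _)) (n2B lu lv) (n2_comb _ _ lu lv).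
by field.
Qed.

Lemma gradofZ (a : R) u g : l2 leb u -> gradof u g -> gradof (fun x => a * u x) (fun i x => a * g i x).
Proof.
move=> lu Hu; have H := gradof_comb (a - 1) 1 lu lu Hu Hu.
have E (p : R3 -> R) : (fun x => a * p x) = (fun x => (a - 1) * p x + 1 * p x).
  by apply/funext => x; ring.
rewrite E (_ : (fun i x => _) = (fun i x => (a - 1) * g i x + 1 * g i x))//.
by apply/funext => i; exact: E.
Qed.

Lemma hnorm2Z mu (a : R) u g : l2 leb u -> gradof u g ->
  hnorm2 mu (fun x => a * u x) = a ^+ 2 * hnorm2 mu u.
Proof.
move=> lu Hu; rewrite (hnorm2E mu lu Hu) (hnorm2E mu (l2Z a lu) (gradofZ a lu Hu)) /G3.
by rewrite !(n2Z a ((Hu _).1)) (n2Z a lu); ring.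
Qed.

Lemma MmuP u : Mmu u <-> [/\ l2 leb u, exists g, gradof u g & DD u = 1].
Proof.
split=> [[/H1P[lu gu] D1]|[lu gu D1]]; split=> //.
- by move: D1; rewrite (DDE lu) => -[].
- exact/H1P.
- by rewrite (DDE lu) D1.
Qed.

Lemma DD_mono u w : l2 leb u -> l2 leb w -> (forall x, u x ^+ 2 <= w x ^+ 2) -> DD u <= DD w.
Proof.
move=> lu lw uw; apply: rint_le; [exact: DD_intble|exact: DD_intble|move=> x].
apply: ler_pM; [exact: ph_ge0|exact: sqr_ge0| |exact: uw].
apply: rint_le; [exact: ph_intble|exact: ph_intble|move=> y].
by rewrite ler_wpM2l ?kq_ge0.
Qed.

Lemma root4 (D : R) : 0 < D -> exists c : R, [/\ 0 < c, c ^+ 4 * D = 1 & c ^+ 2 * Num.sqrt D = 1].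
Proof.
move=> D0; have s0 : 0 < Num.sqrt D by rewrite sqrtr_gt0.
have q0 : 0 < Num.sqrt (Num.sqrt D) by rewrite sqrtr_gt0.
pose q := Num.sqrt (Num.sqrt D); have E2 : q ^+ 2 = Num.sqrt D by rewrite sqr_sqrtr// ltW.
have E4 : q ^+ 4 = D by rewrite (exprM q 2 2) E2 sqr_sqrtr// ltW.
have qn n : q ^+ n != 0 by rewrite expf_neq0// gt_eqF.
exists q^-1; split; first by rewrite invr_gt0.
  by rewrite exprVn -E4 mulVf.
by rewrite exprVn -E2 mulVf.
Qed.

Lemma radialZ (a : R) u : radial u -> radial (fun x => a * u x).
Proof. by move=> ru x y /ru ->. Qed.

(** [DD] is homogeneous of degree 4 and [hnorm2] of degree 2, so [c] is the power [-1/4] of [DD u]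
    and the squared norm is divided by [sqrt (DD u)]. *)
Lemma scale_in_Mrad mu u g : l2 leb u -> gradof u g -> radial u -> 0 < DD u ->
  exists c, [/\ Mrad (fun x => c * u x), hnorm2 mu (fun x => c * u x) * Num.sqrt (DD u) = hnorm2 mu u & 0 < c].
Proof.
move=> lu Hu ru D0; have [c [c0 c4 c2]] := root4 D0; exists c; split=> //.
  split; last exact: radialZ.
  by apply/MmuP; split; [exact: l2Z|exists (fun i x => c * g i x); exact: gradofZ|rewrite DDZ].
by rewrite (hnorm2Z mu c lu Hu) mulrAC c2 mul1r.
Qed.

Lemma hnorm2_ge0 mu u g : 0 < mu -> l2 leb u -> gradof u g -> 0 <= hnorm2 mu u.
Proof.
by move=> m0 lu Hu; rewrite (hnorm2E mu lu Hu) addr_ge0 ?G3_ge0// mulr_ge0 ?n2_ge0// ltW.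
Qed.

(** Rescaling to the constraint gives [I * sqrt (DD u) <= hnorm2 mu u], and
    [sqrt (1 - eta) >= 1 - eta]. *)
Lemma hnorm2_lb mu I u g (eta : R) : 0 < mu -> 0 <= I -> (forall w, Mrad w -> I <= hnorm2 mu w) ->
  l2 leb u -> gradof u g -> radial u -> 0 <= eta < 1 -> 1 - eta <= DD u ->
  I * (1 - eta) <= hnorm2 mu u.
Proof.
move=> m0 I0 HI lu Hu ru /andP[e0 e1] De.
have D0 : 0 < DD u by apply: lt_le_trans De; rewrite subr_gt0.
have [c [cM E _]] := scale_in_Mrad mu lu Hu ru D0.
rewrite -E; apply: ler_pM => //; [by rewrite subr_ge0 ltW|exact: HI|].
have d0 : 0 <= 1 - eta by rewrite subr_ge0 ltW.
rewrite -[leLHS](ger0_norm d0) -sqrtr_sqr; apply: ler_wsqrtr; apply: le_trans De.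
by rewrite expr2 ler_piMl// lerBlDr lerDl.
Qed.

End bridge.

(** * Compactness of minimising sequences *)

Section compactness.
Context {R : realType}.
Local Notation R3 := (R3 R).
Local Notation leb := (leb R).
Implicit Types (u v w f : R3 -> R) (x y h : R3) (mu : R).

Lemma bt_mul_l2 (r : R) u : l2 leb u -> l2 leb (fun x => bt r x * u x) /\ n2 leb (fun x => bt r x * u x) <= n2 leb u.
Proof.
move=> lu.
have le x : `|bt r x * u x| <= `|u x|.
  by rewrite normrM ler_piMl// ger0_norm ?bt_ge0//; case/andP: (bt01 r x).
have l : l2 leb (fun x => bt r x * u x).
  apply: l2_dom (lu) => //; apply: measurable_funM; first exact: bt_meas.
  by case: lu.
by split=> //; exact: n2_le.
Qed.

Lemma n2_mid (M : R) u v : l2 leb u -> l2 leb v -> n2 leb u <= M -> n2 leb v <= M ->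
  l2 leb (mid u v) /\ n2 leb (mid u v) <= M.
Proof.
move=> lu lv uM vM; split; first by apply: l2D; exact: l2Z.
rewrite (n2_comb _ _ lu lv); have := n2_ge0 leb (fun x => u x - v x).
rewrite (n2B lu lv); move: (n2 leb u) (n2 leb v) (ip leb u v) uM vM => p q s pM qM H.
have -> : 2^-1 ^+ 2 * p + 2 * (2^-1 * 2^-1 * s) + 2^-1 ^+ 2 * q = (p + 2 * s + q) / 4 by field.
by rewrite ler_pdivrMr//; lra.
Qed.

(** Cutting off [u] loses little of its [DD], because its potential is small far away; on the ball
    the midpoint is close to [u] in L2; and cutting off the midpoint can only lower its [DD]. Far
    away the two functions may differ without harm. *)
Lemma DD_mid u v (r e M d : R) : 0 <= r -> 0 <= e -> 0 <= d -> l2 leb u -> l2 leb v -> radial u ->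
  (forall x, r < enorm3 x -> ph u x <= e * n2 leb u) ->
  n2 leb u <= M -> n2 leb v <= M ->
  rint leb (fun x => bt r x * (u x - v x) ^+ 2) <= d ^+ 2 ->
  DD u - 2 * e * M ^+ 2 - 4 * d * Num.sqrt M * M <= DD (mid u v).
Proof.
move=> r0 e0 d0 lu lv ru H uM vM Hd.
have M0 : 0 <= M := le_trans (n2_ge0 _ _) uM.
have [lm mM] := n2_mid lu lv uM vM.
have [lp np] := bt_mul_l2 r lm; have [lq nq] := bt_mul_l2 r lu.
set p := (fun x => bt r x * mid u v x) in lp np; set q := (fun x => bt r x * u x) in lq nq.
have cut := DD_cutoff r0 e0 lu ru H.
have pm : DD p <= DD (mid u v).
  apply: DD_mono => // x; rewrite /p exprMn ler_piMl ?sqr_ge0//.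
  by rewrite expr2 bt_sq; case/andP: (bt01 r x).
have pq : nrm leb (fun x => p x - q x) <= d.
  apply/nrm_le_n2; [exact: d0|apply: le_trans Hd].
  apply: rint_le; [exact: l2_sq (l2B lp lq)| |].
    have [lb _] := bt_mul_l2 r (l2B lu lv).
    have := l2_sq lb; congr intble; apply/funext => x; rewrite exprMn expr2 bt_sq//.
  move=> x; rewrite /p /q /mid; have := bt_sq r x; have := bt_ge0 r x.
  move: (bt r x) (u x) (v x) => b s t b0 bb.
  have -> : (b * (2^-1 * s + 2^-1 * t) - b * s) ^+ 2 = b * b * (s - t) ^+ 2 / 4 by field.
  by rewrite bb ler_pdivrMr//; have := mulr_ge0 b0 (sqr_ge0 (s - t)); clear; move: (b * _) => z; lra.
have S0 := sqrtr_ge0 M.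
have nS z : n2 leb z <= M -> nrm leb z <= Num.sqrt M by move=> h; apply: ler_wsqrtr.
have ps := nrmD lp lq.
have b1 := nS p (le_trans np mM); have b2 := nS q (le_trans nq uM).
have dd := DD_dist lp lq.
have big : nrm leb (fun x => p x - q x) * nrm leb (fun x => p x + q x) * (n2 leb p + n2 leb q) <=
    (d * (Num.sqrt M + Num.sqrt M)) * (M + M).
  apply: ler_pM; [by rewrite mulr_ge0 ?nrm_ge0|by rewrite addr_ge0 ?n2_ge0| |].
    apply: ler_pM; rewrite ?nrm_ge0//; apply: le_trans ps _; exact: lerD.
  by apply: lerD; [exact: le_trans np mM|exact: le_trans nq uM].
have le2 : 2 * e * n2 leb u ^+ 2 <= 2 * e * M ^+ 2.
  by rewrite ler_wpM2l ?mulr_ge0// lerXn2r ?nnegrE ?n2_ge0.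
have := le_trans (ler_norm _) (le_trans (eq_ind_r (fun z => z <= _) dd (distrC _ _)) big).
move: cut pm le2; rewrite -/q; clear.
move: (DD p) (DD q) (DD u) (DD (mid u v)) (2 * e * n2 leb u ^+ 2) (2 * e * M ^+ 2) => *; lra.
Qed.

Lemma radial_cauchy mu (I : R) (us : nat -> R3 -> R) : 0 < mu ->
  (forall n, Mrad (us n)) -> (fun n => hnorm2 mu (us n)) @ \oo --> I ->
  (forall w, Mrad w -> I <= hnorm2 mu w) ->
  exists s : nat -> nat, (forall n, (s n < s n.+1)%N) /\
    forall e : R, 0 < e -> exists N, forall n k, (N <= n)%N -> (N <= k)%N ->
      hnorm2 mu (fun x => us (s n) x - us (s k) x) <= e.
Proof.
move=> m0 Mu cI HI.
have Mu' n : [/\ l2 leb (us n), exists g, gradof (us n) g & DD (us n) = 1] by apply/MmuP; case: (Mu n).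
have lus n : l2 leb (us n) by case: (Mu' n).
have Dus n : DD (us n) = 1 by case: (Mu' n).
have rus n : radial (us n) by case: (Mu n).
have /choice[gs Hg] : forall n, exists g, gradof (us n) g by move=> n; case: (Mu' n).
have [B HB] : exists B, forall n, hnorm2 mu (us n) <= B.
  have [B [_ HB]] := cvg_seq_bounded (cvgP _ cI); exists (B + 1) => n.
  by apply: le_trans (ler_norm _) _; apply: HB => //; rewrite ltrDl.
pose M := B / mu.
have nM n : n2 leb (us n) <= M.
  rewrite ler_pdivlMr// mulrC; apply: le_trans (HB n).
  by rewrite (hnorm2E mu (lus n) (Hg n)) lerDr G3_ge0.
have M0 : 0 <= M := le_trans (n2_ge0 _ _) (nM 0%N).
have GB n : G3 (gs n) <= B.
  apply: le_trans (HB n); rewrite (hnorm2E mu (lus n) (Hg n)) lerDl.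
  by rewrite mulr_ge0 ?n2_ge0// ltW.
have B0 : 0 <= B := le_trans (G3_ge0 _) (GB 0%N).
have I0 : 0 <= I.
  by apply: le_cvg cI _ => n; exact: hnorm2_ge0 m0 (lus n) (Hg n).
have [s [si Hs]] : exists s : nat -> nat, (forall n, (s n < s n.+1)%N) /\
    forall r e : R, 0 < e -> exists N, forall n k, (N <= n)%N -> (N <= k)%N ->
      rint leb (fun x => bt r x * (us (s n) x - us (s k) x) ^+ 2) <= e.
  apply: (@rellich R us M (24 * B)) => //; first by rewrite mulr_ge0.
  move=> n t /andP[t0 t1]; apply: le_trans (Enr_le_grad (ltW t0) (lus n) (Hg n)) _.
  by rewrite ler_wpM2r ?exprn_ge0 ?(ltW t0)// ler_pM2l.
exists s; split=> // e e0.
(* The parallelogram identity will give at most [4 (I + eta) - 4 I (1 - eta) = eta (4 + 4 I)]. The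
   loss [eta] of [DD] at the midpoint is shared equally between the cutoff, through [e1], and the
   distance on the ball, through [d]. *)
pose eta := Num.min 2^-1 (e / (4 + 4 * I)).
have dI : 0 < 4 + 4 * I by lra.
have eta0 : 0 < eta by rewrite lt_min invr_gt0 divr_gt0//= ltr0n.
have eta1 : eta < 1 by rewrite gt_min; apply/orP; left; rewrite invf_lt1// ltr1n.
have etae : eta * (4 + 4 * I) <= e by rewrite -ler_pdivlMr// ge_min lexx orbT.
pose e1 := eta / (4 * (M ^+ 2 + 1)).
have M2 := sqr_ge0 M.
have dM : 0 < 4 * (M ^+ 2 + 1) by lra.
have e10 : 0 < e1 by rewrite divr_gt0.
have e1E : 2 * e1 * M ^+ 2 <= eta / 2.
  have -> : 2 * e1 * M ^+ 2 = eta / 2 * (M ^+ 2 / (M ^+ 2 + 1)) by rewrite /e1; field; apply: lt0r_neq0; lra.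
  by rewrite ler_piMr ?divr_ge0 ?(ltW eta0)// ler_pdivrMr; lra.
have [r r0 Hr] := ph_tail e10.
pose T := Num.sqrt M * M.
have T0 : 0 <= T by rewrite mulr_ge0// sqrtr_ge0.
pose d := eta / (8 * (T + 1)).
have dT : 0 < 8 * (T + 1) by lra.
have d0 : 0 < d by rewrite divr_gt0.
have dE : 4 * d * Num.sqrt M * M <= eta / 2.
  have -> : 4 * d * Num.sqrt M * M = eta / 2 * (T / (T + 1)).
    by rewrite -mulrA -/T /d; field; apply: lt0r_neq0; lra.
  by rewrite ler_piMr ?divr_ge0 ?(ltW eta0)// ler_pdivrMr; lra.
have [N1 HN1] := Hs r (d ^+ 2) (exprn_gt0 2 d0).
have [N2 _ HN2] : \forall n \near \oo, `|I - hnorm2 mu (us n)| <= eta.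
  by move/cvgrPdist_le: cI => /(_ eta eta0).
exists (maxn N1 N2) => n k; rewrite !geq_max => /andP[n1 n2'] /andP[k1 k2].
have hI j : (N2 <= j)%N -> hnorm2 mu (us (s j)) <= I + eta.
  move=> Nj; have := HN2 (s j) (leq_trans Nj (increasing_seq_ge si j)).
  by rewrite /= ler_norml => /andP[]; move: (hnorm2 _ _) => z; lra.
have h1 := hI n n2'; have h2 := hI k k2.
rewrite (parallelogram mu (lus (s n)) (lus (s k)) (Hg (s n)) (Hg (s k))).
have Dm : 1 - eta <= DD (mid (us (s n)) (us (s k))).
  have := DD_mid (ltW r0) (ltW e10) (ltW d0) (lus (s n)) (lus (s k)) (rus _)
    (fun x => Hr (us (s n)) x (lus _) (rus _)) (nM _) (nM _) (HN1 n k n1 k1).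
  by rewrite Dus; apply: le_trans; move: e1E dE; clear; move: (2 * e1 * _) (4 * d * _ * _) => *; lra.
have [lm _] := n2_mid (lus (s n)) (lus (s k)) (nM _) (nM _).
have gm := gradof_comb (2^-1) (2^-1) (lus (s n)) (lus (s k)) (Hg (s n)) (Hg (s k)).
have rm : radial (mid (us (s n)) (us (s k))).
  by move=> x y xy; rewrite /mid (rus _ _ _ xy) (rus _ _ _ xy).
have eta01 : 0 <= eta < 1 by rewrite ltW.
have := hnorm2_lb m0 I0 HI lm gm rm eta01 Dm.
move: h1 h2 etae; clear; move: (hnorm2 _ _) (hnorm2 _ _) (hnorm2 _ _) => *; nra.
Qed.

(** Cauchy in the norm means Cauchy in L2 for the functions and for each derivative. Weak
    derivatives are closed under L2 limits, [DD] is continuous on L2, and a [plim] of radial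
    functions is radial at every point, so the limit stays in [Mrad]. *)
Lemma radial_compact mu (I : R) (us : nat -> R3 -> R) : 0 < mu ->
  (forall n, Mrad (us n)) -> (fun n => hnorm2 mu (us n)) @ \oo --> I ->
  (forall w, Mrad w -> I <= hnorm2 mu w) ->
  exists (s : nat -> nat) u, [/\ forall n, (s n < s n.+1)%N, Mrad u, hnorm2 mu u = I &
    (fun n => hnorm mu (fun x => us (s n) x - u x)) @ \oo --> (0 : R)].
Proof.
move=> m0 Mu cI HI; have [s [si Hs]] := radial_cauchy m0 Mu cI HI.
pose vs n := us (s n).
have Mu' n : [/\ l2 leb (vs n), exists g, gradof (vs n) g & DD (vs n) = 1] by apply/MmuP; case: (Mu (s n)).
have lvs n : l2 leb (vs n) by case: (Mu' n).
have Dvs n : DD (vs n) = 1 by case: (Mu' n).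
have rvs n : radial (vs n) by case: (Mu (s n)).
have /choice[gs Hg] : forall n, exists g, gradof (vs n) g by move=> n; case: (Mu' n).
have lgs i n : l2 leb (gs n i) := (Hg n i).1.
have dE n k : hnorm2 mu (fun x => vs n x - vs k x) =
    G3 (fun i x => gs n i x - gs k i x) + mu * n2 leb (fun x => vs n x - vs k x).
  exact: hnorm2E (l2B (lvs n) (lvs k)) (gradof_B (lvs n) (lvs k) (Hg n) (Hg k)).
have cu : l2cauchy leb vs.
  move=> e e0; have [N HN] := Hs (mu * e) (mulr_gt0 m0 e0); exists N => n k Nn Nk.
  rewrite -(ler_pM2l m0); apply: le_trans (HN n k Nn Nk); rewrite -/(vs n) -/(vs k) dE lerDr.
  exact: G3_ge0.
have n2G i (z : 'I_3 -> R3 -> R) : n2 leb (z i) <= G3 z.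
  rewrite /G3; have a0 := n2_ge0 leb (z i0); have a1 := n2_ge0 leb (z i1); have a2 := n2_ge0 leb (z i2).
  have [->|->|->] : [\/ i = i0, i = i1 | i = i2].
    by case: i => [[|[|[|//]]] p]; [constructor 1|constructor 2|constructor 3]; exact: val_inj.
  - by move: a0 a1 a2; clear; move: (n2 _ _) (n2 _ _) (n2 _ _) => *; lra.
  - by move: a0 a1 a2; clear; move: (n2 _ _) (n2 _ _) (n2 _ _) => *; lra.
  - by move: a0 a1 a2; clear; move: (n2 _ _) (n2 _ _) (n2 _ _) => *; lra.
have cg i : l2cauchy leb (fun n => gs n i).
  move=> e e0; have [N HN] := Hs e e0; exists N => n k Nn Nk.
  apply: le_trans (HN n k Nn Nk); rewrite -/(vs n) -/(vs k) dE.
  apply: le_trans (n2G i (fun i x => gs n i x - gs k i x)) _.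
  by rewrite lerDl mulr_ge0 ?n2_ge0// ltW.
have [s' [si' []]] := l2_complete lvs cu.
set u := plim _ => lu cvu _.
have /choice[g Hgi] : forall i, exists g, l2 leb g /\ (fun n => n2 leb (fun x => gs n i x - g x)) @ \oo --> (0 : R).
  by move=> i; have [q [_ [lq cq _]]] := l2_complete (lgs i) (cg i); exists (plim (fun n => gs (q n) i)).
have gu : gradof u g.
  move=> i; have [lg cgi] := Hgi i; split=> //.
  exact: wpd_lim lvs (lgs i) lu lg (fun n => (Hg n i).2) cvu cgi.
have Du : DD u = 1.
  have c := DD_cvg lvs lu cvu.
  by apply/eqP; rewrite eq_le; apply/andP; split; [apply: (cvg_le c)|apply: (le_cvg c)] => n; rewrite Dvs.
have ru : radial u.
  move=> x y xy; rewrite /u /plim; congr (fine (limn_esup _)).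
  by apply/funext => n; congr EFin; exact: rvs.
have cN : (fun n => hnorm2 mu (fun x => vs n x - u x)) @ \oo --> (0 : R).
  have -> : (fun n => hnorm2 mu (fun x => vs n x - u x)) = (fun n =>
     n2 leb (fun x => gs n i0 x - g i0 x) + n2 leb (fun x => gs n i1 x - g i1 x) +
     n2 leb (fun x => gs n i2 x - g i2 x) + mu * n2 leb (fun x => vs n x - u x)).
    by apply/funext => n; rewrite (hnorm2E mu (l2B (lvs n) lu) (gradof_B (lvs n) lu (Hg n) gu)).
  rewrite [X in _ --> X](_ : 0 = 0 + 0 + 0 + mu * 0); last by rewrite mulr0 !addr0.
  apply: cvgD; last by apply: cvgM => //; exact: cvg_cst.
  by apply: cvgD; [apply: cvgD|]; exact: (Hgi _).2.
have cH : (fun n => hnorm2 mu (vs n)) @ \oo --> hnorm2 mu u.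
  have -> : (fun n => hnorm2 mu (vs n)) = (fun n =>
     n2 leb (gs n i0) + n2 leb (gs n i1) + n2 leb (gs n i2) + mu * n2 leb (vs n)).
    by apply/funext => n; rewrite (hnorm2E mu (lvs n) (Hg n)).
  rewrite (hnorm2E mu lu gu); apply: cvgD; last first.
    by apply: cvgM; [exact: cvg_cst|exact: cvg_n2].
  by apply: cvgD; [apply: cvgD|]; apply: cvg_n2 (Hgi _).2 => //; exact: (Hgi _).1.
exists s, u; split=> //.
- by split=> //; apply/MmuP; split=> //; exists g.
- have sub : s n @[n --> \oo] --> \oo.
    apply/cvgnyPge => N; exists N => // n /= Nn; exact: leq_trans Nn (increasing_seq_ge si n).
  have c2 : (fun n => hnorm2 mu (vs n)) @ \oo --> I by exact: cvg_comp sub cI.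
  by rewrite -(cvg_lim (@Rhausdorff R) cH) (cvg_lim (@Rhausdorff R) c2).
- rewrite -[X in _ --> X]sqrtr0; apply: continuous_cvg cN; exact: sqrt_continuous.
Qed.

End compactness.

(** * Existence of the radial minimiser and conclusion *)

Section final.
Context {R : realType}.
Local Notation R3 := (R3 R).
Local Notation leb := (leb R).
Implicit Types (u v w : R3 -> R) (x y h : R3) (mu : R).

(** Absolute values do not increase differences, so no [Enr t] increases and [gradof_compare]
    applies. *)
Lemma gradof_abs u g : l2 leb u -> gradof u g ->
  exists2 k, gradof (fun x => `|u x|) k & G3 k <= G3 g.
Proof.
move=> lu Hu; have la := l2_abs lu; apply: (@gradof_compare _ u g _ lu Hu la) => t t0.
apply: rint_le; [exact: dn_int (ltW t0) la|exact: dn_int (ltW t0) lu|move=> h].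
apply: ler_wpM2l; first exact: bt_ge0.
by apply: n2_le; [exact: dn_l2|exact: dn_l2|move=> x; exact: ler_dist_dist].
Qed.

Lemma negabs_M mu u : 0 < mu -> Mmu u -> Mmu (fun x => - `|u x|) /\
  hnorm2 mu (fun x => - `|u x|) <= hnorm2 mu u.
Proof.
move=> m0 /MmuP[lu [g Hu] Du].
have [k Hk kg] := gradof_abs lu Hu; have la := l2_abs lu.
have E : (fun x => - `|u x|) = (fun x => -1 * `|u x|) by apply/funext => x; rewrite mulN1r.
have nE : n2 leb (fun x => `|u x|) = n2 leb u.
  by congr rint; apply/funext => x; rewrite real_normK ?num_real.
split.
  apply/MmuP; split; first exact: l2N.
    by rewrite E; exists (fun i x => -1 * k i x); exact: gradofZ.
  by rewrite -Du; apply: eq_DD => x; rewrite sqrrN real_normK ?num_real.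
rewrite E (hnorm2Z mu (-1) la Hk) sqrrN expr1n mul1r (hnorm2E mu la Hk) (hnorm2E mu lu Hu) nE.
by rewrite lerD2r.
Qed.

(** As the kernel is at most 1, [DD u = 1] forces the L2 norm to be at least 1. The positivity of
    the minimum comes from here. *)
Lemma Mmu_lb mu u : 0 < mu -> Mmu u -> mu <= hnorm2 mu u.
Proof.
move=> m0 /MmuP[lu [g Hu] Du]; rewrite (hnorm2E mu lu Hu).
have n1 : 1 <= n2 leb u.
  have := DD_le lu; rewrite Du => h; rewrite leNgt; apply/negP => k.
  by have := n2_ge0 leb u; move: h k; move: (n2 leb u) => p; nra.
have g0 := G3_ge0 g; have : mu * 1 <= mu * n2 leb u by rewrite ler_wpM2l// ltW.
lra.
Qed.

(** Symmetrisation may push [DD] above 1; scaling back to the constraint then divides the squared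
    norm by [sqrt (DD w) >= 1], which is the favourable direction. *)
Lemma Mmu_radial mu v : 0 < mu -> Mmu v -> exists2 w, Mrad w & hnorm2 mu w <= hnorm2 mu v.
Proof.
move=> m0 /MmuP[lv [g Hv] Dv]; have [k Hk kg] := gradof_abs lv Hv; have la := l2_abs lv.
have [w [q [[rw lw Hq qk] [nw Dw]]]] := symmetrization la (fun x => normr_ge0 _) Hk.
have nE : n2 leb (fun x => `|v x|) = n2 leb v.
  by congr rint; apply/funext => x; rewrite real_normK ?num_real.
have DE : DD (fun x => `|v x|) = 1 by rewrite -Dv; apply: eq_DD => x; rewrite real_normK ?num_real.
rewrite DE in Dw; have D0 : 0 < DD w by exact: lt_le_trans Dw.
have [c [cM E c0]] := scale_in_Mrad mu lw Hq rw D0.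
exists (fun x => c * w x) => //.
have hw : hnorm2 mu w <= hnorm2 mu v.
  by rewrite (hnorm2E mu lw Hq) (hnorm2E mu lv Hv) nw nE lerD2r; exact: le_trans kg.
apply: le_trans hw; rewrite -E ler_peMr//.
  by case: cM => cM _; apply: le_trans (Mmu_lb m0 cM); exact: ltW.
by rewrite -sqrtr1; exact: ler_wsqrtr.
Qed.

(** A radial Lipschitz function of bounded support, introduced to show that [Mrad] is not empty; its
    weak gradient comes from [gradof_of_Enr] instead of a computation. *)
Definition hat x : R := Num.max 0 (1 - sq3 x).

Lemma sqr_le_norm (a L : R) : 0 <= L -> a ^+ 2 <= L ^+ 2 -> `|a| <= L.
Proof. by move=> L0 h; rewrite -(ler_pXn2r (ltn0Sn 1)) ?nnegrE// real_normK ?num_real. Qed.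

Lemma hat_box x : hat x != 0 -> box_le 1 x.
Proof.
rewrite /hat => H; have s1 : sq3 x <= 1.
  rewrite leNgt; apply/negP => h; move/eqP: H; apply; apply/max_idPl; lra.
by move: s1; rewrite /sq3 => s1; split; apply: sqr_le_norm => //; rewrite expr1n;
  have := sqr_ge0 x.1.1; have := sqr_ge0 x.1.2; have := sqr_ge0 x.2; move: s1; clear;
  move: (x.1.1 ^+ 2) (x.1.2 ^+ 2) (x.2 ^+ 2) => *; lra.
Qed.

Lemma hat01 x : 0 <= hat x <= 1.
Proof. by rewrite /hat le_max lexx/= ge_max ler01/= gerBl sq3_ge0. Qed.

Lemma hat_meas : measurable_fun setT hat.
Proof.
apply: measurable_maxr; first exact: measurable_cst.
by apply: measurable_funB; [exact: measurable_cst|exact: measurable_sq3].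
Qed.

Lemma hat_l2 : l2 leb hat.
Proof.
apply: (@bounded_bsupp_l2 _ hat 1 1); [exact: hat_meas| |exact: hat_box].
by move=> x; have /andP[a b] := hat01 x; rewrite ger0_norm.
Qed.

Lemma hat_n2 : 0 < n2 leb hat.
Proof.
have h0 : 0 < 2^-1 :> R by rewrite invr_gt0.
have v0 := vol_gt0 h0.
apply: (@lt_le_trans _ _ (4^-1 * vol (2^-1 : R))); first by rewrite mulr_gt0// invr_gt0.
rewrite /vol -(rintZ _ (bt_int (ltW h0))); apply: rint_le.
- by apply: intbleZ; exact: bt_int (ltW h0).
- exact: l2_sq hat_l2.
move=> x; rewrite /bt; case: (boolP (sq3 x <= 2^-1 ^+ 2)) => h; last by rewrite mulr0 sqr_ge0.
have : 1 - sq3 x <= hat x by rewrite /hat le_max lexx orbT.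
move: h; rewrite (_ : 2^-1 ^+ 2 = 4^-1 :> R); last by field.
move: (sq3 x) (hat x) => p q h1 h2; have h3 : 2^-1 <= q by lra.
by rewrite mulr1 (_ : 4^-1 = 2^-1 * 2^-1 :> R); [apply: ler_pM|field].
Qed.

Lemma max0_dist (a b : R) : `|Num.max 0 a - Num.max 0 b| <= `|a - b|.
Proof.
rewrite !maxEle; case: (leP 0 a) => a0; case: (leP 0 b) => b0 //.
- by rewrite subr0 !ger0_norm//; lra.
- by rewrite sub0r normrN (ger0_norm b0) ler0_norm; lra.
- by rewrite subrr normr0.
Qed.

Lemma sqr_incr (a t s : R) : `|a| <= 3 -> `|t| <= s -> s <= 2 -> `|(a + t) ^+ 2 - a ^+ 2| <= 8 * s.
Proof.
move=> a3 ts s2; have -> : (a + t) ^+ 2 - a ^+ 2 = (2 * a + t) * t by ring.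
rewrite normrM mulrC [leRHS]mulrC; apply: ler_pM => //.
by apply: le_trans (ler_normD _ _) _; rewrite normrM ger0_norm//; lra.
Qed.

(** For shifts of size at most 2, the range that [gradof_of_Enr] asks for, the difference lives in
    the box of size 3. There each of the three squares changes by at most [8 * s], hence the 24. *)
Lemma hat_dn (s : R) h : 0 <= s -> s <= 2 -> box_le s h ->
  dn hat h <= (24 * s * nrm leb (\1_(cbox (3 : R)))) ^+ 2.
Proof.
move=> s0 s2 [b1 b2 b3]; have ld := dn_l2 h hat_l2.
have supp : bsupp (fun x => tau h hat x - hat x) 3.
  move=> x /= H; have [z|nz] := eqVneq (hat x) 0; last first.
    by have [? ? ?] := hat_box nz; split; lra.
  move: H; rewrite z subr0 /tau => /hat_box[/= p1 p2 p3].
  have T (a t : R) : `|a + t| <= 1 -> `|t| <= s -> `|a| <= 3.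
    by move=> h1 h2; have -> : a = (a + t) - t; [ring|apply: le_trans (ler_normB _ _) _; lra].
  by split; [exact: T p1 b1|exact: T p2 b2|exact: T p3 b3].
have c0 : 0 <= 24 * s by rewrite mulr_ge0.
have bd x : `|tau h hat x - hat x| <= 24 * s.
  have [->|/supp [p1 p2 p3]] := eqVneq (tau h hat x - hat x) 0; first by rewrite normr0.
  apply: le_trans (max0_dist _ _) _.
  have -> : 1 - sq3 (add3 x h) - (1 - sq3 x) = - (((x.1.1 + h.1.1) ^+ 2 - x.1.1 ^+ 2) +
     ((x.1.2 + h.1.2) ^+ 2 - x.1.2 ^+ 2) + ((x.2 + h.2) ^+ 2 - x.2 ^+ 2)).
    by rewrite /sq3 /add3/=; ring.
  rewrite normrN; apply: le_trans (ler_normD _ _) _.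
  have := sqr_incr p1 b1 s2; have := sqr_incr p2 b2 s2; have := sqr_incr p3 b3 s2.
  have := ler_normD ((x.1.1 + h.1.1) ^+ 2 - x.1.1 ^+ 2) ((x.1.2 + h.1.2) ^+ 2 - x.1.2 ^+ 2).
  clear; move: `|_| `|_| `|_| `|_| => *; lra.
have := nrm_bound_box ld c0 bd supp.
by rewrite /dn -nrm_sqr => H; rewrite lerXn2r ?nnegrE ?mulr_ge0 ?nrm_ge0.
Qed.

Lemma exists_Mrad : exists u : R3 -> R, Mrad u.
Proof.
have lh := hat_l2.
pose N := nrm leb (\1_(cbox (3 : R))).
have [g Hg] : exists g, gradof hat g.
  apply: (@gradof_of_Enr _ hat (8 * (24 * N) ^+ 2) lh); first by rewrite mulr_ge0 ?sqr_ge0.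
  move=> s /andP[s0 s2]; have sn := ltW s0.
  apply: (@le_trans _ _ (rint leb (fun h => (24 * s * N) ^+ 2 * bt s h))).
    apply: rint_le; [exact: dn_int|by apply: intbleZ; exact: bt_int|move=> h].
    have [->|b0] := eqVneq (bt s h) 0; first by rewrite mul0r mulr0.
    by rewrite mulrC; apply: ler_wpM2r; [exact: bt_ge0|exact: hat_dn (bt_box sn b0)].
  rewrite (rintZ _ (bt_int sn)) -/(vol s).
  apply: (@le_trans _ _ ((24 * s * N) ^+ 2 * (8 * s ^+ 3))).
    by apply: ler_wpM2l; [exact: sqr_ge0|exact: vol_le].
  by rewrite le_eqVlt; apply/orP; left; apply/eqP; ring.
have rh : radial hat by move=> x y xy; rewrite /hat -!enorm_sq3 xy.
have [c [cM _ _]] := scale_in_Mrad 1 lh Hg rh (DD_gt0 lh hat_n2).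
by exists (fun x => c * hat x).
Qed.

Lemma Rintegral_eq0 d (T : measurableType d) (m : {measure set T -> \bar R}) (D : set T)
  (g : T -> R) : (forall z, D z -> g z = 0) -> Rintegral m D g = 0.
Proof.
move=> H; rewrite /Rintegral (eq_integral (fun=> 0%E)) ?integral0// => x.
by rewrite inE => /H ->.
Qed.

Section primitive.
Variable f : R -> R.
Hypotheses (fpos : forall t, 0 <= t -> 0 <= f t) (fneg : forall t, t <= 0 -> f t = 0).

Lemma primF_ge0 t : 0 <= primF f t.
Proof.
rewrite /primF; case: (leP 0 t) => t0.
  by apply: Rintegral_ge0 => x /=; rewrite in_itv/= => /andP[x0 _]; exact: fpos.
rewrite oppr_ge0 Rintegral_eq0// => x /=; rewrite in_itv/= => /andP[_]; exact: fneg.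
Qed.

Lemma primF_le0 t : t <= 0 -> primF f t = 0.
Proof.
move=> t0; rewrite /primF; case: (leP 0 t) => t1; rewrite Rintegral_eq0 ?oppr0// => x /=;
  rewrite in_itv/= => /andP[_ xt]; apply: fneg => //; exact: le_trans xt t0.
Qed.

(** The nonlinear term is nonnegative even if its integral diverges, since [Rintegral] then takes
    the value 0. *)
Lemma Emu_ge mu u : hnorm2 mu u / 2 <= Emu mu f u.
Proof. by rewrite /Emu lerDl; apply: Rintegral_ge0 => x _; exact: primF_ge0. Qed.

Lemma Emu_le0 mu u : (forall x, u x <= 0) -> Emu mu f u = hnorm2 mu u / 2.
Proof.
move=> u0; rewrite /Emu; have -> : Rintegral (@leb3 R) setT (fun x => primF f (u x)) = 0.
  by apply: (Rintegral_eq0 leb) => x _; rewrite primF_le0.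
by rewrite addr0.
Qed.

End primitive.

Lemma inf_eq (E : set R) (m : R) : E m -> lbound E m -> inf E = m.
Proof.
move=> Em lb; apply/eqP; rewrite eq_le; apply/andP; split.
  by apply: ge_inf => //; exists m.
by apply: lb_le_inf => //; exists m.
Qed.

Lemma radial_minimiser mu : 0 < mu ->
  exists2 u : R3 -> R, Mrad u & forall w, Mrad w -> hnorm2 mu u <= hnorm2 mu w.
Proof.
move=> m0; pose E := [set hnorm2 mu u | u in @Mrad R].
have E0 : has_inf E.
  split; first by have [u Mu] := exists_Mrad; exists (hnorm2 mu u); exists u.
  by exists mu => _ [u [Mu _] <-]; exact: Mmu_lb.
have lb w : Mrad w -> inf E <= hnorm2 mu w.
  by move=> Mw; apply: ge_inf; [exact: E0.2|exists w].
have /choice[us Hus] : forall n : nat, exists u, Mrad u /\ hnorm2 mu u < inf E + n.+1%:R^-1.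
  move=> n; have n0 : 0 < n.+1%:R^-1 :> R by rewrite invr_gt0.
  by have [_ [u Mu <-] h] := inf_adherent n0 E0; exists u.
have Mus n : Mrad (us n) := (Hus n).1.
have c : (fun n => hnorm2 mu (us n)) @ \oo --> inf E.
  have c1 : (fun n => inf E + n.+1%:R^-1) @ \oo --> inf E.
    rewrite -[X in _ --> X]addr0; apply: cvgD; [exact: cvg_cst|exact: cvg_harmonic].
  apply: squeeze_cvgr (cvg_cst (inf E)) c1; near=> n.
  by rewrite lb//= ltW// (Hus n).2.
have [_ [u [_ Mu hu _]]] := radial_compact m0 Mus c lb.
by exists u => // w Mw; rewrite hu; exact: lb.
Unshelve. all: by end_near. Qed.

End final.

Theorem theorem4p3 (R : realType) (mu : R) (f : R -> R) :
  0 < mu ->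
  continuous f ->
  (forall t, 0 <= t -> 0 <= f t) ->
  (forall t, t <= 0 -> f t = 0) ->
  (exists q : R, 2 < q < 6 /\
     (fun t => f t / t `^ (q - 1)) @ +oo --> (0 : R)) ->
  (fun t => f t / t) @ 0^' --> (0 : R) ->
  (* (1) every minimising sequence for E_mu on M_rad,mu converges in H^1_mu
         (up to a subsequence) *)
  (forall us : nat -> R3 R -> R,
     (forall n, Mrad (us n)) ->
     (fun n => Emu mu f (us n)) @ \oo --> inf [set Emu mu f v | v in @Mrad R] ->
     exists (sigma : nat -> nat) (u : R3 R -> R),
       (forall n, (sigma n < sigma n.+1)%N) /\ H1 u /\
       (fun n => hnorm mu (fun x => us (sigma n) x - u x)) @ \oo --> (0 : R)) /\
  (* (2) m_rad,mu = m_mu is attained at a radial, nonpositive u, with the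
         stated properties *)
  (exists u : R3 R -> R,
     Mrad u /\
     Emu mu f u = inf [set Emu mu f v | v in @Mrad R] /\
     Emu mu f u = inf [set Emu mu f v | v in @Mmu R] /\
     (forall v, Mmu v -> Emu mu f u <= Emu mu f v) /\
     0 < Emu mu f u /\
     (forall x, u x <= 0) /\
     Emu mu f u = hnorm2 mu u / 2).
Proof.
move=> m0 _ fpos fneg _ _.
have [u0 Mu0 min0] := radial_minimiser m0.
pose u x := - `|u0 x|.
have [Mu hu] := negabs_M m0 Mu0.1.
have un x : u x <= 0 by rewrite oppr_le0.
have Mru : Mrad u by split=> // x y /Mu0.2 E; rewrite /u E.
have min w : Mrad w -> hnorm2 mu u <= hnorm2 mu w by move=> /min0; exact: le_trans.
have Eu : Emu mu f u = hnorm2 mu u / 2 by exact: Emu_le0.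
have minE v : Mmu v -> Emu mu f u <= Emu mu f v.
  move=> Mv; have [w Mw wv] := Mmu_radial m0 Mv.
  apply: le_trans (Emu_ge fpos fneg mu v); rewrite Eu ler_pM2r ?invr_gt0//.
  exact: le_trans (min w Mw) wv.
have infrad : inf [set Emu mu f v | v in @Mrad R] = Emu mu f u.
  by apply: inf_eq; [exists u|move=> _ [v [Mv _] <-]; exact: minE].
have infall : inf [set Emu mu f v | v in @Mmu R] = Emu mu f u.
  by apply: inf_eq; [exists u|move=> _ [v Mv <-]; exact: minE].
split; last first.
  exists u; rewrite infrad infall; do 4!split=> //.
  split; last by split.
  by rewrite Eu divr_gt0// (lt_le_trans m0)// Mmu_lb.
move=> us Mus; rewrite infrad Eu => cE.
(* [hnorm2] is squeezed between its minimum and twice the energy, so a minimising sequence of the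
   energy also minimises the norm, and [radial_compact] applies to it. *)
have c2 : (fun n => 2 * Emu mu f (us n)) @ \oo --> hnorm2 mu u.
  rewrite (_ : hnorm2 mu u = 2 * (hnorm2 mu u / 2)); last by field.
  by apply: cvgM cE; exact: cvg_cst.
have c : (fun n => hnorm2 mu (us n)) @ \oo --> hnorm2 mu u.
  apply: squeeze_cvgr (cvg_cst (hnorm2 mu u)) c2; near=> n.
  rewrite min//= mulrC -ler_pdivrMr//; exact: Emu_ge.
have [s [w [si [[Hw _] _] _ cw]]] := radial_compact m0 Mus c min.
by exists s, w; split=> //; split.
Unshelve. all: by end_near. Qed.
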